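(* (Right sketching.) Let $A\in\mathbb{R}^{n\times d}$, let $k\ge1$ satisfy $k\le\mathrm{rank}(A)$ and $\sigma_k(A)>\sigma_{k+1}(A)$, and let $b=f+\xi\in\mathbb{R}^n$ be as in the fixed design model. Let $\nu,\delta\in(0,1/2)$ and denote $$\epsilon=\frac{\nu}{1+\nu}\cdot\mathrm{gap}_k(A).$$ Suppose that $G$ is sampled (independently of $b$) from a distribution that has the $(\epsilon,\delta)$-approximate Gram matrix property for $A^{T}$. Then for $R=G^{T}$, with probability at least $1-\delta$ over $G$, the approximate solution $Ax_{R,k}$ is a $(\nu,\nu)$-approximate PCP of rank $k$ and $$\mathcal{E}(x_{R,k})\le\mathcal{E}(x_k)+\frac{(2\nu+\nu^2)\|f\|_2^2}{n}.$$ Moreover, the condition on $G$ is met if $G$ is a CountSketch matrix with $\Omega\!\left(\frac{\mathrm{sr}(A)^2}{\mathrm{gap}_k(A)^2\nu^2\delta}\right)$ rows, and also if $G$ is a subgaussian map with $\Omega\!\left(\frac{\mathrm{sr}(A)+\log(1/\delta)}{\mathrm{gap}_k(A)^2\nu^2}\right)$ rows.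
   Context: $\|\cdot\|_2$ is the Euclidean/spectral norm. $\sigma_1(X)\ge\sigma_2(X)\ge\cdots$ are the singular values of $X$ (with $\sigma_{k+1}$ read as $0$ if $k$ equals the smaller dimension). For $X\in\mathbb{R}^{m\times n}$ with thin SVD $X=U_X\Sigma_XV_X^{T}$, $U_{X,k},V_{X,k}$ are the first $k$ columns of $U_X,V_X$ and $U_{X,k+}$ the last $\min(m,n)-k$ columns of $U_X$; statements are meant for any such decomposition. $\mathrm{gap}_k(X)=(\sigma_k(X)^2-\sigma_{k+1}(X)^2)/\sigma_1(X)^2$ and $\mathrm{sr}(X)=\|X\|_F^2/\|X\|_2^2$. $X^{+}$ is the Moore–Penrose pseudo-inverse and $P_X$ the orthogonal projection onto the column space of $X$. $x_k=\arg\min_{x\in\mathrm{range}(V_{A,k})}\|Ax-b\|_2$, $b_k=Ax_k$, and $x_{R,k}=RV_{AR,k}(ARV_{AR,k})^{+}b$. A vector $\tilde b\in\mathbb{R}^n$ is an $(\epsilon',\upsilon)$-approximate PCP of rank $k$ if $\big|\,\|\tilde b-b\|_2-\|b_k-b\|_2\big|\le\epsilon'\|b\|_2$ and $\|U_{A,k+}^{T}\tilde b\|_2\le\upsilon\|b\|_2$. For a fixed $X\in\mathbb{R}^{m\times n}$ and $\epsilon,\delta\in(0,1/2)$, a distribution $\mathcal{D}$ on matrices with $m$ columns has the $(\epsilon,\delta)$-approximate Gram matrix property for $X$ if $\Pr_{S\sim\mathcal{D}}\big(\|X^{T}S^{T}SX-X^{T}X\|_2\ge\epsilon\|X\|_2^2\big)\le\delta$.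 Fixed design model: $A$ and $f\in\mathbb{R}^n$ are fixed, $b=f+\xi$ where the entries of $\xi$ are independent with mean $0$ and variance $\sigma^2$. $x^\star$ is the minimum-norm minimizer of $\mathbb{E}[\|Ax-b\|_2^2/n]$ (so $Ax^\star=P_Af$). $\mathcal{E}(\theta)=\mathbb{E}[\|A\theta-Ax^\star\|_2^2/n]$, with expectation over $\xi$ only (the sketch $G$ being held fixed). A CountSketch matrix is a random matrix whose columns are independent, each being a uniformly random standard basis vector multiplied by an independent uniform random sign. A subgaussian map with $t$ rows is a random matrix whose entries are $t^{-1/2}$ times i.i.d. samples from a mean-zero, unit-variance subgaussian distribution (e.g. $N(0,1)$). ''$\Omega(\cdot)$ rows'' means at least a sufficiently large constant (absolute for CountSketch, depending only on the subgaussian distribution for subgaussian maps) times the quantity in parentheses. *)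

(* Defs.v *)
From HB Require Import structures.
From mathcomp Require Import all_boot all_order all_algebra.
From mathcomp Require Import all_classical all_reals all_analysis.

Set Implicit Arguments.
Unset Strict Implicit.
Unset Printing Implicit Defensive.

Import Order.TTheory GRing.Theory Num.Theory.
Import numFieldNormedType.Exports.

Local Open Scope classical_set_scope.
Local Open Scope ring_scope.

Section LinearAlgebra.
Variable R : realType.

(* Euclidean norm; the library's `|x| on matrices is the sup norm. *)
Definition norm2 m (x : 'cV[R]_m) : R := Num.sqrt (\sum_(i < m) x i 0 ^+ 2).

Definition frobenius_norm m n (X : 'M[R]_(m, n)) : R :=
  Num.sqrt (\sum_(i < m) \sum_(j < n) X i j ^+ 2).

Definition spectral_norm m n (X : 'M[R]_(m, n)) : R :=
  sup [set norm2 (X *m v) | v in [set v : 'cV[R]_n | norm2 v <= 1]].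

Definition stable_rank m n (X : 'M[R]_(m, n)) : R :=
  frobenius_norm X ^+ 2 / spectral_norm X ^+ 2.

Definition thin_svd m n (X : 'M[R]_(m, n)) (U : 'M[R]_(m, minn m n))
    (s : 'rV[R]_(minn m n)) (V : 'M[R]_(n, minn m n)) : Prop :=
  [/\ U^T *m U = 1%:M,
      V^T *m V = 1%:M,
      forall i, 0 <= s 0 i,
      forall i j : 'I_(minn m n), (i <= j)%N -> s 0 j <= s 0 i
    & X = U *m diag_mx s *m V^T].

(* The diagonal of any thin SVD of X; it does not depend on the choice. *)
Definition singular_values m n (X : 'M[R]_(m, n)) : 'rV[R]_(minn m n) :=
  xget 0 [set s | exists U V, thin_svd X U s V].

(* sigma_k(X), counted from k = 1; the sum has at most one term and is 0 when
   k > minn m n. *)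
Definition singular_value m n (X : 'M[R]_(m, n)) (k : nat) : R :=
  \sum_(j < minn m n | j.+1 == k) singular_values X 0 j.

Definition gap m n (k : nat) (X : 'M[R]_(m, n)) : R :=
  (singular_value X k ^+ 2 - singular_value X k.+1 ^+ 2)
    / singular_value X 1 ^+ 2.

(* The first k columns (all of them if there are fewer than k). *)
Definition first_cols m r (k : nat) (U : 'M[R]_(m, r)) : 'M[R]_(m, minn k r) :=
  colsub (widen_ord (geq_minr k r)) U.

Lemma last_ord_subproof r k (j : 'I_(r - k)) : (k + j < r)%N.
Proof. by rewrite -ltn_subRL. Qed.

Definition last_ord r k (j : 'I_(r - k)) : 'I_r :=
  Ordinal (last_ord_subproof j).

Definition last_cols m r (k : nat) (U : 'M[R]_(m, r)) : 'M[R]_(m, r - k) :=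
  colsub (@last_ord r k) U.

(* Moore-Penrose pseudo-inverse; the library's pinvmx only satisfies
   X *m Y *m X = X in general. *)
Definition mp_inverse m n (X : 'M[R]_(m, n)) (Y : 'M[R]_(n, m)) : Prop :=
  [/\ X *m Y *m X = X, Y *m X *m Y = Y,
      (X *m Y)^T = X *m Y & (Y *m X)^T = Y *m X].

Definition mp_pinv m n (X : 'M[R]_(m, n)) : 'M[R]_(n, m) :=
  xget 0 [set Y | mp_inverse X Y].

(* x_k = argmin of |A x - b|_2 over x in range(V_k); unique when
   sigma_k(A) > 0. *)
Definition pcr_solution n d r (A : 'M[R]_(n, d)) (V : 'M[R]_(d, r)) (k : nat)
    (b : 'cV[R]_n) : 'cV[R]_d :=
  let range : set 'cV[R]_d :=
    [set x | exists z : 'cV[R]_(minn k r), x = first_cols k V *m z] in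
  xget 0 [set x | range x /\
    forall y, range y -> norm2 (A *m x - b) <= norm2 (A *m y - b)].

(* x_{R,k} = S V_{AS,k} (A S V_{AS,k})^+ b for a right sketch S, where V is the
   right factor of a thin SVD of A S. *)
Definition sketched_pcr_solution n d t r (A : 'M[R]_(n, d)) (S : 'M[R]_(d, t))
    (V : 'M[R]_(t, r)) (k : nat) (b : 'cV[R]_n) : 'cV[R]_d :=
  S *m first_cols k V *m mp_pinv (A *m S *m first_cols k V) *m b.

(* U and V are the factors of a thin SVD of A, and b_k = A x_k. *)
Definition approx_pcp n d r (A : 'M[R]_(n, d)) (U : 'M[R]_(n, r))
    (V : 'M[R]_(d, r)) (k : nat) (eps ups : R) (b bt : 'cV[R]_n) : Prop :=
  `| norm2 (bt - b) - norm2 (A *m pcr_solution A V k b - b) | <= eps * norm2 b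
  /\ norm2 ((last_cols k U)^T *m bt) <= ups * norm2 b.

End LinearAlgebra.

Section Probability.
Context {R : realType} {dT : measure_display} {T : measurableType dT}.
Variable P : probability T R.

(* Each F i is meant to be a sigma-algebra. *)
Definition independent_systems (I : finType) (F : I -> set (set T)) : Prop :=
  forall (J : {set I}) (E : I -> set T), (forall i, F i (E i)) ->
    P (\bigcap_(i in [set` J]) E i) = (\prod_(i in J) P (E i))%E.

Definition independent_RVs (I : finType) (X : I -> T -> R) : Prop :=
  independent_systems (fun i => preimage_set_system setT (X i) measurable).

Definition random_matrix m n (G : T -> 'M[R]_(m, n)) : Prop :=
  forall i j, measurable_fun setT (fun w => G w i j).

Definition gram_property m n s (G : T -> 'M[R]_(s, m)) (X : 'M[R]_(m, n))
    (eps del : R) : Prop :=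
  (P [set w | (eps * spectral_norm X ^+ 2 <=
        spectral_norm (X^T *m (G w)^T *m G w *m X - X^T *m X))%R]
    <= del%:E)%E.

(* Column j of G is (-1)^(e j) times the standard basis vector of index h j. *)
Definition countsketch s m (G : T -> 'M[R]_(s, m)) : Prop :=
  random_matrix G /\
  exists (h : 'I_m -> T -> 'I_s) (e : 'I_m -> T -> bool),
  [/\ forall j i, measurable [set w | h j w = i] /\
        P [set w | h j w = i] = (s%:R^-1)%:E,
      forall j c, measurable [set w | e j w = c] /\
        P [set w | e j w = c] = (2^-1)%:E,
      independent_systems (fun a : 'I_m + 'I_m =>
        match a with
        | inl j => preimage_set_system setT (h j) setT
        | inr j => preimage_set_system setT (e j) setT
        end)
    & {ae P, forall w,
        G w = \matrix_(i, j) ((h j w == i)%:R * (-1) ^+ (e j w))}].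

Definition sketch_with_law (D : probability (measurableTypeR R) R) t m
    (G : T -> 'M[R]_(t, m)) : Prop :=
  exists Z : 'I_t * 'I_m -> T -> R,
  [/\ forall a, measurable_fun setT (Z a),
      forall a (B : set (measurableTypeR R)), measurable B ->
        P (Z a @^-1` B) = D B,
      independent_RVs Z
    & forall w, G w = \matrix_(i, j) ((Num.sqrt t%:R)^-1 * Z (i, j) w)].

(* Additive noise of the fixed design model, with variance tau ^+ 2. *)
Definition fixed_design_noise n (xi : T -> 'cV[R]_n) (tau : R) : Prop :=
  [/\ random_matrix xi,
      independent_RVs (fun (i : 'I_n) w => xi w i 0),
      forall i, ('E_P[fun w => (xi w i 0)%R] = 0)%E
    & forall i, ('V_P[fun w => (xi w i 0)%R] = (tau ^+ 2)%:E)%E].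

Definition mean_sq_error n d (A : 'M[R]_(n, d)) (b : T -> 'cV[R]_n)
    (x : 'cV[R]_d) : \bar R :=
  ('E_P[fun w => (norm2 (A *m x - b w) ^+ 2 / n%:R)%R])%E.

Definition optimal_param n d (A : 'M[R]_(n, d)) (b : T -> 'cV[R]_n)
    : 'cV[R]_d :=
  let minimizers : set 'cV[R]_d :=
    [set x | forall y, (mean_sq_error A b x <= mean_sq_error A b y)%E] in
  xget 0 [set x | minimizers x /\
    forall y, minimizers y -> norm2 x <= norm2 y].

(* theta is an estimator, i.e. depends on the sample through b. *)
Definition excess_risk n d (A : 'M[R]_(n, d)) (b : T -> 'cV[R]_n)
    (theta : T -> 'cV[R]_d) : \bar R :=
  ('E_P[fun w => (norm2 (A *m theta w - A *m optimal_param A b) ^+ 2 / n%:R)%R])%E.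

End Probability.

(* Subgaussianity is stated as the two-sided tail bound; it is equivalent, up to
   the value of K, to the moment and Orlicz-norm forms. *)
Definition subgaussian_law (R : realType)
    (D : probability (measurableTypeR R) R) : Prop :=
  [/\ ('E_D[fun x : measurableTypeR R => (x : R)] = 0)%E,
      ('V_D[fun x : measurableTypeR R => (x : R)] = 1)%E
    & exists2 K : R, 0 < K & forall u : R, 0 <= u ->
        (D [set x | (u <= `|x : R|)%R] <= (2 * expR (- (u ^+ 2 / K ^+ 2)))%:E)%E].

(* Main.v *)
Require Import Defs.
From HB Require Import structures.
From mathcomp Require Import all_boot all_order all_algebra.
From mathcomp Require Import all_classical all_reals all_analysis.
From mathcomp Require Import measurable_realfun ring lra.

Set Implicit Arguments.
Unset Strict Implicit.
Unset Printing Implicit Defensive.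

Import Order.TTheory GRing.Theory Num.Theory.
Import numFieldNormedType.Exports.

Local Open Scope classical_set_scope.
Local Open Scope ring_scope.

(* Write P and P' for the orthogonal projections onto the spans of the first k
   left singular vectors of A and of AR.  Then A x_k = P b and A x_{R,k} = P' b,
   so the first part reduces to |P' b - P b| <= nu |b|.  Weyl's inequality keeps
   s_k(AR) above s_{k+1}(A) and s_{k+1}(AR) below s_k(A), and Davis-Kahan bounds
   both (1 - P) P' and P (1 - P') by nu; the two pieces of P' - P have
   orthogonal images and act on the orthogonal vectors P' b and (1 - P') b, which
   gives nu instead of sqrt 2 nu.  The noise contributes k tau^2 / n to both
   risks, so only the bias P' f - P f matters.

   For CountSketch the expected squared Frobenius error of the Gram matrix is at
   most 2 |A|_F^4 / t.  For subgaussian maps, cut the singular values of A into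
   consecutive blocks of length q ~ sr(A); the squares of the leading values of
   the blocks sum to at most 2 |A|_2^2.  The error is then controlled by its
   quadratic forms on pairs of blocks, hence on lattice nets with 2^O(q) points
   in 2q dimensions.  Weighting a pair of blocks by the product of the squares
   of its leading values and taking 2m-th moments turns the whole estimate into
   one application of Markov's inequality, with no union bound over the pairs. *)

(** The objects [singular_values], [pcr_solution], [mp_pinv] and [optimal_param] are chosen by
    [xget], with a default when nothing qualifies. Each use therefore exhibits a witness and shows
    that all admissible choices agree in what matters; of a solution x only A x enters the
    conclusions.

    For subgaussian maps the obstacle is to obtain sr(A) in place of rank(A). A net of the whole
    range costs 2^O(rank). A pair of blocks has dimension at most 2 q, but a union bound over the
    pairs would bring in the logarithm of their number. The pairs are instead averaged with weights
    of total mass at most 1, so a bound by delta for the moment of each pair is a bound for all of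
    them together. The power m has to beat both the net, of size 2^O(q), and 1/delta; hence m ~
    sr(A) + log(1/delta), and moments of order 2m are small at scale eps once t is a large multiple
    of m / eps^2. *)

Section InnerProduct.
Variable R : realType.

Definition dotv m (u v : 'cV[R]_m) : R := (u^T *m v) 0 0.

Lemma dotvE m (u v : 'cV[R]_m) : dotv u v = \sum_i u i 0 * v i 0.
Proof. by rewrite /dotv mxE; apply: eq_bigr => i _; rewrite mxE. Qed.

Lemma dotvC m (u v : 'cV[R]_m) : dotv u v = dotv v u.
Proof. by rewrite !dotvE; apply: eq_bigr => i _; rewrite mulrC. Qed.

Lemma dotvDr m (u v w : 'cV[R]_m) : dotv u (v + w) = dotv u v + dotv u w.
Proof. by rewrite /dotv mulmxDr mxE. Qed.

Lemma dotvDl m (u v w : 'cV[R]_m) : dotv (v + w) u = dotv v u + dotv w u.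
Proof. by rewrite dotvC dotvDr !(dotvC u). Qed.

Lemma dotvZr m a (u v : 'cV[R]_m) : dotv u (a *: v) = a * dotv u v.
Proof. by rewrite /dotv -scalemxAr mxE. Qed.

Lemma dotvZl m a (u v : 'cV[R]_m) : dotv (a *: u) v = a * dotv u v.
Proof. by rewrite dotvC dotvZr dotvC. Qed.

Lemma dotvNr m (u v : 'cV[R]_m) : dotv u (- v) = - dotv u v.
Proof. by rewrite -scaleN1r dotvZr mulN1r. Qed.

Lemma dotvNl m (u v : 'cV[R]_m) : dotv (- u) v = - dotv u v.
Proof. by rewrite dotvC dotvNr dotvC. Qed.

Lemma dotvBr m (u v w : 'cV[R]_m) : dotv u (v - w) = dotv u v - dotv u w.
Proof. by rewrite dotvDr dotvNr. Qed.

Lemma dotvBl m (u v w : 'cV[R]_m) : dotv (v - w) u = dotv v u - dotv w u.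
Proof. by rewrite dotvDl dotvNl. Qed.

Lemma dotv0r m (u : 'cV[R]_m) : dotv u 0 = 0.
Proof. by rewrite /dotv mulmx0 mxE. Qed.

Lemma dotv0l m (u : 'cV[R]_m) : dotv 0 u = 0.
Proof. by rewrite dotvC dotv0r. Qed.

Lemma dotv_mull m n (M : 'M[R]_(m, n)) u v :
  dotv (M *m u) v = dotv u (M^T *m v).
Proof. by rewrite /dotv trmx_mul mulmxA. Qed.

Lemma dotv_mulr m n (M : 'M[R]_(m, n)) u v :
  dotv u (M *m v) = dotv (M^T *m u) v.
Proof. by rewrite dotvC dotv_mull dotvC. Qed.

Lemma dotv_sumr m (I : Type) (r : seq I) (P : pred I) u (F : I -> 'cV[R]_m) :
  dotv u (\sum_(i <- r | P i) F i) = \sum_(i <- r | P i) dotv u (F i).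
Proof. by rewrite /dotv mulmx_sumr summxE. Qed.

Lemma dotv_suml m (I : Type) (r : seq I) (P : pred I) u (F : I -> 'cV[R]_m) :
  dotv (\sum_(i <- r | P i) F i) u = \sum_(i <- r | P i) dotv (F i) u.
Proof. by rewrite dotvC dotv_sumr; apply: eq_bigr => i _; rewrite dotvC. Qed.

Lemma dotvv_ge0 m (u : 'cV[R]_m) : 0 <= dotv u u.
Proof. by rewrite dotvE; apply: sumr_ge0 => i _; rewrite -expr2 sqr_ge0. Qed.

Lemma dotv_pythagoras m (u v : 'cV[R]_m) :
  dotv u v = 0 -> dotv (u + v) (u + v) = dotv u u + dotv v v.
Proof. by move=> e; rewrite dotvDl !dotvDr e (dotvC v) e addr0 add0r. Qed.

Lemma norm2_sqr m (u : 'cV[R]_m) : norm2 u ^+ 2 = dotv u u.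
Proof.
rewrite /norm2 sqr_sqrtr; last by apply: sumr_ge0 => i _; rewrite sqr_ge0.
by rewrite dotvE; apply: eq_bigr => i _; rewrite expr2.
Qed.

Lemma norm2_ge0 m (u : 'cV[R]_m) : 0 <= norm2 u.
Proof. exact: sqrtr_ge0. Qed.

Lemma norm2E m (u : 'cV[R]_m) : norm2 u = Num.sqrt (dotv u u).
Proof. by rewrite -norm2_sqr sqrtr_sqr ger0_norm ?norm2_ge0. Qed.

Lemma dotvv_eq0 m (u : 'cV[R]_m) : dotv u u = 0 -> u = 0.
Proof.
rewrite dotvE => /eqP; rewrite psumr_eq0; last first.
  by move=> i _; rewrite -expr2 sqr_ge0.
move=> /allP h; apply/matrixP => i j; rewrite ord1 mxE.
by have := h i (mem_index_enum _); rewrite -expr2 sqrf_eq0 => /eqP.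
Qed.

Lemma norm2_0 m : norm2 (0 : 'cV[R]_m) = 0.
Proof. by rewrite norm2E dotv0r sqrtr0. Qed.

Lemma norm2_gt0 m (u : 'cV[R]_m) : u != 0 -> 0 < norm2 u.
Proof.
move=> u0; rewrite lt_def norm2_ge0 andbT; apply: contra u0 => /eqP e.
by apply/eqP/dotvv_eq0; rewrite -norm2_sqr e expr0n.
Qed.

Lemma norm2Z m a (u : 'cV[R]_m) : norm2 (a *: u) = `|a| * norm2 u.
Proof.
by rewrite !norm2E dotvZl dotvZr mulrA -expr2 sqrtrM ?sqr_ge0 // sqrtr_sqr.
Qed.

Lemma norm2N m (u : 'cV[R]_m) : norm2 (- u) = norm2 u.
Proof. by rewrite -scaleN1r norm2Z normrN1 mul1r. Qed.

Lemma norm2_le m p (u : 'cV[R]_m) (v : 'cV[R]_p) :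
  (norm2 u <= norm2 v) = (dotv u u <= dotv v v).
Proof. by rewrite -!norm2_sqr ler_sqr ?nnegrE ?norm2_ge0. Qed.

Lemma norm2_leM m p (u : 'cV[R]_m) (v : 'cV[R]_p) c : 0 <= c ->
  (norm2 u <= c * norm2 v) = (dotv u u <= c ^+ 2 * dotv v v).
Proof.
by move=> c0; rewrite -!norm2_sqr -exprMn ler_sqr ?nnegrE ?mulr_ge0 ?norm2_ge0.
Qed.

Lemma dotv_CS m (u v : 'cV[R]_m) : `|dotv u v| <= norm2 u * norm2 v.
Proof.
have [->|v0] := eqVneq v 0; first by rewrite dotv0r normr0 norm2_0 mulr0.
have nv := norm2_gt0 v0.
rewrite -ler_sqr ?nnegrE ?mulr_ge0 ?norm2_ge0 // real_normK ?num_real//.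
rewrite exprMn !norm2_sqr.
have vv : 0 < dotv v v by rewrite -norm2_sqr exprn_gt0.
have := dotvv_ge0 (dotv v v *: u - dotv u v *: v).
rewrite !(dotvBl, dotvBr, dotvZl, dotvZr) (dotvC v u) => h.
rewrite -(ler_pM2r vv).
nra.
Qed.

Lemma ler_norm2D m (u v : 'cV[R]_m) : norm2 (u + v) <= norm2 u + norm2 v.
Proof.
rewrite -ler_sqr ?nnegrE ?addr_ge0 ?norm2_ge0 // sqrrD !norm2_sqr.
rewrite dotvDl !dotvDr (dotvC v u).
have := dotv_CS u v; have := ler_norm (dotv u v); lra.
Qed.

Lemma ler_norm2B m (u v : 'cV[R]_m) : norm2 (u - v) <= norm2 u + norm2 v.
Proof. by rewrite (le_trans (ler_norm2D _ _)) ?norm2N. Qed.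

Lemma ler_dist_norm2 m (u v : 'cV[R]_m) : `|norm2 u - norm2 v| <= norm2 (u - v).
Proof.
rewrite ler_norml; apply/andP; split.
  have := ler_norm2D (v - u) u; rewrite subrK -[v - u]opprB norm2N; lra.
by have := ler_norm2D (u - v) v; rewrite subrK; lra.
Qed.

(** Divide |N^T x|^2 = <x, N (N^T x)> <= c |x| |N^T x| by |N^T x|. *)
Lemma norm2_tr_le m n (N : 'M[R]_(m, n)) c : 0 <= c ->
  (forall v, norm2 (N *m v) <= c * norm2 v) ->
  forall x, norm2 (N^T *m x) <= c * norm2 x.
Proof.
move=> c0 hN x; have [->|nz] := eqVneq (N^T *m x) 0.
  by rewrite norm2_0 mulr_ge0 ?norm2_ge0.
rewrite -(ler_pM2l (norm2_gt0 nz)) -expr2 norm2_sqr dotv_mull trmxK.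
apply: le_trans (ler_norm _) _; apply: le_trans (dotv_CS _ _) _.
by rewrite mulrC [leRHS]mulrA ler_wpM2r ?norm2_ge0// mulrC.
Qed.

Lemma isometry_dotv m n (U : 'M[R]_(m, n)) x y :
  U^T *m U = 1%:M -> dotv (U *m x) (U *m y) = dotv x y.
Proof. by move=> UU; rewrite dotv_mull mulmxA UU mul1mx. Qed.

Lemma isometry_norm2 m n (U : 'M[R]_(m, n)) x :
  U^T *m U = 1%:M -> norm2 (U *m x) = norm2 x.
Proof. by move=> UU; rewrite !norm2E isometry_dotv. Qed.

Lemma bessel m n (U : 'M[R]_(m, n)) x :
  U^T *m U = 1%:M -> norm2 (U^T *m x) <= norm2 x.
Proof.
move=> UU; rewrite -[leRHS]mul1r; apply: norm2_tr_le => // v.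
by rewrite mul1r isometry_norm2.
Qed.

End InnerProduct.

(** * Spectral and Frobenius norms *)

Section SpectralNorm.
Variable R : realType.

Lemma frobenius_sqr m n (M : 'M[R]_(m, n)) :
  frobenius_norm M ^+ 2 = \sum_i \sum_j M i j ^+ 2.
Proof.
rewrite sqr_sqrtr //; apply: sumr_ge0 => i _; apply: sumr_ge0 => j _.
exact: sqr_ge0.
Qed.

Lemma frobenius_trace m n (M : 'M[R]_(m, n)) :
  frobenius_norm M ^+ 2 = \tr (M *m M^T).
Proof.
rewrite frobenius_sqr; apply: eq_bigr => i _; rewrite mxE.
by apply: eq_bigr => j _; rewrite mxE expr2.
Qed.

Lemma norm2_mul_frobenius m n (M : 'M[R]_(m, n)) v :
  norm2 (M *m v) <= frobenius_norm M * norm2 v.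
Proof.
rewrite norm2_leM ?sqrtr_ge0 // frobenius_sqr mulr_suml dotvE.
apply: ler_sum => i _.
have -> : (M *m v) i 0 = dotv (row i M)^T v.
  by rewrite dotvE mxE; apply: eq_bigr => j _; rewrite !mxE.
have -> : \sum_j M i j ^+ 2 = dotv (row i M)^T (row i M)^T.
  by rewrite dotvE; apply: eq_bigr => j _; rewrite !mxE expr2.
rewrite -!norm2_sqr -exprMn -expr2 -real_normK ?num_real // ler_sqr ?nnegrE //.
  exact: dotv_CS.
by rewrite mulr_ge0 ?norm2_ge0.
Qed.

(** [sup] is meaningful only on a nonempty bounded set; the Frobenius norm is the bound. *)
Lemma spectral_norm_has_sup m n (M : 'M[R]_(m, n)) :
  has_sup [set norm2 (M *m v) | v in [set v : 'cV[R]_n | norm2 v <= 1]].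
Proof.
split; first by exists (norm2 (M *m 0)); exists 0 => //=; rewrite norm2_0.
exists (frobenius_norm M) => _ [v /= v1 <-].
apply: le_trans (norm2_mul_frobenius _ _) _.
by rewrite -[leRHS]mulr1 ler_wpM2l ?sqrtr_ge0.
Qed.

Lemma spectral_norm_ge0 m n (M : 'M[R]_(m, n)) : 0 <= spectral_norm M.
Proof.
have := ub_le_sup (spectral_norm_has_sup M).2; apply.
by exists 0; rewrite /= ?norm2_0 // mulmx0 norm2_0.
Qed.

Lemma spectral_normP m n (M : 'M[R]_(m, n)) v :
  norm2 (M *m v) <= spectral_norm M * norm2 v.
Proof.
have [->|v0] := eqVneq v 0; first by rewrite mulmx0 !norm2_0 mulr0.
have nv := norm2_gt0 v0.
rewrite -ler_pdivrMr // -[norm2 (M *m v) / _](_ : norm2 (M *m ((norm2 v)^-1 *: v)) = _).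
  apply: (ub_le_sup (spectral_norm_has_sup M).2).
  exists ((norm2 v)^-1 *: v) => //=.
  by rewrite norm2Z ger0_norm ?invr_ge0 ?norm2_ge0 // mulVf // gt_eqF.
by rewrite -scalemxAr norm2Z ger0_norm ?invr_ge0 ?norm2_ge0 // mulrC.
Qed.

Lemma spectral_norm_le m n (M : 'M[R]_(m, n)) c : 0 <= c ->
  (forall v, norm2 (M *m v) <= c * norm2 v) -> spectral_norm M <= c.
Proof.
move=> c0 h; apply: ge_sup; first exact: (spectral_norm_has_sup M).1.
move=> _ [v /= v1 <-]; apply: le_trans (h v) _.
by rewrite -[leRHS]mulr1 ler_wpM2l.
Qed.

(** Take u = M v. *)
Lemma spectral_norm_le_bilinear m n (M : 'M[R]_(m, n)) c : 0 <= c ->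
  (forall u v, dotv u (M *m v) <= c * norm2 u * norm2 v) -> spectral_norm M <= c.
Proof.
move=> c0 h; apply: spectral_norm_le => // v.
have [->|nz] := eqVneq (M *m v) 0; first by rewrite norm2_0 mulr_ge0 ?norm2_ge0.
rewrite -(ler_pM2l (norm2_gt0 nz)) -expr2 norm2_sqr (le_trans (h _ _)) //.
by rewrite [c * _]mulrC mulrA.
Qed.

Lemma spectral_norm_le_frobenius m n (M : 'M[R]_(m, n)) :
  spectral_norm M <= frobenius_norm M.
Proof.
apply: spectral_norm_le; first exact: sqrtr_ge0.
exact: norm2_mul_frobenius.
Qed.

Lemma frobenius_tr m n (M : 'M[R]_(m, n)) : frobenius_norm M^T = frobenius_norm M.
Proof.
rewrite /frobenius_norm exchange_big /=; congr Num.sqrt.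
by apply: eq_bigr => i _; apply: eq_bigr => j _; rewrite mxE.
Qed.

End SpectralNorm.

(** * Singular value decompositions *)

Section SVD.
Variable R : realType.

(* A thin singular value decomposition with an arbitrary number r of columns,
   so that it can be transposed. *)
Definition svd_of m n r (X : 'M[R]_(m, n)) (U : 'M[R]_(m, r)) (s : 'rV[R]_r)
    (V : 'M[R]_(n, r)) : Prop :=
  [/\ U^T *m U = 1%:M,
      V^T *m V = 1%:M,
      forall i, 0 <= s 0 i,
      forall i j : 'I_r, (i <= j)%N -> s 0 j <= s 0 i
    & X = U *m diag_mx s *m V^T].

(* Indexed from 1, and equal to 0 outside 1..r. *)
Definition nth_sv r (s : 'rV[R]_r) (k : nat) : R :=
  \sum_(j < r | j.+1 == k) s 0 j.

Lemma nth_sv_ord r (s : 'rV[R]_r) (j : 'I_r) : nth_sv s j.+1 = s 0 j.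
Proof.
by rewrite /nth_sv (big_pred1 j) // => i; rewrite eqSS.
Qed.

Lemma nth_sv_out r (s : 'rV[R]_r) k : (r < k)%N -> nth_sv s k = 0.
Proof.
move=> rk; rewrite /nth_sv big_pred0 // => i; apply/negbTE/eqP => ik.
by have := ltn_ord i; rewrite ltnNge -ltnS ik rk.
Qed.

Lemma nth_sv_ge0 r (s : 'rV[R]_r) k : (forall i, 0 <= s 0 i) -> 0 <= nth_sv s k.
Proof. by move=> s0; apply: sumr_ge0 => i _. Qed.

Lemma nth_sv_homo r (s : 'rV[R]_r) k l : (forall i, 0 <= s 0 i) ->
  (forall i j : 'I_r, (i <= j)%N -> s 0 j <= s 0 i) ->
  (0 < k)%N -> (k <= l)%N -> nth_sv s l <= nth_sv s k.
Proof.
move=> s0 sd k0 kl; have [rl|lr] := ltnP r l.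
  by rewrite nth_sv_out ?nth_sv_ge0.
have hk : (k.-1 < r)%N by rewrite prednK // (leq_trans kl).
have hl : (l.-1 < r)%N by rewrite prednK // (leq_trans k0).
rewrite -(prednK k0) -(prednK (leq_trans k0 kl)).
rewrite (nth_sv_ord s (Ordinal hk)) (nth_sv_ord s (Ordinal hl)); apply: sd => /=.
by rewrite -ltnS !prednK // (leq_trans k0).
Qed.

Lemma svd_of_tr m n r (X : 'M[R]_(m, n)) (U : 'M[R]_(m, r)) s V :
  svd_of X U s V -> svd_of X^T V s U.
Proof.
by case=> ? ? ? ? ->; split=> //; rewrite !trmx_mul trmxK tr_diag_mx mulmxA.
Qed.

Section Decomposition.
Variables (m n r : nat) (X : 'M[R]_(m, n)).
Variables (U : 'M[R]_(m, r)) (s : 'rV[R]_r) (V : 'M[R]_(n, r)).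
Hypothesis dec : svd_of X U s V.

Let UU : U^T *m U = 1%:M. Proof. by case: dec. Qed.
Let VV : V^T *m V = 1%:M. Proof. by case: dec. Qed.
Let s_ge0 i : 0 <= s 0 i. Proof. by case: dec. Qed.
Let s_dec (i j : 'I_r) : (i <= j)%N -> s 0 j <= s 0 i.
Proof. by case: dec => _ _ _ h _; exact: h. Qed.
Let XE : X = U *m diag_mx s *m V^T. Proof. by case: dec. Qed.

Lemma svd_le_nth_sv1 i : s 0 i <= nth_sv s 1.
Proof. by rewrite -nth_sv_ord; exact: nth_sv_homo. Qed.

Lemma mul_diag_mxE (x : 'cV[R]_r) i : (diag_mx s *m x) i 0 = s 0 i * x i 0.
Proof. by rewrite mul_diag_mx mxE. Qed.

Lemma svd_gramE : X *m X^T = U *m diag_mx s *m diag_mx s *m U^T.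
Proof.
rewrite XE !trmx_mul trmxK tr_diag_mx !mulmxA; congr (_ *m _ *m _).
by rewrite -mulmxA VV mulmx1.
Qed.

Lemma svd_quad (u : 'cV[R]_m) :
  dotv u (X *m X^T *m u) = \sum_i s 0 i ^+ 2 * (U^T *m u) i 0 ^+ 2.
Proof.
rewrite svd_gramE -!mulmxA dotv_mulr dotv_mulr tr_diag_mx dotvE.
by apply: eq_bigr => i _; rewrite !mul_diag_mxE -exprMn expr2.
Qed.

Lemma svd_norm2_mul v :
  norm2 (X *m v) ^+ 2 = \sum_i s 0 i ^+ 2 * (V^T *m v) i 0 ^+ 2.
Proof.
rewrite XE -!mulmxA isometry_norm2 // norm2_sqr dotvE; apply: eq_bigr => i _.
by rewrite mul_diag_mxE -exprMn expr2.
Qed.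

(** The supremum is attained at the first right singular vector [V *m e]; when r = 0 there is none
    and [nth_sv] is 0. *)
Lemma svd_spectral_norm : spectral_norm X = nth_sv s 1.
Proof.
have s10 : 0 <= nth_sv s 1 by apply: nth_sv_ge0.
apply/eqP; rewrite eq_le; apply/andP; split.
  apply: spectral_norm_le => // v.
  rewrite -ler_sqr ?nnegrE ?mulr_ge0 ?norm2_ge0 // svd_norm2_mul exprMn.
  apply: (@le_trans _ _ (nth_sv s 1 ^+ 2 * norm2 (V^T *m v) ^+ 2)).
    rewrite norm2_sqr dotvE mulr_sumr; apply: ler_sum => i _.
    rewrite -expr2 ler_wpM2r ?sqr_ge0 // ler_sqr ?nnegrE //.
    exact: svd_le_nth_sv1.
  by rewrite ler_wpM2l ?sqr_ge0 // ler_sqr ?nnegrE ?norm2_ge0 // bessel.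
have [r0|r0] := leqP r 0; first by rewrite nth_sv_out ?spectral_norm_ge0.
pose i0 := Ordinal r0; rewrite (nth_sv_ord s i0).
pose e : 'cV[R]_r := delta_mx i0 0.
have ne : norm2 e = 1.
  apply/eqP; rewrite -(eqrXn2 (n:=2)) ?norm2_ge0 // expr1n norm2_sqr dotvE.
  rewrite (bigD1 i0) //= big1 ?addr0 => [|i ii].
    by rewrite mxE !eqxx mulr1.
  by rewrite mxE (negbTE ii) mul0r.
have := spectral_normP X (V *m e); rewrite (isometry_norm2 e VV) ne mulr1.
apply: le_trans; rewrite -ler_sqr ?nnegrE ?norm2_ge0 // svd_norm2_mul.
rewrite mulmxA VV mul1mx (bigD1 i0) //= mxE !eqxx expr1n mulr1 lerDl.
by apply: sumr_ge0 => i _; rewrite mulr_ge0 ?sqr_ge0.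
Qed.

Lemma svd_frobenius : frobenius_norm X ^+ 2 = \sum_i s 0 i ^+ 2.
Proof.
rewrite frobenius_trace svd_gramE -!mulmxA mxtrace_mulC -!mulmxA UU mulmx1.
apply: eq_bigr => i _; rewrite mulmx_diag !mxE eqxx mulr1n expr2 //.
Qed.

End Decomposition.

Lemma svd_of_nth_sv_ge0 m n r (X : 'M[R]_(m, n)) (U : 'M[R]_(m, r)) s V k :
  svd_of X U s V -> 0 <= nth_sv s k.
Proof. by case=> _ _ s0 _ _; exact: nth_sv_ge0. Qed.

(* Courant-Fischer: a nonzero combination of the first k columns of U is
   orthogonal to the first k-1 columns of U'. *)
Lemma weyl m n n' r r' (X : 'M[R]_(m, n)) (U : 'M[R]_(m, r)) s V
    (X' : 'M[R]_(m, n')) (U' : 'M[R]_(m, r')) s' V' eta k :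
  svd_of X U s V -> svd_of X' U' s' V' -> 0 <= eta ->
  (forall u, dotv u (X *m X^T *m u) <=
     dotv u (X' *m X'^T *m u) + eta * dotv u u) ->
  (0 < k)%N -> nth_sv s k ^+ 2 <= nth_sv s' k ^+ 2 + eta.
Proof.
move=> dec dec' eta0 hq k0.
have [rk|kr] := ltnP r k.
  by rewrite nth_sv_out // expr0n /= addr_ge0 ?sqr_ge0.
have [UU _ s0 sd _] := dec; have [UU' _ s0' sd' _] := dec'.
have hk : (k.-1 < r)%N by rewrite prednK.
pose Uk : 'M[R]_(m, k) := colsub (widen_ord kr) U.
(* The sum over [l == j] is the entry of [Uk^T *m U'], or 0 when [U'] has no column j. So [W] has k
   - 1 columns even if r' < k - 1, and a rank count gives a nonzero left kernel. *)
pose W : 'M[R]_(k, k.-1) := \matrix_(i, j)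
  \sum_(l < r' | l == j :> nat) (Uk^T *m U') i l.
have rkW : (\rank W < k)%N.
  by rewrite (leq_ltn_trans (rank_leq_col W)) // prednK.
have kW : kermx W != 0.
  by rewrite kermx_eq0 /row_free neq_ltn rkW.
have [z /sub_kermxP zW zn0] := rowV0Pn kW.
pose u := Uk *m z^T.
have UkU i : (U^T *m u) i 0 = \sum_(l < k | l == i :> nat) z 0 l.
  have -> : U^T *m u = (colsub (widen_ord kr) (1%:M : 'M[R]_r)) *m z^T.
    by rewrite /u mulmxA -UU /Uk mulmx_colsub.
  rewrite mxE [RHS]big_mkcond /=; apply: eq_bigr => l _; rewrite !mxE.
  by rewrite -val_eqE /= eq_sym; case: eqP => _; rewrite ?mul1r ?mul0r.
have UkUk : Uk^T *m Uk = 1%:M.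
  apply/matrixP => i j; have /matrixP/(_ (widen_ord kr i) (widen_ord kr j)) := UU.
  by rewrite !mxE -val_eqE /= => <-; apply: eq_bigr => l _; rewrite !mxE.
have uu : dotv u u = dotv z^T z^T by rewrite /u isometry_dotv.
have zz : 0 < dotv z^T z^T.
  rewrite lt_def dotvv_ge0 andbT; apply: contra zn0 => /eqP /dotvv_eq0 e.
  by rewrite -[z]trmxK e trmx0.
have lowU : nth_sv s k ^+ 2 * dotv u u <= dotv u (X *m X^T *m u).
  rewrite (svd_quad dec) uu dotvE mulr_sumr.
  pose F (i : 'I_r) := s 0 i ^+ 2 * (U^T *m u) i 0 ^+ 2.
  have -> : \sum_i s 0 i ^+ 2 * (U^T *m u) i 0 ^+ 2 = \sum_i F i by [].
  apply: (@le_trans _ _ (\sum_(l < k) F (widen_ord kr l))).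
    apply: ler_sum => l _; rewrite /F UkU (big_pred1 l) //.
    rewrite !mxE -expr2 ler_wpM2r ?sqr_ge0 // ler_sqr ?nnegrE ?nth_sv_ge0 //.
    by rewrite -nth_sv_ord nth_sv_homo //= ltn_ord.
  (* [insubd] makes the summand a function of a natural number, as widening the range of the sum
     requires. *)
  have -> : \sum_(l < k) F (widen_ord kr l) =
      \sum_(l < k) F (insubd (Ordinal hk) l).
    apply: eq_bigr => l _; congr F; apply: val_inj; rewrite /= val_insubd.
    by rewrite (leq_trans (ltn_ord l) kr).
  rewrite (big_ord_widen_cond r predT (fun j => F (insubd (Ordinal hk) j)) kr) /=.
  rewrite big_mkcond /=; apply: ler_sum => i _.
  have -> : insubd (Ordinal hk) i = i.
    by apply: val_inj; rewrite val_insubd ltn_ord.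
  by case: ifP => // _; rewrite /F mulr_ge0 ?sqr_ge0.
have U'u (j : 'I_r') : (j < k.-1)%N -> (U'^T *m u) j 0 = 0.
  move=> jk; have : (z *m W) 0 (Ordinal jk) = 0 by rewrite zW mxE.
  rewrite mxE => h; rewrite -[RHS]h /u mulmxA mxE; apply: eq_bigr => i _.
  rewrite !mxE (big_pred1 j) // !mxE mulrC; congr (_ * _).
  by apply: eq_bigr => l _; rewrite !mxE mulrC.
have upU : dotv u (X' *m X'^T *m u) <= nth_sv s' k ^+ 2 * dotv u u.
  rewrite (svd_quad dec').
  apply: (@le_trans _ _ (nth_sv s' k ^+ 2 * norm2 (U'^T *m u) ^+ 2)); last first.
    rewrite ler_wpM2l ?sqr_ge0 // -norm2_sqr ler_sqr ?nnegrE ?norm2_ge0 //.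
    exact: bessel.
  rewrite norm2_sqr dotvE mulr_sumr; apply: ler_sum => j _.
  have [jk|kj] := ltnP j k.-1; first by rewrite U'u // expr0n /= !mulr0.
  rewrite -expr2 ler_wpM2r ?sqr_ge0 // ler_sqr ?nnegrE ?nth_sv_ge0 //.
  by rewrite -nth_sv_ord nth_sv_homo // -(prednK k0) ltnS.
rewrite -(ler_pM2r (_ : 0 < dotv u u)) ?uu // mulrDl -uu.
apply: le_trans lowU _; apply: le_trans (hq u) _.
by rewrite lerD2r.
Qed.

(** Weyl's inequality with [eta = 0], in both directions. *)
Lemma svd_unique m n r r' (X : 'M[R]_(m, n)) (U : 'M[R]_(m, r)) s V
    (U' : 'M[R]_(m, r')) s' V' k :
  svd_of X U s V -> svd_of X U' s' V' -> (0 < k)%N -> nth_sv s k = nth_sv s' k.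
Proof.
move=> d d' k0; apply/eqP.
rewrite -(eqrXn2 (n := 2)) ?(svd_of_nth_sv_ge0 _ d) ?(svd_of_nth_sv_ge0 _ d') //.
rewrite eq_le; apply/andP; split; rewrite -[leRHS]addr0.
  by apply: weyl d d' _ _ _ => // u; rewrite mul0r addr0.
by apply: weyl d' d _ _ _ => // u; rewrite mul0r addr0.
Qed.

Lemma thin_svd_singular_value m n (X : 'M[R]_(m, n)) U s V k :
  thin_svd X U s V -> (0 < k)%N -> singular_value X k = nth_sv s k.
Proof.
move=> d k0; rewrite /singular_value /singular_values.
case: xgetP => [s' _ /= [U' [V' d']]|/(_ s)]; last by case; exists U, V.
exact: svd_unique d' d k0.
Qed.

(** Without a thin SVD, [singular_values X] would be the default 0 and the strict inequality would
    read 0 < 0. The gap hypothesis thus provides a decomposition. *)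
Lemma thin_svd_exists m n (X : 'M[R]_(m, n)) k l :
  singular_value X k < singular_value X l -> exists U s V, thin_svd X U s V.
Proof.
rewrite /singular_value /singular_values.
case: xgetP => [s' _ /= [U' [V' d']] _|_]; first by exists U', s', V'.
by rewrite !big1 ?ltxx // => i _; rewrite mxE.
Qed.

End SVD.

(** * Perturbation of the leading singular subspace *)

Section Perturbation.
Variable R : realType.

Lemma colsub_gram m r p q (U : 'M[R]_(m, r)) (f : 'I_p -> 'I_r)
    (g : 'I_q -> 'I_r) :
  U^T *m U = 1%:M ->
  (colsub f U)^T *m colsub g U = \matrix_(i, j) (f i == g j)%:R.
Proof.
move=> UU; apply/matrixP => i j; have /matrixP/(_ (f i) (g j)) := UU.
by rewrite !mxE => <-; apply: eq_bigr => l _; rewrite !mxE.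
Qed.

Lemma colsub_orth m r p (U : 'M[R]_(m, r)) (f : 'I_p -> 'I_r) :
  injective f -> U^T *m U = 1%:M -> (colsub f U)^T *m colsub f U = 1%:M.
Proof.
by move=> fI UU; rewrite colsub_gram //; apply/matrixP => i j; rewrite !mxE inj_eq.
Qed.

Lemma first_cols_orth m r k (U : 'M[R]_(m, r)) :
  U^T *m U = 1%:M -> (first_cols k U)^T *m first_cols k U = 1%:M.
Proof. by apply: colsub_orth => i j /(congr1 val) /= /val_inj. Qed.

Lemma last_cols_orth m r k (U : 'M[R]_(m, r)) :
  U^T *m U = 1%:M -> (last_cols k U)^T *m last_cols k U = 1%:M.
Proof. by apply: colsub_orth => i j /(congr1 val) /= /addnI /val_inj. Qed.

Lemma last_first_cols m r k (U : 'M[R]_(m, r)) :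
  U^T *m U = 1%:M -> (last_cols k U)^T *m first_cols k U = 0.
Proof.
move=> UU; rewrite colsub_gram //; apply/matrixP => i j; rewrite !mxE.
rewrite -val_eqE /= gtn_eqF // (leq_trans (ltn_ord j)) //.
by rewrite (leq_trans (geq_minl _ _)) ?leq_addr.
Qed.

Lemma colsub_trmul m r p (U : 'M[R]_(m, r)) (f : 'I_p -> 'I_r) (x : 'cV[R]_m) i :
  ((colsub f U)^T *m x) i 0 = (U^T *m x) (f i) 0.
Proof. by rewrite !mxE; apply: eq_bigr => l _; rewrite !mxE. Qed.

Definition proj_first m r k (U : 'M[R]_(m, r)) : 'M[R]_m :=
  first_cols k U *m (first_cols k U)^T.

Section Projection.
Variables (m r k : nat) (U : 'M[R]_(m, r)).
Hypothesis UU : U^T *m U = 1%:M.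
Let P := proj_first k U.

Lemma proj_first_tr : P^T = P.
Proof. by rewrite /P /proj_first trmx_mul trmxK. Qed.

Lemma proj_firstK : P *m P = P.
Proof.
by rewrite /P /proj_first mulmxA -[_ *m _ *m first_cols k U]mulmxA
  first_cols_orth // mulmx1.
Qed.

Lemma first_cols_proj : (first_cols k U)^T *m P = (first_cols k U)^T.
Proof. by rewrite /P /proj_first mulmxA first_cols_orth // mul1mx. Qed.

Lemma first_cols_compl (x : 'cV[R]_m) : (first_cols k U)^T *m (x - P *m x) = 0.
Proof. by rewrite mulmxBr mulmxA first_cols_proj subrr. Qed.

Lemma proj_first_pythagoras (x : 'cV[R]_m) :
  dotv x x = dotv (P *m x) (P *m x) + dotv (x - P *m x) (x - P *m x).
Proof.
have e : dotv (P *m x) (x - P *m x) = 0.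
  by rewrite dotv_mull proj_first_tr mulmxBr mulmxA proj_firstK subrr dotv0r.
by rewrite -dotv_pythagoras // addrC subrK.
Qed.

Lemma norm2_proj_first (x : 'cV[R]_m) : norm2 (P *m x) <= norm2 x.
Proof. by rewrite norm2_le (proj_first_pythagoras x) lerDl dotvv_ge0. Qed.

Lemma norm2_compl_first (x : 'cV[R]_m) : norm2 (x - P *m x) <= norm2 x.
Proof.
by rewrite norm2_le [leRHS]proj_first_pythagoras lerDr dotvv_ge0.
Qed.

(** The last columns do not see [P *m x], so Bessel's inequality applies to [x - P *m x]. This
    reduces the second PCP condition to a bound on the complement of [P]. *)
Lemma norm2_last_cols (x : 'cV[R]_m) : norm2 ((last_cols k U)^T *m x) <= norm2 (x - P *m x).
Proof.
have -> : (last_cols k U)^T *m x = (last_cols k U)^T *m (x - P *m x).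
  by rewrite mulmxBr /P /proj_first !mulmxA last_first_cols // !mul0mx subr0.
by apply: bessel; exact: last_cols_orth.
Qed.

Lemma norm2_proj_firstE (x : 'cV[R]_m) : norm2 (P *m x) = norm2 ((first_cols k U)^T *m x).
Proof. by rewrite /P /proj_first -mulmxA isometry_norm2 // first_cols_orth. Qed.

Lemma trmul_first_cols_eq0 (x : 'cV[R]_m) (i : 'I_r) : (i < k)%N ->
  (U^T *m (x - P *m x)) i 0 = 0.
Proof.
move=> ik; have ik' : (i < minn k r)%N by rewrite leq_min ik ltn_ord.
have /matrixP/(_ (Ordinal ik') 0) := first_cols_compl x.
rewrite colsub_trmul [RHS]mxE => <-; congr ((_ *m _) _ _); exact: val_inj.
Qed.

End Projection.

Section DecompositionFirst.
Variables (m n r k : nat) (X : 'M[R]_(m, n)).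
Variables (U : 'M[R]_(m, r)) (s : 'rV[R]_r) (V : 'M[R]_(n, r)).
Hypothesis dec : svd_of X U s V.
Let P := proj_first k U.

Lemma svd_mul_first_cols :
  X *m first_cols k V = first_cols k U *m diag_mx (first_cols k s).
Proof.
case: dec => UU VV _ _ ->.
rewrite mulmx_colsub -!mulmxA VV mulmx1; apply/matrixP => i j.
by rewrite !mul_mx_diag !mxE.
Qed.

Lemma svd_gram_first_cols : X *m X^T *m first_cols k U =
  first_cols k U *m diag_mx (map_mx (fun x => x ^+ 2) (first_cols k s)).
Proof.
case: (dec) => UU VV _ _ _; rewrite (svd_gramE dec) mulmx_colsub -!mulmxA UU mulmx1.
apply/matrixP => i j.
by rewrite mulmx_diag !mul_mx_diag !mxE expr2.
Qed.

(** Off the span of the first k columns only the values s_i with i > k remain. This supplies [beta]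
    in [davis_kahan]. *)
Lemma norm2_gram_compl (x : 'cV[R]_m) :
  norm2 (X *m X^T *m (x - P *m x)) <=
  nth_sv s k.+1 ^+ 2 * norm2 (x - P *m x).
Proof.
case: (dec) => UU VV s0 sd _.
have z0 (i : 'I_r) : (i < k)%N -> (U^T *m (x - P *m x)) i 0 = 0.
  exact: trmul_first_cols_eq0.
set z := x - P *m x in z0 *; clearbody z.
rewrite (svd_gramE dec) -!mulmxA isometry_norm2 //.
apply: (@le_trans _ _ (nth_sv s k.+1 ^+ 2 * norm2 (U^T *m z))); last first.
  by rewrite ler_wpM2l ?sqr_ge0 // bessel.
rewrite norm2_leM ?sqr_ge0 // !dotvE mulr_sumr.
apply: ler_sum => i _; rewrite !mul_diag_mxE.
have [ik|ki] := ltnP i k; first by rewrite z0 // !mulr0.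
set y := (U^T *m _) i 0.
rewrite (_ : _ * (_ * y) * _ = (s 0 i ^+ 2) ^+ 2 * y ^+ 2); last by ring.
have h : s 0 i ^+ 2 <= nth_sv s k.+1 ^+ 2.
  by rewrite ler_sqr ?nnegrE ?nth_sv_ge0 // -nth_sv_ord nth_sv_homo.
by rewrite -expr2 ler_wpM2r ?sqr_ge0 // ler_sqr ?nnegrE ?sqr_ge0.
Qed.

Lemma nth_sv_gt0_first : (0 < k)%N -> 0 < nth_sv s k ->
  forall i : 'I_(minn k r), nth_sv s k <= first_cols k s 0 i.
Proof.
case: (dec) => UU VV s0 sd _ k0 sk i; rewrite mxE -nth_sv_ord nth_sv_homo //=.
by rewrite (leq_trans (ltn_ord i)) ?geq_minl.
Qed.

(** For x in the range, |X x - b|^2 = |X x - P b|^2 + |P b - b|^2, so every minimizer satisfies X x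
    = P b as soon as one vector of the range does. *)
Lemma pcr_solutionE (b : 'cV[R]_m) : (0 < k)%N -> 0 < nth_sv s k ->
  X *m pcr_solution X V k b = P *m b.
Proof.
case: (dec) => UU VV s0 sd _ k0 sk.
have sk' (i : 'I_(minn k r)) : first_cols k s 0 i != 0.
  by rewrite gt_eqF // (lt_le_trans sk) ?nth_sv_gt0_first.
have pyth z : dotv (X *m (first_cols k V *m z) - b) (X *m (first_cols k V *m z) - b) =
    dotv (X *m (first_cols k V *m z) - P *m b) (X *m (first_cols k V *m z) - P *m b)
    + dotv (P *m b - b) (P *m b - b).
  rewrite mulmxA svd_mul_first_cols -mulmxA; set y := diag_mx _ *m z; clearbody y.
  have e : dotv (first_cols k U *m y - P *m b) (P *m b - b) = 0.
    have -> : first_cols k U *m y - P *m b =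
        first_cols k U *m (y - (first_cols k U)^T *m b).
      by rewrite mulmxBr /P /proj_first -mulmxA.
    by rewrite dotv_mull -[P *m b - b]opprB mulmxN first_cols_compl // oppr0 dotv0r.
  by rewrite -dotv_pythagoras // addrA subrK.
(* [z0] solves diag(s) z = U_k^T b, which is possible because the first k singular values are
   positive. *)
pose z0 := diag_mx (map_mx GRing.inv (first_cols k s)) *m ((first_cols k U)^T *m b).
have z0E : X *m (first_cols k V *m z0) = P *m b.
  rewrite mulmxA svd_mul_first_cols /z0 /P /proj_first -!mulmxA; congr (_ *m _).
  rewrite mulmxA mulmx_diag; set D := diag_mx _; have -> : D = 1%:M.
    rewrite /D -diag_const_mx; congr diag_mx; apply/rowP => i; rewrite [LHS]mxE [X in _ * X]mxE.
    by rewrite mulfV // mxE.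
  by rewrite mul1mx.
rewrite /pcr_solution; case: xgetP => [x _ /= [[z ->] hmin]|/(_ (first_cols k V *m z0))].
  have /(_ (first_cols k V *m z0)) := hmin; rewrite z0E => /(_ (ex_intro _ z0 erefl)).
  rewrite norm2_le pyth gerDr => h.
  have /dotvv_eq0/eqP : dotv (X *m (first_cols k V *m z) - P *m b)
      (X *m (first_cols k V *m z) - P *m b) = 0.
    by apply/eqP; rewrite eq_le h dotvv_ge0.
  by rewrite subr_eq0 => /eqP.
case; split; first by exists z0.
move=> _ [z ->]; rewrite z0E norm2_le pyth; rewrite lerDr; exact: dotvv_ge0.
Qed.

(** The symmetry conditions give Y Z = Y Z' and Z Y = Z' Y; then Z = Z Y Z = Z Y Z' = Z' Y Z' =
    Z'. *)
Lemma mp_inverse_unique p q (Y : 'M[R]_(p, q)) Z Z' :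
  mp_inverse Y Z -> mp_inverse Y Z' -> Z = Z'.
Proof.
case=> a1 a2 a3 a4 [b1 b2 b3 b4].
have e1 : Y *m Z = Y *m Z'.
  rewrite -{1}b1 -[_ *m Y *m Z]mulmxA -a3 -b3 -trmx_mul mulmxA a1.
  by rewrite b3.
have e2 : Z *m Y = Z' *m Y.
  rewrite -{1}b1 mulmxA mulmxA -mulmxA -a4 -b4 -trmx_mul -mulmxA [Y *m _]mulmxA.
  by rewrite a1 b4.
by rewrite -a2 -mulmxA e1 mulmxA e2.
Qed.
End DecompositionFirst.
End Perturbation.

Section DavisKahan.
Variable R : realType.

Lemma norm2_diag_le m (l : 'rV[R]_m) c (v : 'cV[R]_m) :
  0 <= c -> (forall i, `|l 0 i| <= c) -> norm2 (diag_mx l *m v) <= c * norm2 v.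
Proof.
move=> c0 h; rewrite norm2_leM // !dotvE mulr_sumr; apply: ler_sum => i _.
rewrite mul_diag_mx mxE -!expr2 exprMn ler_wpM2r ?sqr_ge0 //.
by rewrite -real_normK ?num_real // ler_sqr ?nnegrE.
Qed.

(* On the range of W the matrix M' is at least alpha, on that of Q the matrix M
   is at most beta; N := Q W solves N diag(lam) = L N + Q (M' - M) W. *)
Lemma davis_kahan m p q (Q : 'M[R]_(q, m)) (L : 'M[R]_q) (M M' : 'M[R]_m)
    (W : 'M[R]_(m, p)) (lam : 'rV[R]_p) alpha beta eta :
  Q *m M = L *m Q ->
  (forall x : 'cV_m, norm2 (L *m (Q *m x)) <= beta * norm2 (Q *m x)) ->
  (forall x : 'cV_m, norm2 (Q *m x) <= norm2 x) ->
  M' *m W = W *m diag_mx lam -> W^T *m W = 1%:M ->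
  (forall i, alpha <= lam 0 i) ->
  (forall x : 'cV_m, norm2 ((M' - M) *m x) <= eta * norm2 x) ->
  0 <= beta -> 0 <= eta -> beta < alpha ->
  forall v : 'cV_p, norm2 (Q *m (W *m v)) <= eta / (alpha - beta) * norm2 v.
Proof.
move=> QM hL hQ M'W WW hlam hE beta0 eta0 ba v.
have alpha0 : 0 < alpha by exact: le_lt_trans ba.
have lam0 i : 0 < lam 0 i by exact: lt_le_trans (hlam i).
pose N := Q *m W; set c := spectral_norm N.
have c0 : 0 <= c by exact: spectral_norm_ge0.
have NE : N *m diag_mx lam = L *m N + Q *m ((M' - M) *m W).
  rewrite /N -mulmxA -M'W mulmxBl mulmxBr [Q *m (M *m W)]mulmxA QM -!mulmxA.
  by rewrite addrC subrK.
(* The equation for [N] is applied to w = diag(lam)^-1 u, whose norm is at most |u| / alpha. The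
   resulting inequality has c on both sides; solving it gives eta / (alpha - beta). *)
have cle : c <= (beta * c + eta) / alpha.
  apply: spectral_norm_le => [|u].
    by rewrite divr_ge0 ?addr_ge0 ?mulr_ge0 // ltW.
  pose w := diag_mx (map_mx GRing.inv lam) *m u.
  have uE : u = diag_mx lam *m w.
    rewrite /w mulmxA mulmx_diag -[LHS]mul1mx -diag_const_mx; congr (diag_mx _ *m _).
    by apply/rowP => i; rewrite !mxE mulfV ?gt_eqF.
  have nw : norm2 w <= alpha^-1 * norm2 u.
    apply: norm2_diag_le => [|i]; first by rewrite invr_ge0 ltW.
    by rewrite mxE ger0_norm ?lef_pV2 ?posrE ?hlam // invr_ge0 ltW.
  rewrite {1}uE mulmxA NE mulmxDl -!mulmxA.
  apply: le_trans (ler_norm2D _ _) _.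
  have h1 : norm2 (L *m (Q *m (W *m w))) <= beta * (c * norm2 w).
    apply: le_trans (hL _) _; rewrite ler_wpM2l //.
    by rewrite mulmxA spectral_normP.
  have h2 : norm2 (Q *m ((M' - M) *m (W *m w))) <= eta * norm2 w.
    by apply: le_trans (hQ _) _; apply: le_trans (hE _) _; rewrite isometry_norm2.
  apply: le_trans (lerD h1 h2) _.
  rewrite mulrA -mulrDl -[leRHS]mulrA ler_wpM2l //.
  by rewrite addr_ge0 ?mulr_ge0.
rewrite mulmxA; apply: le_trans (spectral_normP _ _) _.
rewrite ler_wpM2r ?norm2_ge0 // ler_pdivlMr ?subr_gt0 // -/N -/c.
by move: cle; rewrite ler_pdivlMr //; lra.
Qed.

End DavisKahan.

(** * From a Gram perturbation to the approximate PCP *)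

Section PCP.
Variables (R : realType) (n d t r r' k : nat).
Variables (X : 'M[R]_(n, d)) (U : 'M[R]_(n, r)) (s : 'rV[R]_r) (V : 'M[R]_(d, r)).
Variables (X' : 'M[R]_(n, t)) (U' : 'M[R]_(n, r')) (s' : 'rV[R]_r')
  (V' : 'M[R]_(t, r')).
Hypotheses (dec : svd_of X U s V) (dec' : svd_of X' U' s' V').
Variable nu : R.
Hypothesis nu0 : 0 < nu.
Hypothesis k0 : (0 < k)%N.
Hypothesis gap0 : nth_sv s k.+1 < nth_sv s k.
(** This is eps |A|_2^2, the denominator of the gap having cancelled. *)
Let eta := nu / (1 + nu) * (nth_sv s k ^+ 2 - nth_sv s k.+1 ^+ 2).
Hypothesis hE : forall x : 'cV_n,
  norm2 ((X' *m X'^T - X *m X^T) *m x) <= eta * norm2 x.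

Let sk1 : 0 <= nth_sv s k.+1. Proof. exact: svd_of_nth_sv_ge0 dec. Qed.
Let sk : 0 < nth_sv s k. Proof. exact: le_lt_trans gap0. Qed.

Let diff_gt0 : 0 < nth_sv s k ^+ 2 - nth_sv s k.+1 ^+ 2.
Proof. by rewrite subr_gt0 ltr_sqr ?nnegrE // ltW. Qed.

Let eta_ge0 : 0 <= eta.
Proof. by rewrite mulr_ge0 ?divr_ge0 // ?ltW // addr_gt0. Qed.

(** The origin of the factor nu / (1 + nu): the perturbation shrinks the gap D to D - eta = D / (1 +
    nu), and eta divided by that is exactly nu. *)
Let etaE : eta / (nth_sv s k ^+ 2 - nth_sv s k.+1 ^+ 2 - eta) = nu.
Proof.
rewrite /eta; set D := _ - _; have D0 : D != 0 by rewrite gt_eqF.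
have nu1 : 1 + nu != 0 by rewrite gt_eqF // addr_gt0.
have -> : D - nu / (1 + nu) * D = D / (1 + nu) by field.
by field; rewrite D0 nu1.
Qed.

Let eta_lt : eta < nth_sv s k ^+ 2 - nth_sv s k.+1 ^+ 2.
Proof.
rewrite -[ltRHS]mul1r ltr_pM2r // ltr_pdivrMr ?addr_gt0 // mul1r.
by rewrite ltrDr.
Qed.

Let hE' (x : 'cV_n) : norm2 ((X *m X^T - X' *m X'^T) *m x) <= eta * norm2 x.
Proof. by rewrite -opprB mulNmx norm2N. Qed.

Let quad_le (Y Z : 'M[R]_n) :
  (forall x : 'cV_n, norm2 ((Y - Z) *m x) <= eta * norm2 x) ->
  forall u, dotv u (Y *m u) <= dotv u (Z *m u) + eta * dotv u u.
Proof.
move=> h u; rewrite -lerBlDl -dotvBr -mulmxBl.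
apply: le_trans (ler_norm _) _; apply: le_trans (dotv_CS _ _) _.
by rewrite -norm2_sqr expr2 mulrCA ler_wpM2l ?norm2_ge0.
Qed.

Lemma perturbed_sv_ge : nth_sv s k ^+ 2 - eta <= nth_sv s' k ^+ 2.
Proof. by rewrite lerBlDr; apply: weyl dec dec' _ _ _ => //; exact: quad_le. Qed.

Lemma perturbed_sv_le : nth_sv s' k.+1 ^+ 2 <= nth_sv s k.+1 ^+ 2 + eta.
Proof. by apply: weyl dec' dec _ _ _ => //; exact: quad_le. Qed.

Lemma perturbed_sv_gt0 : 0 < nth_sv s' k.
Proof.
rewrite lt_def (svd_of_nth_sv_ge0 _ dec') andbT; apply/eqP => e.
have := perturbed_sv_ge; rewrite e expr0n /=; have := eta_lt.
by have := sqr_ge0 (nth_sv s k.+1); lra.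
Qed.

Let P := proj_first k U.
Let P' := proj_first k U'.

(** Stated for two arbitrary decompositions because it serves in both directions, once with X and X'
    and once with their roles exchanged. *)
Let davis_kahan_svd n1 n2 r1 r2 (Y : 'M[R]_(n, n1)) (W1 : 'M[R]_(n, r1)) l1 Z1
    (Y' : 'M[R]_(n, n2)) (W2 : 'M[R]_(n, r2)) l2 Z2 :
  svd_of Y W1 l1 Z1 -> svd_of Y' W2 l2 Z2 -> 0 < nth_sv l2 k ->
  (forall x : 'cV_n, norm2 ((Y' *m Y'^T - Y *m Y^T) *m x) <= eta * norm2 x) ->
  nth_sv s k ^+ 2 - nth_sv s k.+1 ^+ 2 - eta <=
    nth_sv l2 k ^+ 2 - nth_sv l1 k.+1 ^+ 2 ->
  forall v : 'cV_(minn k r2),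
    norm2 (first_cols k W2 *m v - proj_first k W1 *m (first_cols k W2 *m v))
      <= nu * norm2 v.
Proof.
move=> d1 d2 l2k h hgap v; have [W1W _ _ _ _] := d1; have [W2W _ l20 _ _] := d2.
have e (x : 'cV_n) : x - proj_first k W1 *m x = (1%:M - proj_first k W1) *m x.
  by rewrite mulmxBl mul1mx.
have gp : 0 < nth_sv s k ^+ 2 - nth_sv s k.+1 ^+ 2 - eta by rewrite subr_gt0.
(* W D W^T is symmetric, so transposing shows that the projection commutes with the Gram matrix;
   hence [Q *m M = L *m Q] holds for Q = 1 - P with L = M. *)
have PY : proj_first k W1 *m (Y *m Y^T) = Y *m Y^T *m proj_first k W1.
  have := svd_gram_first_cols k d1; set D := diag_mx _ => hD.
  have hP : Y *m Y^T *m proj_first k W1 =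
      first_cols k W1 *m D *m (first_cols k W1)^T.
    by rewrite /proj_first mulmxA hD.
  rewrite hP -[LHS]trmxK trmx_mul proj_first_tr (trmx_mul Y) trmxK hP.
  by rewrite !trmx_mul tr_diag_mx trmxK mulmxA.
rewrite e; apply: le_trans (_ : eta / (nth_sv l2 k ^+ 2 - nth_sv l1 k.+1 ^+ 2) * norm2 v <= _).
  apply: (davis_kahan (L := Y *m Y^T) (M := Y *m Y^T) _ _ _
    (svd_gram_first_cols k d2)) => //.
  - by rewrite mulmxBl mulmxBr mul1mx mulmx1 PY.
  - by move=> x; rewrite -e; exact: (norm2_gram_compl k d1).
  - by move=> x; rewrite -e; exact: norm2_compl_first.
  - exact: first_cols_orth.
  - move=> i; rewrite mxE ler_sqr ?nnegrE ?(nth_sv_ge0 _ l20) //.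
      exact: nth_sv_gt0_first d2 k0 l2k i.
    by rewrite mxE.
  - exact: sqr_ge0.
  - by rewrite -subr_gt0; exact: lt_le_trans hgap.
rewrite ler_wpM2r ?norm2_ge0 // -[leRHS]etaE ler_wpM2l // lef_pV2 ?posrE //.
exact: lt_le_trans hgap.
Qed.

Lemma compl_proj_le b : norm2 (P' *m b - P *m (P' *m b)) <= nu * norm2 (P' *m b).
Proof.
have [UU' _ _ _ _] := dec'.
rewrite norm2_proj_firstE // /P' /proj_first -[first_cols k U' *m _ *m b]mulmxA.
apply: davis_kahan_svd dec dec' perturbed_sv_gt0 hE _ _.
by have := perturbed_sv_ge; lra.
Qed.

(** P (1 - P') is the transpose of (1 - P') P, which Davis-Kahan bounds with the two matrices
    exchanged. *)
Lemma proj_compl_le b :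
  norm2 (P *m (b - P' *m b)) <= nu * norm2 (b - P' *m b).
Proof.
have [UU _ _ _ _] := dec; have [UU' _ _ _ _] := dec'.
set z := b - P' *m b.
(* Inserting the idempotent 1 - P' once more makes the bound relative to |z| instead of |b|; the
   final Pythagorean sum relies on this. *)
have zz : z = (1%:M - P') *m z.
  by rewrite mulmxBl mul1mx /z mulmxBr mulmxA proj_firstK // subrr subr0.
rewrite norm2_proj_firstE // {1}zz mulmxA.
rewrite -[_ *m (1%:M - P')]trmxK; apply: norm2_tr_le; first exact: ltW.
move=> v; rewrite trmx_mul trmxK linearB /= trmx1 proj_first_tr.
rewrite -mulmxA mulmxBl mul1mx.
apply: davis_kahan_svd dec' dec sk hE' _ v.
by have := perturbed_sv_le; lra.
Qed.

Lemma proj_dist b : norm2 (P' *m b - P *m b) <= nu * norm2 b.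
Proof.
have [UU _ _ _ _] := dec; have [UU' _ _ _ _] := dec'.
have e : P' *m b - P *m b = (P' *m b - P *m (P' *m b)) + (- (P *m (b - P' *m b))).
  by rewrite mulmxBr opprB addrA addrNK.
rewrite e norm2_leM ?(ltW nu0) // dotv_pythagoras; last first.
  rewrite dotvNr dotvC dotv_mull proj_first_tr mulmxBr [_ *m (P *m _)]mulmxA.
  by rewrite proj_firstK // subrr dotv0r oppr0.
rewrite dotvNl dotvNr opprK (proj_first_pythagoras k UU' b) mulrDr.
by apply: lerD; rewrite -norm2_leM ?(ltW nu0) ?compl_proj_le ?proj_compl_le.
Qed.

Lemma last_cols_proj_le b :
  norm2 ((last_cols k U)^T *m (P' *m b)) <= nu * norm2 b.
Proof.
have [UU _ _ _ _] := dec; have [UU' _ _ _ _] := dec'.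
apply: le_trans (norm2_last_cols k UU _) _; apply: le_trans (compl_proj_le _) _.
by rewrite ler_wpM2l ?(ltW nu0) // norm2_proj_first.
Qed.

Lemma approx_pcp_proj b : approx_pcp X U V k nu nu b (P' *m b).
Proof.
split; last exact: last_cols_proj_le.
rewrite (pcr_solutionE dec) //; apply: le_trans (ler_dist_norm2 _ _) _.
by rewrite opprB addrA subrK proj_dist.
Qed.

End PCP.

(** * The sketched solution as a projection *)

Section Sketched.
Variables (R : realType) (n d t r k : nat).

(** A S V_k = W diag(l) with W orthonormal and l positive, so its pseudo-inverse is diag(l)^-1 W^T
    and the product of the two is W W^T. *)
Lemma sketched_pcr_solutionE (A : 'M[R]_(n, d)) (S : 'M[R]_(d, t))
    (U : 'M[R]_(n, r)) s V b :
  svd_of (A *m S) U s V -> (0 < k)%N -> 0 < nth_sv s k ->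
  A *m sketched_pcr_solution A S V k b = proj_first k U *m b.
Proof.
move=> dec k0 sk; have [UU _ _ _ _] := dec.
rewrite /sketched_pcr_solution !mulmxA.
rewrite (svd_mul_first_cols k dec); set W := first_cols k U.
set l := first_cols k s.
have WW : W^T *m W = 1%:M by exact: first_cols_orth.
have ll : diag_mx l *m diag_mx (map_mx GRing.inv l) = 1%:M.
  rewrite mulmx_diag -diag_const_mx; congr diag_mx; apply/rowP => i.
  rewrite !mxE mulfV // gt_eqF // (lt_le_trans sk) //.
  by have := nth_sv_gt0_first dec k0 sk i; rewrite mxE.
have ll' : diag_mx (map_mx GRing.inv l) *m diag_mx l = 1%:M.
  by rewrite -ll !mulmx_diag; congr diag_mx; apply/rowP => i; rewrite !mxE mulrC.
have mp : mp_inverse (W *m diag_mx l) (diag_mx (map_mx GRing.inv l) *m W^T).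
  have e1 : W *m diag_mx l *m (diag_mx (map_mx GRing.inv l) *m W^T) = W *m W^T.
    by rewrite mulmxA -[W *m _ *m _]mulmxA ll mulmx1.
  have e2 : diag_mx (map_mx GRing.inv l) *m W^T *m (W *m diag_mx l) = 1%:M.
    by rewrite mulmxA -[_ *m W^T *m W]mulmxA WW mulmx1.
  split; rewrite ?e1 ?e2 ?mul1mx ?trmx1 ?trmx_mul ?trmxK //.
  by rewrite mulmxA -[W *m W^T *m W]mulmxA WW mulmx1.
have -> : mp_pinv (W *m diag_mx l) = diag_mx (map_mx GRing.inv l) *m W^T.
  rewrite /mp_pinv; case: xgetP => [Y _ /= hY|/(_ _ mp)//].
  exact: mp_inverse_unique hY mp.
by rewrite mulmxA -[W *m _ *m _]mulmxA ll mulmx1.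
Qed.

End Sketched.

(** * Independent families *)

Section Independence.
Context {R : realType} {d : measure_display} {T : measurableType d}.
Variable P : probability T R.

Lemma rectangle_measure_unique d1 d2 (T1 : measurableType d1)
    (T2 : measurableType d2) (m1 m2 : {measure set (T1 * T2) -> \bar R}) :
  (m1 setT < +oo)%E ->
  (forall A B, measurable A -> measurable B -> m1 (A `*` B) = m2 (A `*` B)) ->
  forall D, measurable D -> m1 D = m2 D.
Proof.
move=> fin1 h D mD.
pose G : set (set (T1 * T2)) :=
  [set A `*` B | A in measurable & B in measurable].
apply: (measure_unique G (fun=> setT)) => //.
- exact: measurable_prod_measurableType.
- move=> _ _ [A mA [B mB <-]] [A' mA' [B' mB' <-]].
  exists (A `&` A'); first exact: measurableI.
  by exists (B `&` B'); [exact: measurableI|rewrite setXI].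
- by move=> _; exists setT => //; exists setT => //; rewrite setXTT.
- by rewrite bigcup_const //; exists 0%N.
- by move=> _ [A mA [B mB <-]]; exact: h.
Qed.

Lemma measurable_preimage d1 (T1 : measurableType d1) (V : T -> T1) A :
  measurable_fun setT V -> measurable A -> measurable (V @^-1` A).
Proof. by move=> mV mA; rewrite -[X in measurable X]setTI; exact: mV. Qed.

(** P restricted to C and P scaled by P(C), both pushed forward along (V, X), agree on rectangles,
    hence everywhere. This allows one entry to be absorbed into a state while the event [C] on
    everything else stays independent. *)
Lemma pair_indep_event d1 d2 (T1 : measurableType d1) (T2 : measurableType d2)
    (V : T -> T1) (X : T -> T2) (C : set T) :
  measurable_fun setT V -> measurable_fun setT X -> measurable C ->
  (forall A B, measurable A -> measurable B ->
    P (V @^-1` A `&` X @^-1` B) = (P (V @^-1` A) * P (X @^-1` B))%E) ->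
  (forall A B, measurable A -> measurable B ->
    P (V @^-1` A `&` X @^-1` B `&` C) =
    (P (V @^-1` A) * P (X @^-1` B) * P C)%E) ->
  forall D, measurable D ->
    P ((fun w => (V w, X w)) @^-1` D `&` C) =
    (P ((fun w => (V w, X w)) @^-1` D) * P C)%E.
Proof.
move=> mV mX mC h1 h2 D mD.
pose W w := (V w, X w).
have mW : measurable_fun setT W by exact: measurable_fun_pair.
have PC : (fine (P C))%:E = P C by rewrite fineK // fin_num_measure.
have pc0 : 0 <= fine (P C) by rewrite fine_ge0.
pose c := NngNum pc0.
pose m1 : {measure set (T1 * T2) -> \bar R} :=
  measure_function_pushforward__canonical__measure_function_Measure
    (mrestr P mC) mW.
pose m2 : {measure set (T1 * T2) -> \bar R} :=
  mscale c (measure_function_pushforward__canonical__measure_function_Measure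
    P mW).
have -> : P (W @^-1` D `&` C) = m1 D by [].
rewrite (@rectangle_measure_unique _ _ _ _ m1 m2) //=.
- by rewrite /mscale /= PC muleC.
- rewrite /pushforward /mrestr preimage_setT setTI.
  by rewrite (le_lt_trans (probability_le1 _ _)) ?ltry.
- move=> A B mA mB; rewrite /pushforward /mrestr /mscale /= PC.
  have -> : W @^-1` (A `*` B) = V @^-1` A `&` X @^-1` B by [].
  by rewrite h2 // muleC -h1.
Qed.

(** By independence the law of the pair is the product of the laws; Tonelli does the rest. *)
Lemma indep_ge0_integralM d1 d2 (T1 : measurableType d1)
    (T2 : measurableType d2) (V : T -> T1) (X : T -> T2)
    (f : T1 -> \bar R) (g : T2 -> \bar R) :
  measurable_fun setT V -> measurable_fun setT X ->
  (forall A B, measurable A -> measurable B ->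
    P (V @^-1` A `&` X @^-1` B) = (P (V @^-1` A) * P (X @^-1` B))%E) ->
  measurable_fun setT f -> measurable_fun setT g ->
  (forall x, 0 <= f x)%E -> (forall x, 0 <= g x)%E ->
  (\int[P]_w (f (V w) * g (X w)) = \int[P]_w f (V w) * \int[P]_w g (X w))%E.
Proof.
move=> mV mX h mf mg f0 g0.
pose W w := (V w, X w).
have mW : measurable_fun setT W by exact: measurable_fun_pair.
pose V' : {mfun T >-> T1} := mfun_Sub (mem_set mV).
pose X' : {mfun T >-> T2} := mfun_Sub (mem_set mX).
pose W' : {mfun T >-> (T1 * T2)%type} := mfun_Sub (mem_set mW).
pose F (z : T1 * T2) := (f z.1 * g z.2)%E.
have mF : measurable_fun setT F.
  by apply: emeasurable_funM; apply: measurableT_comp.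
have F0 z : (0 <= F z)%E by rewrite mule_ge0.
transitivity (\int[distribution P W']_z F z)%E.
  by rewrite ge0_integral_distribution.
transitivity (\int[distribution P V' \x distribution P X']_z F z)%E.
  apply: eq_measure_integral => A mA _; apply/esym.
  by apply: product_measure_unique.
rewrite fubini_tonelli1 //= /fubini_F /=.
under eq_integral => x _ do rewrite /F /= ge0_integralZl //.
rewrite ge0_integralZr //; last exact: integral_ge0.
by rewrite !ge0_integral_distribution.
Qed.

Section Fold.
Variables (I J : finType) (Z : J -> T -> R) (pi : J -> I).
Variables (Phi : J -> R -> R -> R) (c : I -> R).
Hypothesis mZ : forall a, measurable_fun setT (Z a).
Hypothesis mPhi : forall a, measurable_fun setT (fun z : R * R => Phi a z.1 z.2).
Hypothesis indZ : independent_RVs P Z.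

(* Summation over a row of independent entries, treated one entry at a time: the
   states stay independent of each other and of the entries not yet used. *)
Definition fold_state (l : seq J) (i : I) (w : T) : R :=
  foldr (fun a v => if pi a == i then Phi a (Z a w) v else v) (c i) l.

Lemma measurable_fold_state l i : measurable_fun setT (fold_state l i).
Proof.
rewrite /fold_state; elim: l => [|a l IH] /=; first exact: measurable_cst.
case: eqP => // _.
exact: (measurableT_comp (mPhi a) (measurable_fun_pair (mZ a) IH)).
Qed.

Lemma measurable_bigcap_fin (K : finType) (D : set K) (F : K -> set T) :
  (forall i, measurable (F i)) -> measurable (\bigcap_(i in D) F i).
Proof. by move=> mF; apply: fin_bigcap_measurable. Qed.

Let event l (B : I -> set R) (K : {set J}) (B' : J -> set R) : set T :=
  (\bigcap_(i in [set: I]) (fold_state l i @^-1` B i)) `&`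
  (\bigcap_(a in [set` K]) (Z a @^-1` B' a)).

Let measurable_event l B K B' : (forall i, measurable (B i)) ->
  (forall a, measurable (B' a)) -> measurable (event l B K B').
Proof.
move=> mB mB'; apply: measurableI; apply: measurable_bigcap_fin => i.
  exact: measurable_preimage (@measurable_fold_state _ _) (mB _).
exact: measurable_preimage (mZ _) (mB' _).
Qed.

(** Induction on [l]. The entry [a] changes only the state [pi a]; the new state is a function of
    the old one and [Z a], and this pair is independent of the event [C] about all other states and
    the entries in [K]. *)
Lemma indep_fold l B (K : {set J}) B' : uniq l -> {in K, forall a, a \notin l} ->
  (forall i, measurable (B i)) -> (forall a, measurable (B' a)) ->
  P (event l B K B') =
    ((\prod_(i : I) P (fold_state l i @^-1` B i)) *
     (\prod_(a in K) P (Z a @^-1` B' a)))%E.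
Proof.
elim: l B K B' => [|a l IH] B K B' /=.
  move=> _ _ mB mB'.
  have ZK : P (\bigcap_(a in [set` K]) (Z a @^-1` B' a)) =
      (\prod_(a in K) P (Z a @^-1` B' a))%E.
    apply: (indZ K (E := fun a => Z a @^-1` B' a)) => b.
    by exists (B' b); [exact: mB'|rewrite setTI].
  (* With no entry processed the states are the constants [c], so each state event has probability 0
     or 1. *)
  have [hc|] := pselect (forall i, B i (c i)).
    rewrite [X in (X * _)%E]big1 ?mul1e => [|i _].
      rewrite -ZK /event; congr (P _).
      rewrite (_ : \bigcap_(i in [set: I]) _ = setT) ?setTI //.
      by apply/seteqP; split=> // w _ i _ /=; exact: hc.
    rewrite (_ : _ @^-1` _ = setT) ?probability_setT //.
    by apply/seteqP; split=> // w _ /=; exact: hc.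
  move/existsNP => [i nB]; rewrite (bigD1 i) //=.
  have e0 : fold_state [::] i @^-1` B i = set0 by apply/seteqP; split=> // w.
  rewrite e0 measure0 !mul0e /event (_ : _ `&` _ = set0) ?measure0 //.
  by apply/seteqP; split=> // w [/(_ i Logic.I)]; rewrite e0.
move=> /andP[al ul] hK mB mB'.
pose i0 := pi a.
(* [Bu] and [B'u] replace the condition on one state or one entry; the value [setT] removes it. *)
pose Bu A i := if i == i0 then A else B i.
pose B'u A b := if b == a then A else B' b.
have mBu A : measurable A -> forall i, measurable (Bu A i).
  by move=> mA i; rewrite /Bu; case: ifP.
have mB'u A : measurable A -> forall i, measurable (B'u A i).
  by move=> mA i; rewrite /B'u; case: ifP.
have aK : a \notin K by apply/negP => /hK; rewrite inE eqxx.
have hK' : {in K, forall b, b \notin l}.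
  by move=> b /hK; rewrite inE negb_or => /andP[].
have haK : {in a |: K, forall b, b \notin l}.
  by move=> b; rewrite inE => /orP[/set1P ->//|/hK'].
set V := fold_state l i0.
pose C := event l (Bu setT) K B'.
have mC : measurable C by apply: measurable_event => //; exact: mBu.
pose Q1 := (\prod_(i | i != i0) P (fold_state l i @^-1` B i))%E.
pose Q2 := (\prod_(b in K) P (Z b @^-1` B' b))%E.
have prodBu A : (\prod_i P (fold_state l i @^-1` Bu A i) = P (V @^-1` A) * Q1)%E.
  rewrite (bigD1 i0) //= /Bu eqxx; congr (_ * _)%E.
  by apply: eq_bigr => i /negbTE ->.
have prodB'u X : (\prod_(b in a |: K) P (Z b @^-1` B'u X b) =
    P (Z a @^-1` X) * Q2)%E.
  rewrite big_setU1 //= /B'u eqxx; congr (_ * _)%E.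
  by apply: eq_bigr => b bK; rewrite (negbTE (memPn aK _ bK)).
have PC : P C = (Q1 * Q2)%E.
  by rewrite IH // ?prodBu ?preimage_setT ?probability_setT ?mul1e // ; exact: mBu.
have EV A X : V @^-1` A `&` Z a @^-1` X `&` C = event l (Bu A) (a |: K) (B'u X).
  apply/seteqP; split=> w /=.
    move=> [[VA ZX] [h1 h2]]; split=> i /=.
      move=> _; have := h1 i Logic.I; rewrite /Bu /=.
      by have [->|] := eqVneq i i0.
    rewrite finset.in_setU1 /B'u; have [->|ia] //= := eqVneq i a.
    by move=> iK; exact: h2.
  move=> [h1 h2]; split.
    split; first by have := h1 i0 Logic.I; rewrite /Bu /= eqxx.
    by have := h2 a; rewrite /= finset.setU11 /B'u eqxx; apply.
  split=> i /= => [_|iK].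
    have := h1 i Logic.I; rewrite /Bu /=; by case: ifP.
  have := h2 i; rewrite /= finset.in_setU1 iK orbT /B'u => /(_ isT).
  by rewrite (negbTE (memPn aK _ iK)).
have E2 A X : V @^-1` A `&` Z a @^-1` X =
    event l (fun i => if i == i0 then A else setT) [set a] (fun=> X).
  apply/seteqP; split=> w /=.
    move=> [VA ZX]; split=> i /=; last by rewrite finset.in_set1 => /eqP ->.
    by move=> _; have [->|] := eqVneq i i0.
  move=> [h1 h2]; split; last by apply: h2; rewrite /= finset.in_set1.
  by have := h1 i0 Logic.I; rewrite /= eqxx.
have mV : measurable_fun setT V by exact: measurable_fold_state.
have key := @pair_indep_event _ _ _ _ V (Z a) C mV (mZ a) mC.
(* The pair is ordered (state, entry), whereas [Phi] takes the entry first. *)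
pose D : set (R * R) := (fun z => Phi a z.2 z.1) @^-1` B i0.
have mD : measurable D.
  have ms : measurable_fun setT (fun z : R * R => Phi a z.2 z.1).
    exact: (measurableT_comp (mPhi a)
      (measurable_fun_pair measurable_snd measurable_fst)).
  by rewrite -[D]setTI; exact: ms.
have {key} := key _ _ D mD.
have -> : (fun w => (V w, Z a w)) @^-1` D = fold_state (a :: l) i0 @^-1` B i0.
  by apply/seteqP; split=> w; rewrite /D /fold_state /= eqxx.
have -> : fold_state (a :: l) i0 @^-1` B i0 `&` C = event (a :: l) B K B'.
  apply/seteqP; split=> w /=.
    move=> [h0 [h1 h2]]; split=> // i _ /=.
    have [->|ii] := eqVneq i i0; first by move: h0; rewrite eqxx.
    by have := h1 i Logic.I; rewrite /Bu /= (negbTE ii).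
  move=> [h1 h2]; split; first exact: h1.
  split=> // i _; rewrite /Bu /=; have [->|ii] := eqVneq i i0; first by [].
  have := h1 i Logic.I; rewrite /fold_state /=.
  by rewrite [pi a == i]eq_sym (negbTE ii).
have e1 : (\prod_i P (fold_state (a :: l) i @^-1` B i) =
    P (fold_state (a :: l) i0 @^-1` B i0) * Q1)%E.
  rewrite (bigD1 i0) //=; congr (_ * _)%E; apply: eq_bigr => i ii.
  congr (P _); apply/seteqP; split=> w; rewrite /fold_state /=;
  by rewrite [pi a == i]eq_sym (negbTE ii).
rewrite e1 PC muleA; apply.
- move=> A X mA mX; rewrite E2 IH //.
  + rewrite (bigD1 i0) //= eqxx big1 ?mule1 => [|i /negbTE ->]; last first.
      by rewrite preimage_setT probability_setT.
    by rewrite big_set1.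
  + by move=> b /set1P ->.
  + by move=> i; case: ifP.
- move=> A X mA mX; rewrite EV IH //; [|exact: mBu|exact: mB'u].
  by rewrite prodBu prodB'u muleACA -muleA.
Qed.

End Fold.

End Independence.

(** * Means of products, independence of row sums *)

Section IndependenceConsequences.
Context {R : realType} {d : measure_display} {T : measurableType d}.
Variable P : probability T R.

Definition indep_pair (X Y : T -> R) : Prop :=
  forall A B : set R, measurable A -> measurable B ->
    P (X @^-1` A `&` Y @^-1` B) = (P (X @^-1` A) * P (Y @^-1` B))%E.

(** The nonnegative case, applied to |X| and |Y|, gives the integrability that Fubini's theorem
    needs. *)
Lemma indep_integralM (X Y : T -> R) :
  indep_pair X Y ->
  P.-integrable setT (EFin \o X) -> P.-integrable setT (EFin \o Y) ->
  P.-integrable setT (fun w => (X w * Y w)%:E) /\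
  (\int[P]_w (X w * Y w)%:E = \int[P]_w (X w)%:E * \int[P]_w (Y w)%:E)%E.
Proof.
move=> h iX iY.
have mX : measurable_fun setT X by apply/measurable_EFinP; exact: measurable_int iX.
have mY : measurable_fun setT Y by apply/measurable_EFinP; exact: measurable_int iY.
have iXY : P.-integrable setT (fun w => (X w * Y w)%:E).
  apply/integrableP; split.
    by apply/measurable_EFinP; exact: measurable_funM.
  under eq_integral => w _ do rewrite EFinM abseM.
  rewrite (indep_ge0_integralM (f := fun x : R => `|x%:E|%E)
    (g := fun x : R => `|x%:E|%E) mX mY h) //;
    [|exact: measurableT_comp|exact: measurableT_comp].
  have := (integrableP _ _ _ iX).2; have := (integrableP _ _ _ iY).2 => /= hY hX.
  by rewrite lte_mul_pinfty // ?ge0_fin_numE // integral_ge0.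
split=> //.
pose W w := (X w, Y w).
have mW : measurable_fun setT W by exact: measurable_fun_pair.
pose X' : {mfun T >-> R} := mfun_Sub (mem_set mX).
pose Y' : {mfun T >-> R} := mfun_Sub (mem_set mY).
pose W' : {mfun T >-> (R * R)%type} := mfun_Sub (mem_set mW).
pose F (z : R * R) := (z.1 * z.2)%:E.
have mF : measurable_fun setT F.
  by apply/measurable_EFinP; apply: measurable_funM.
have eqm A : measurable A ->
    (distribution P X' \x distribution P Y')%E A = distribution P W' A.
  by move=> mA; apply: product_measure_unique.
have iF : (distribution P X' \x distribution P Y')%E.-integrable setT F.
  apply/integrableP; split => //.
  rewrite (@eq_measure_integral _ _ _ _ (distribution P W')); last first.
    by move=> A mA _; exact: eqm.
  exact: (integrableP _ _ _ (integrable_pushforward mW mF iXY measurableT)).2.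
transitivity (\int[distribution P W']_z F z)%E.
  by rewrite integral_distribution.
transitivity (\int[distribution P X' \x distribution P Y']_z F z)%E.
  by apply: eq_measure_integral => A mA _; apply/esym; exact: eqm.
rewrite -integral12_prod_meas1 //= /fubini_F /=.
have iX' : (distribution P X').-integrable setT (EFin : R -> \bar R).
  by apply: integrable_pushforward.
have iY' : (distribution P Y').-integrable setT (EFin : R -> \bar R).
  by apply: integrable_pushforward.
have EX : (\int[distribution P X']_x x%:E = \int[P]_w (X w)%:E)%E.
  by rewrite integral_distribution.
have EY : (\int[distribution P Y']_x x%:E = \int[P]_w (Y w)%:E)%E.
  by rewrite integral_distribution.
under eq_integral => x _ do
  rewrite /F /= (eq_integral (fun y => x%:E * y%:E)%E) // integralZl // EY.
have fY : (\int[P]_w (Y w)%:E)%E \is a fin_num by exact: integrable_fin_num.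
by rewrite -(fineK fY) integralZr // EX.
Qed.

(** A subfamily is recovered from the full family by choosing [setT] for the indices outside it. *)
Lemma independent_RVs_full (I : finType) (Y : I -> T -> R) :
  (forall B : I -> set R, (forall i, measurable (B i)) ->
    P (\bigcap_(i in [set: I]) (Y i @^-1` B i)) =
    (\prod_i P (Y i @^-1` B i))%E) ->
  independent_RVs P Y.
Proof.
move=> h J E hE.
pose B i : set R := if i \in J then projT1 (cid2 (hE i)) else setT.
have mB i : measurable (B i).
  by rewrite /B; case: ifP => // _; case: cid2.
have EB i : i \in J -> E i = Y i @^-1` B i.
  by rewrite /B => ->; case: cid2 => /= A _ <-; rewrite setTI.
have := h _ mB.
have -> : \bigcap_(i in [set: I]) (Y i @^-1` B i) = \bigcap_(i in [set` J]) E i.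
  apply/seteqP; split=> w /= hw i; first by move=> iJ; rewrite EB //; exact: hw.
  move=> _; have [iJ|iJ] := boolP (i \in J); first by rewrite -EB //; exact: hw.
  by rewrite /preimage /B (negbTE iJ).
move=> ->; rewrite [RHS]big_mkcond /=; apply: eq_bigr => i _.
have [iJ|iJ] := boolP (i \in J); first by rewrite -EB.
by rewrite /B (negbTE iJ) preimage_setT probability_setT.
Qed.

Lemma independent_RVs_pair (I : finType) (Y : I -> T -> R) i j :
  independent_RVs P Y -> i != j -> indep_pair (Y i) (Y j).
Proof.
move=> h ij A B mA mB.
have := h [set i; j]%SET (fun l => if l == i then Y i @^-1` A
  else if l == j then Y j @^-1` B else setT).
rewrite big_setU1 ?finset.in_set1 // big_set1 eqxx eq_sym (negbTE ij) eqxx.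
move=> <-; last first.
  move=> l; case: eqVneq => [->|_]; first by exists A; rewrite ?setTI.
  case: eqVneq => [->|_]; first by exists B; rewrite ?setTI.
  by exists setT; rewrite ?setTI ?preimage_setT.
congr (P _); apply/seteqP; split=> w /=.
  move=> [wA wB] l /=; rewrite finset.in_set2 => /orP[/eqP ->|/eqP ->].
    by rewrite eqxx.
  by rewrite eq_sym (negbTE ij) eqxx.
move=> hw; split.
  by have := hw i; rewrite /= eqxx; apply; rewrite /= !inE eqxx.
have := hw j; rewrite /= eq_sym (negbTE ij) eqxx; apply.
by rewrite /= !inE eqxx orbT.
Qed.

(** [indep_fold] with one running sum per row and no entries left over. *)
Lemma independent_RVs_rowsum (I J : finType) (Z : I * J -> T -> R) (u : J -> R) :
  (forall a, measurable_fun setT (Z a)) -> independent_RVs P Z ->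
  independent_RVs P (fun i w => \sum_j u j * Z (i, j) w).
Proof.
move=> mZ indZ; apply: independent_RVs_full => B mB.
pose Phi (a : I * J) (z v : R) := u a.2 * z + v.
have mPhi a : measurable_fun setT (fun z : R * R => Phi a z.1 z.2).
  apply: measurable_funD => //; apply: measurable_funM => //.
have := @indep_fold _ _ _ P I (I * J)%type Z fst Phi (fun=> 0) mZ mPhi indZ
  (enum {: I * J}) B finset.set0 (fun=> setT) (enum_uniq _) _ mB _.
have E i w : fold_state Z fst Phi (fun=> 0) (enum {: I * J}) i w =
    \sum_j u j * Z (i, j) w.
  transitivity (\sum_(a <- enum {: I * J} | a.1 == i) u a.2 * Z a w).
    rewrite /fold_state; elim: (enum _) => [|a l IH] /=; first by rewrite big_nil.
    by rewrite big_cons; case: ifP => _ //; rewrite /Phi IH.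
  rewrite big_enum_cond big_mkcond /=.
  rewrite (eq_bigr (fun a : I * J => if a.1 == i then u a.2 * Z (a.1, a.2) w else 0));
    last by case.
  rewrite -(pair_bigA _ (fun i' j => if i' == i then u j * Z (i', j) w else 0)) /=.
  rewrite (bigD1 i) //= eqxx [X in _ + X]big1 ?addr0 // => i' /negbTE ii.
  by rewrite big1 // => j _; rewrite ii.
have E' i : fold_state Z fst Phi (fun=> 0) (enum {: I * J}) i =
    (fun w => \sum_j u j * Z (i, j) w) by apply/funext => w; exact: E.
rewrite big_set0 mule1; under eq_bigr do rewrite E'.
under eq_bigcapr do rewrite E'.
move=> <- //; last by move=> a; rewrite inE.
rewrite [X in P (_ `&` X)](_ : _ = setT) ?setIT //.
by apply/seteqP; split.
Qed.

(** [indep_fold] with a single state: the running product is independent of the next entry. *)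
Lemma independent_RVs_integral_prod (J : finType) (Z : J -> T -> R)
    (g : J -> R -> R) :
  (forall a, measurable_fun setT (Z a)) -> independent_RVs P Z ->
  (forall a, measurable_fun setT (g a)) -> (forall a x, 0 <= g a x) ->
  (\int[P]_w (\prod_a g a (Z a w))%:E = \prod_a \int[P]_w (g a (Z a w))%:E)%E.
Proof.
move=> mZ indZ mg g0.
pose Phi a (z v : R) := g a z * v.
have mPhi a : measurable_fun setT (fun z : R * R => Phi a z.1 z.2).
  by apply: measurable_funM => //; exact: measurableT_comp.
pose st l := fold_state Z (fun=> tt) Phi (fun=> 1) l tt.
have stE l w : st l w = \prod_(a <- l) g a (Z a w).
  rewrite /st /fold_state; elim: l => [|a l IH] /=; first by rewrite big_nil.
  by rewrite big_cons /Phi IH.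
have mst l : measurable_fun setT (st l) by exact: measurable_fold_state.
have ind a l : uniq (a :: l) -> indep_pair (Z a) (st l).
  move=> /= /andP[al ul] A B mA mB.
  have := @indep_fold _ _ _ P unit J Z (fun=> tt) Phi (fun=> 1) mZ mPhi indZ
    l (fun=> B) [set a]%SET (fun=> A) ul _ (fun=> mB) (fun=> mA).
  rewrite big_set1 (big_pred1 tt) => [|[]//].
  rewrite muleC => <-; last by move=> b /set1P ->.
  congr (P _); apply/seteqP; split=> w /=.
    move=> [h1 h2]; split=> [[] _ //|b /=].
    by rewrite finset.in_set1 => /eqP ->.
  move=> [h1 h2]; split; last exact: (h1 tt).
  by apply: h2; rewrite /= finset.in_set1.
have key l : uniq l -> (\int[P]_w (st l w)%:E =
    \prod_(a <- l) \int[P]_w (g a (Z a w))%:E)%E.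
  elim: l => [|a l IH] ul.
    by rewrite big_nil /st /fold_state /= integral_cst //= probability_setT mule1.
  rewrite big_cons -IH; last by case/andP: ul.
  have st0 l' w : 0 <= st l' w by rewrite stE prodr_ge0.
  (* The product rule asks for a function nonnegative on all of R, not merely on the values of the
     state; hence the absolute value. *)
  transitivity (\int[P]_w ((g a (Z a w))%:E * `|st l w|%:E))%E.
    apply: eq_integral => w _; rewrite -EFinM; congr EFin.
    by rewrite ger0_norm // !stE big_cons.
  transitivity (\int[P]_w ((g a (Z a w))%:E) * \int[P]_w (`|st l w|%:E))%E; last first.
    congr (_ * _)%E; apply: eq_integral => w _; congr EFin.
    by rewrite ger0_norm.
  apply: (indep_ge0_integralM (f := fun x : R => (g a x)%:E)
    (g := fun v : R => `|v|%:E) _ _ (ind _ _ ul)) => //.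
  - exact/measurable_EFinP.
  - by apply/measurable_EFinP; exact: normr_measurable.
  - by move=> x; rewrite lee_fin.
have := key _ (enum_uniq J); rewrite big_enum /= => <-.
by apply: eq_integral => w _; rewrite stE big_enum.
Qed.

End IndependenceConsequences.

(** * Measurability of the spectral norm *)

Section SpectralMeasurable.
Context {R : realType} {d : measure_display} {T : measurableType d}.

Lemma measurable_fun_sumr (I : Type) (l : seq I) (Q : pred I) (h : I -> T -> R) :
  (forall i, measurable_fun setT (h i)) ->
  measurable_fun setT (fun w => \sum_(i <- l | Q i) h i w).
Proof.
move=> mh; elim: l => [|i l IH].
  by under eq_fun do rewrite big_nil; exact: measurable_cst.
under eq_fun do rewrite big_cons; case: (Q i) => //.
exact: measurable_funD.
Qed.

Lemma measurable_fun_prodr (I : Type) (l : seq I) (Q : pred I) (h : I -> T -> R) :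
  (forall i, measurable_fun setT (h i)) ->
  measurable_fun setT (fun w => \prod_(i <- l | Q i) h i w).
Proof.
move=> mh; elim: l => [|i l IH].
  by under eq_fun do rewrite big_nil; exact: measurable_cst.
under eq_fun do rewrite big_cons; case: (Q i) => //.
exact: measurable_funM.
Qed.

Lemma random_matrix_cst m n (M : 'M[R]_(m, n)) :
  random_matrix (fun _ : T => M).
Proof. by move=> i j; exact: measurable_cst. Qed.

Lemma random_matrix_mul m n p (M : T -> 'M[R]_(m, n)) (N : T -> 'M[R]_(n, p)) :
  random_matrix M -> random_matrix N -> random_matrix (fun w => M w *m N w).
Proof.
move=> mM mN i j; under eq_fun do rewrite mxE.
by apply: measurable_fun_sumr => l; exact: measurable_funM.
Qed.

Lemma random_matrix_tr m n (M : T -> 'M[R]_(m, n)) :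
  random_matrix M -> random_matrix (fun w => (M w)^T).
Proof. by move=> mM i j; under eq_fun do rewrite mxE; exact: mM. Qed.

Lemma random_matrixB m n (M N : T -> 'M[R]_(m, n)) :
  random_matrix M -> random_matrix N -> random_matrix (fun w => M w - N w).
Proof.
move=> mM mN i j; under eq_fun do rewrite !mxE.
by apply: measurable_funB; [exact: mM|exact: mN].
Qed.

Lemma measurable_dotv m (u v : T -> 'cV[R]_m) :
  random_matrix u -> random_matrix v ->
  measurable_fun setT (fun w => dotv (u w) (v w)).
Proof. by move=> mu mv; apply: random_matrix_mul => //; exact: random_matrix_tr. Qed.

Lemma norm2_small n (x : 'cV[R]_n) e : 0 <= e -> (forall i, `|x i 0| <= e) ->
  norm2 x <= n%:R * e.
Proof.
move=> e0 h; rewrite -ler_sqr ?nnegrE ?norm2_ge0 ?mulr_ge0 // norm2_sqr dotvE.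
apply: (@le_trans _ _ (\sum_(i < n) e ^+ 2)).
  by apply: ler_sum => i _; rewrite -expr2 -real_normK ?num_real // ler_sqr ?nnegrE.
rewrite sumr_const card_ord -[leLHS]mulr_natl exprMn ler_wpM2r ?sqr_ge0 //.
by rewrite -natrX ler_nat; case: n x h => // n _ _; rewrite leq_pmulr.
Qed.

(* Countably many test vectors suffice, which makes the norm measurable. *)
Lemma spectral_norm_le_rat m n (M : 'M[R]_(m, n)) c : 0 <= c ->
  (forall q : 'cV[rat]_n,
    norm2 (M *m map_mx ratr q) <= c * norm2 (map_mx ratr q : 'cV[R]_n)) ->
  spectral_norm M <= c.
Proof.
move=> c0 h; apply: spectral_norm_le => // v; apply/ler_addgt0Pr => e e0.
(* [K] collects the coefficients of |y - v| in the final estimate: the spectral norm from M (y - v),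
   c from comparing |y| with |v|, and 1 for positivity. In [e'], the factor n + 1 keeps the
   denominator nonzero when n = 0. *)
set K := c + spectral_norm M + 1.
have K0 : 0 < K by rewrite ltr_wpDl // addr_ge0 ?spectral_norm_ge0.
pose e' := e / (K * n.+1%:R).
have e'0 : 0 < e' by rewrite divr_gt0 // mulr_gt0.
have hq i : exists q : rat, `|ratr q - v i 0| <= e'.
  have /rat_in_itvoo[q] : v i 0 < v i 0 + e' by rewrite ltrDl.
  rewrite in_itv /= => /andP[q1 q2]; exists q.
  by rewrite ger0_norm ?subr_ge0 ?(ltW q1) // lerBlDl ltW.
pose q : 'cV[rat]_n := \col_i projT1 (cid (hq i)).
pose y : 'cV[R]_n := map_mx ratr q.
have yv : norm2 (y - v) <= n%:R * e'.
  apply: norm2_small => [|i]; first exact: ltW.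
  by rewrite !mxE; case: cid.
have -> : v = y - (y - v) by rewrite opprB addrC subrK.
rewrite {1}mulmxBr; apply: le_trans (ler_norm2B _ _) _.
have h1 := h q; have h2 := spectral_normP M (y - v).
have h3 : norm2 y <= norm2 (y - (y - v)) + norm2 (y - v).
  by rewrite -{1}[y](subrK (y - v)) ler_norm2D.
have h4 : K * norm2 (y - v) <= e.
  apply: le_trans (_ : K * (n%:R * e') <= e); first by rewrite ler_wpM2l // ltW.
  have -> : K * (n%:R * e') = e * (n%:R / n.+1%:R).
    by rewrite /e'; field; rewrite (gt_eqF K0) andbT addrC natr1 pnatr_eq0.
  rewrite ler_piMr ?(ltW e0) // ler_pdivrMr // mul1r ler_nat //.
have h5 : c * norm2 y <= c * (norm2 (y - (y - v)) + norm2 (y - v)).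
  by rewrite ler_wpM2l.
have h6 : K * norm2 (y - v) = c * norm2 (y - v) + spectral_norm M * norm2 (y - v)
  + norm2 (y - v) by rewrite /K; ring.
have := norm2_ge0 (y - v); rewrite -/y in h1; lra.
Qed.

Lemma measurable_spectral_norm_le m n (M : T -> 'M[R]_(m, n)) c :
  random_matrix M -> measurable [set w | spectral_norm (M w) <= c].
Proof.
move=> mM; have [c0|c0] := leP 0 c; last first.
  rewrite [X in measurable X](_ : _ = set0); first exact: measurable0.
  apply/seteqP; split=> // w /=; have := spectral_norm_ge0 (M w); lra.
pose S (q : 'cV[rat]_n) : set T := [set w | norm2 (M w *m map_mx ratr q) <=
    c * norm2 (map_mx ratr q : 'cV[R]_n)].
(* Codes that decode to no rational vector contribute [setT], so the intersection runs over all
   natural numbers. *)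
rewrite [X in measurable X](_ : _ =
  \bigcap_k (if @unpickle ('cV[rat]_n : countType) k is Some q then S q else setT)).
  apply: bigcapT_measurable => k; case: unpickle => [q|]; last exact: measurableT.
  rewrite /S; under eq_set do rewrite norm2_leM //.
  set v := map_mx ratr q : 'cV[R]_n.
  have mv : random_matrix (fun w => M w *m v).
    by apply: random_matrix_mul => //; exact: random_matrix_cst.
  have mb := measurable_fun_ler (measurable_dotv mv mv)
    (measurable_cst (c ^+ 2 * dotv v v)).
  by have := mb measurableT [set true] Logic.I; rewrite setTI.
apply/seteqP; split=> w /=.
  move=> h k _; case: unpickle => [q|//]; rewrite /S /=.
  by apply: le_trans (spectral_normP _ _) _; rewrite ler_wpM2r ?norm2_ge0.
move=> h; apply: spectral_norm_le_rat => // q.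
by have := h (pickle q) Logic.I; rewrite pickleK.
Qed.

(** The event that the norm is below c is the union over k of the events that it is at most c -
    1/(k+1). *)
Lemma measurable_spectral_norm_ge m n (M : T -> 'M[R]_(m, n)) c :
  random_matrix M -> measurable [set w | c <= spectral_norm (M w)].
Proof.
move=> mM.
rewrite [X in measurable X](_ : _ =
  ~` \bigcup_k [set w | spectral_norm (M w) <= c - k.+1%:R^-1]).
  apply: measurableC; apply: bigcupT_measurable => k.
  exact: measurable_spectral_norm_le.
apply/seteqP; split=> w /=.
  move=> h [k _ /= hk]; have k0 : 0 < k.+1%:R^-1 :> R by rewrite invr_gt0.
  by move: (le_trans h hk); rewrite lerBrDr gerDl leNgt k0.
move=> h; rewrite leNgt; apply/negP => lt; apply: h.
pose e := c - spectral_norm (M w).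
have e0 : 0 < e by rewrite subr_gt0.
exists (Num.truncn e^-1) => //=.
rewrite lerBrDl -lerBrDr -/e -[leRHS]invrK lef_pV2 ?posrE ?invr_gt0 //.
by rewrite ltW // truncnS_gt.
Qed.

Lemma measurable_gram_event m n s (G : T -> 'M[R]_(s, m)) (X : 'M[R]_(m, n)) c :
  random_matrix G ->
  measurable [set w | c <= spectral_norm (X^T *m (G w)^T *m G w *m X - X^T *m X)].
Proof.
move=> mG; apply: measurable_spectral_norm_ge; apply: random_matrixB.
  apply: random_matrix_mul; last exact: random_matrix_cst.
  apply: random_matrix_mul => //; apply: random_matrix_mul; first exact: random_matrix_cst.
  exact: random_matrix_tr.
exact: random_matrix_cst.
Qed.

End SpectralMeasurable.

(** * Excess risk *)

Section HasMean.
Context {R : realType} {d : measure_display} {T : measurableType d}.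
Variable P : probability T R.

(** Integrability travels with the value, so that means combine without finiteness side
    conditions. *)
Definition has_mean (f : T -> R) (v : R) : Prop :=
  P.-integrable setT (EFin \o f) /\ (\int[P]_w (f w)%:E = v%:E)%E.

Lemma eq_has_mean f g v : f =1 g -> has_mean f v -> has_mean g v.
Proof. by move=> /funext ->. Qed.

Lemma has_mean_measurable f v : has_mean f v -> measurable_fun setT f.
Proof. by case=> /measurable_int h _; exact/measurable_EFinP. Qed.

Lemma has_mean_cst c : has_mean (fun=> c) c.
Proof.
split; first exact: finite_measure_integrable_cst.
by rewrite integral_cst //= probability_setT mule1.
Qed.

Lemma has_meanD f g v u : has_mean f v -> has_mean g u ->
  has_mean (fun w => f w + g w) (v + u).
Proof.
move=> [i1 e1] [i2 e2]; split; first exact: (integrableD measurableT i1 i2).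
by rewrite (integralD_EFin measurableT i1 i2) e1 e2.
Qed.

Lemma has_meanZ c f v : has_mean f v -> has_mean (fun w => c * f w) (c * v).
Proof.
move=> [i1 e1]; split; first exact: (integrableZl measurableT c i1).
by under eq_integral do rewrite EFinM; rewrite (integralZl measurableT i1) e1.
Qed.

Lemma has_mean_sum (I : Type) (l : seq I) (Q : pred I) (f : I -> T -> R) v :
  (forall i, has_mean (f i) (v i)) ->
  has_mean (fun w => \sum_(i <- l | Q i) f i w) (\sum_(i <- l | Q i) v i).
Proof.
move=> h; elim: l => [|i l IH].
  by rewrite big_nil; apply: eq_has_mean (has_mean_cst 0) => w; rewrite big_nil.
rewrite big_cons; case: ifP => Qi; last first.
  by apply: eq_has_mean IH => w; rewrite big_cons Qi.
by apply: eq_has_mean (has_meanD (h i) IH) => w; rewrite big_cons Qi.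
Qed.

Lemma has_mean_le f g v u : has_mean f v -> has_mean g u ->
  (forall w, f w <= g w) -> v <= u.
Proof.
move=> [i1 e1] [i2 e2] h; rewrite -lee_fin -e1 -e2; apply: le_integral => //.
by move=> w _; rewrite lee_fin.
Qed.

Lemma has_mean_dominated (f g : T -> R) u : measurable_fun setT f -> has_mean g u ->
  (forall w, `|f w| <= g w) -> exists v, has_mean f v.
Proof.
move=> mf [ig _] h.
have i1 : P.-integrable setT (EFin \o f).
  apply: (le_integrable measurableT _ _ ig); first exact/measurable_EFinP.
  move=> w _ /=; rewrite lee_fin (le_trans (h w)) // ler_norm //.
exists (fine (\int[P]_w (f w)%:E)); split => //.
by rewrite fineK // integrable_fin_num.
Qed.

Lemma has_mean_indep X Y v u : indep_pair P X Y ->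
  has_mean X v -> has_mean Y u -> has_mean (fun w => X w * Y w) (v * u).
Proof.
move=> h [i1 e1] [i2 e2]; have [i3 e3] := indep_integralM h i1 i2.
by split=> //; rewrite e3 e1 e2 EFinM.
Qed.

Lemma has_mean_ge0 (f : T -> R) v : measurable_fun setT f -> (forall w, 0 <= f w) ->
  (\int[P]_w (f w)%:E = v%:E)%E -> has_mean f v.
Proof.
move=> mf f0 e; split=> //; apply/integrableP; split; first exact/measurable_EFinP.
under eq_integral => w _ do rewrite /= ger0_norm //.
by rewrite e ltry.
Qed.

(** The hypotheses give only values of integrals. The one of X^2 is finite and X^2 >= 0, which
    yields integrability of X^2; |X| <= 1 + X^2 then yields that of X. *)
Lemma has_mean_sqr (X : T -> R) tau : measurable_fun setT X -> ('E_P[X] = 0)%E ->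
  ('V_P[X] = (tau ^+ 2)%:E)%E ->
  has_mean X 0 /\ has_mean (fun w => X w ^+ 2) (tau ^+ 2).
Proof.
move=> mX E0 V1.
have X2 : has_mean (fun w => X w ^+ 2) (tau ^+ 2).
  apply: has_mean_ge0 => [|w|]; [exact: measurable_funX|exact: sqr_ge0|].
  rewrite -V1 /variance covariance.unlock E0 /= expectation.unlock.
  by apply: eq_integral => w _; congr EFin; rewrite !fctE /= subr0 expr2.
split=> //; have [v [iX e]] : exists v, has_mean X v.
  apply: has_mean_dominated (has_meanD (has_mean_cst 1) X2) _ => // w.
  have := sqr_ge0 (`|X w| - 1); rewrite sqrrB real_normK ?num_real //.
  by have := sqr_ge0 (X w); lra.
by split=> //; move: E0; rewrite expectation.unlock.
Qed.

End HasMean.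

Section FixedDesign.
Context {R : realType} {d : measure_display} {T : measurableType d}.
Variables (P : probability T R) (n : nat) (xi : T -> 'cV[R]_n) (tau : R).
Hypothesis noise : fixed_design_noise P xi tau.

(** Bias and variance: linear and off-diagonal terms vanish by mean zero and pairwise independence,
    which leaves tau^2 tr(M^T M). *)
Lemma noise_quadratic m (c : 'cV[R]_m) (M : 'M[R]_(m, n)) :
  has_mean P (fun w => norm2 (c + M *m xi w) ^+ 2)
    (norm2 c ^+ 2 + tau ^+ 2 * frobenius_norm M ^+ 2).
Proof.
have [mxi ind E0 V1] := noise.
have h j := has_mean_sqr (mxi j 0) (E0 j) (V1 j).
have hxx i j : has_mean P (fun w => xi w i 0 * xi w j 0) ((i == j)%:R * tau ^+ 2).
  have [->|ij] := eqVneq i j.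
    by rewrite mul1r; apply: eq_has_mean (h j).2 => w; rewrite expr2.
  rewrite mul0r -(mulr0 0).
  by apply: has_mean_indep (h i).1 (h j).1; exact: independent_RVs_pair ind ij.
pose F w := norm2 c ^+ 2 + (\sum_j (2 * (M^T *m c) j 0) * xi w j 0 +
  \sum_i \sum_j (M^T *m M) i j * (xi w i 0 * xi w j 0)).
apply: (@eq_has_mean _ _ _ _ F).
  move=> w; rewrite /F !norm2_sqr dotvDl !dotvDr -!addrA; congr (_ + _).
  rewrite (dotvC (M *m _) c) addrA -mulr2n; congr (_ + _).
    by rewrite dotv_mulr dotvE -sumrMnl; apply: eq_bigr => j _; ring.
  rewrite dotv_mull mulmxA dotvE; apply: eq_bigr => i _.
  rewrite mxE mulr_sumr; apply: eq_bigr => j _; ring.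
have -> : tau ^+ 2 * frobenius_norm M ^+ 2 =
    \sum_j (2 * (M^T *m c) j 0) * 0 +
    \sum_i \sum_j (M^T *m M) i j * ((i == j)%:R * tau ^+ 2).
  rewrite big1 ?add0r => [|j _]; last by rewrite mulr0.
  rewrite -frobenius_tr frobenius_sqr mulr_sumr; apply: eq_bigr => i _.
  rewrite [RHS](bigD1 i) //= [X in _ = _ + X]big1 ?addr0 => [|j ji]; last first.
    by rewrite eq_sym (negbTE ji) mul0r mulr0.
  rewrite eqxx mul1r mulrC mxE; congr (_ * _); apply: eq_bigr => l _.
  by rewrite !mxE expr2.
apply: has_meanD; first exact: has_mean_cst.
apply: has_meanD; apply: has_mean_sum => i.
  by apply: has_meanZ; case: (h i).
by apply: has_mean_sum => j; apply: has_meanZ.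
Qed.

Lemma noise_expectation m (c : 'cV[R]_m) (M : 'M[R]_(m, n)) a (g : T -> R) :
  (forall w, g w = norm2 (c + M *m xi w) ^+ 2 / a) ->
  ('E_P[g] = ((norm2 c ^+ 2 + tau ^+ 2 * frobenius_norm M ^+ 2) / a)%:E)%E.
Proof.
move=> /funext ->; have [_] := has_meanZ a^-1 (noise_quadratic c M).
rewrite [(_ + _) / a]mulrC => <-; rewrite expectation.unlock.
by apply: eq_integral => w _; rewrite mulrC.
Qed.

Variables (p : nat) (A : 'M[R]_(n, p)) (f : 'cV[R]_n).
Hypothesis n0 : (0 < n)%N.
Let b w := f + xi w.

Lemma mean_sq_errorE x : mean_sq_error P A b x =
  ((norm2 (A *m x - f) ^+ 2 + tau ^+ 2 * frobenius_norm (1%:M : 'M[R]_n) ^+ 2)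
    / n%:R)%:E.
Proof.
(* The residual is (A x - f) - xi, so the matrix in front of the noise is -1. *)
rewrite -[1%:M]opprK; set N := - 1%:M.
rewrite (_ : frobenius_norm (- N) = frobenius_norm N); last first.
  rewrite /frobenius_norm; congr Num.sqrt; apply: eq_bigr => i _.
  by apply: eq_bigr => j _; rewrite mxE sqrrN.
by apply: noise_expectation => w; rewrite mulNmx mul1mx /b opprD addrA.
Qed.

Lemma mean_sq_error_le x y : (mean_sq_error P A b x <= mean_sq_error P A b y)%E =
  (norm2 (A *m x - f) <= norm2 (A *m y - f)).
Proof.
rewrite !mean_sq_errorE lee_fin ler_pM2r ?invr_gt0 ?ltr0n // lerD2r.
by rewrite ler_sqr ?nnegrE ?norm2_ge0.
Qed.

(** The pseudo-inverse solution [x0] solves the normal equations and has minimal norm among the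
    minimizers, so the choice is not the default; and every minimizer has the same image under A as
    [x0]. *)
Lemma optimal_paramE r (U : 'M[R]_(n, r)) s V : svd_of A U s V ->
  A^T *m (A *m optimal_param P A b - f) = 0.
Proof.
move=> dec; have [UU VV s0 _ AE] := dec.
(* Since the inverse of 0 is 0, this is the pseudo-inverse of diag(s). *)
pose sV := diag_mx (map_mx GRing.inv s).
pose x0 := V *m (sV *m (U^T *m f)).
have nx0 : A^T *m (A *m x0 - f) = 0.
  rewrite mulmxBr {1 2 3}AE !trmx_mul trmxK tr_diag_mx /x0 !mulmxA.
  rewrite -[_ *m U^T *m U]mulmxA UU mulmx1 -[_ *m V^T *m V]mulmxA VV mulmx1.
  rewrite -!mulmxA -mulmxBr (_ : _ - _ = 0) ?mulmx0 //.
  set y := U^T *m f; apply/matrixP => i j; rewrite ord1 mxE [X in _ + X]mxE.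
  rewrite !mul_diag_mxE [map_mx _ _ _ _]mxE [RHS]mxE.
  have [->|si] := eqVneq (s 0 i) 0; first by rewrite !mul0r subrr.
  by rewrite mulVKf // subrr.
have pyth y : norm2 (A *m y - f) ^+ 2 =
    norm2 (A *m (y - x0)) ^+ 2 + norm2 (A *m x0 - f) ^+ 2.
  rewrite !norm2_sqr -dotv_pythagoras; last first.
    by rewrite dotv_mull nx0 dotv0r.
  by rewrite mulmxBr addrA subrK.
have x0min y : (mean_sq_error P A b x0 <= mean_sq_error P A b y)%E.
  rewrite mean_sq_error_le -ler_sqr ?nnegrE ?norm2_ge0 // [leRHS]pyth.
  by rewrite lerDr sqr_ge0.
have eqA y : (mean_sq_error P A b y <= mean_sq_error P A b x0)%E ->
    A *m (y - x0) = 0.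
  rewrite mean_sq_error_le -ler_sqr ?nnegrE ?norm2_ge0 // pyth gerDr => h.
  apply: dotvv_eq0; apply/eqP; rewrite eq_le dotvv_ge0 andbT -norm2_sqr //.
rewrite /optimal_param; case: xgetP => [x _ /= [hx _]|/(_ x0)].
  have /eqP := eqA _ (hx x0); rewrite mulmxBr subr_eq0 => /eqP ->; exact: nx0.
case; split=> // y hy.
have Ay := eqA _ (hy x0).
have : diag_mx s *m (V^T *m (y - x0)) = 0.
  by rewrite -[LHS]mul1mx -UU -!mulmxA (mulmxA U) (mulmxA _ V^T) -AE Ay mulmx0.
(* [x0] lies in the row space and y - x0 in the kernel of A: in coordinate i either s_i = 0, where
   [x0] has no component, or y - x0 has none. *)
move=> DV; have orth : dotv x0 (y - x0) = 0.
  rewrite {1}/x0 dotv_mull; move: DV; set z := V^T *m _ => DV.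
  rewrite dotvE big1 // => i _; rewrite mul_diag_mxE mxE.
  have /matrixP/(_ i 0) := DV; rewrite mul_diag_mxE [RHS]mxE => /eqP.
  by rewrite mulf_eq0 => /orP[/eqP ->|/eqP ->]; rewrite ?invr0 ?mul0r ?mulr0.
have -> : y = x0 + (y - x0) by rewrite addrC subrK.
by rewrite norm2_le dotv_pythagoras ?lerDl ?dotvv_ge0.
Qed.

End FixedDesign.

(** * Right sketching for a fixed sketch *)

Section RightSketch.
Variable R : realType.

Lemma frobenius_proj_first m r k (U : 'M[R]_(m, r)) :
  U^T *m U = 1%:M -> (k <= r)%N -> frobenius_norm (proj_first k U) ^+ 2 = k%:R.
Proof.
move=> UU kr; rewrite frobenius_trace.
rewrite proj_first_tr proj_firstK // /proj_first mxtrace_mulC first_cols_orth //.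
by rewrite mxtrace1 (minn_idPl kr).
Qed.

Lemma nth_sv_gt0_le r (s : 'rV[R]_r) k : 0 < nth_sv s k -> (k <= r)%N.
Proof. by move=> s0; rewrite leqNgt; apply: contraTN s0 => /nth_sv_out ->; rewrite ltxx. Qed.

(** The sketch is fixed here and enters only through its Gram bound. Both estimators have image Q b
    with Q a projection, which gives closed formulas for both risks. *)
Lemma right_sketch (n d k t : nat) (A : 'M[R]_(n, d))
      (U : 'M[R]_(n, minn n d)) (s : 'rV[R]_(minn n d)) (V : 'M[R]_(d, minn n d))
      (f : 'cV[R]_n) (tau nu : R)
      (dX : measure_display) (TX : measurableType dX) (PX : probability TX R)
      (xi : TX -> 'cV[R]_n) (S : 'M[R]_(d, t)) :
    let b := fun w => f + xi w in
    (1 <= k)%N -> singular_value A k.+1 < singular_value A k ->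
    thin_svd A U s V -> fixed_design_noise PX xi tau -> 0 < nu ->
    spectral_norm (A *m S *m (A *m S)^T - A *m A^T) <=
      nu / (1 + nu) * gap k A * spectral_norm A^T ^+ 2 ->
    forall (U' : 'M[R]_(n, minn n t)) (s' : 'rV[R]_(minn n t))
           (V' : 'M[R]_(t, minn n t)),
      thin_svd (A *m S) U' s' V' ->
      (forall w, approx_pcp A U V k nu nu (b w)
                   (A *m sketched_pcr_solution A S V' k (b w))) /\
      (excess_risk PX A b (fun w => sketched_pcr_solution A S V' k (b w))
        <= excess_risk PX A b (fun w => pcr_solution A V k (b w))
           + ((2 * nu + nu ^+ 2) * norm2 f ^+ 2 / n%:R)%:E)%E.
Proof.
move=> b k1 gapA dec noise nu0 hS U' s' V' dec'.
have svE j : (0 < j)%N -> singular_value A j = nth_sv s j.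
  exact: (thin_svd_singular_value dec).
have gaps : nth_sv s k.+1 < nth_sv s k by rewrite -!svE.
have sk : 0 < nth_sv s k.
  by apply: le_lt_trans gaps; exact: svd_of_nth_sv_ge0 dec.
have s1 : 0 < nth_sv s 1.
  by apply: lt_le_trans sk _; case: dec => _ _ s0 sd _; exact: nth_sv_homo.
have hE (x : 'cV_n) : norm2 ((A *m S *m (A *m S)^T - A *m A^T) *m x) <=
    nu / (1 + nu) * (nth_sv s k ^+ 2 - nth_sv s k.+1 ^+ 2) * norm2 x.
  apply: le_trans (spectral_normP _ _) _; rewrite ler_wpM2r ?norm2_ge0 //.
  apply: le_trans hS _; rewrite (svd_spectral_norm (svd_of_tr dec)) /gap !svE //.
  by rewrite -!mulrA mulVf ?mulr1 // sqrf_eq0 gt_eqF.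
have s'k := perturbed_sv_gt0 dec dec' nu0 k1 gaps hE.
have [UU _ _ _ _] := dec; have [UU' _ _ _ _] := dec'.
have skE c : A *m sketched_pcr_solution A S V' k c = proj_first k U' *m c.
  by rewrite (sketched_pcr_solutionE _ dec').
split=> [w|]; first by rewrite skE; exact: (approx_pcp_proj dec dec' nu0 k1 gaps hE).
(* A positive k-th singular value forces k <= min(n, t), so that both projections have rank exactly
   k and equal Frobenius norms. *)
have kr := nth_sv_gt0_le sk; have kr' := nth_sv_gt0_le s'k.
have n0 : (0 < n)%N by rewrite (leq_trans k1) // (leq_trans kr) // geq_minl.
set F := A *m optimal_param PX A b.
have riskE (th : TX -> 'cV[R]_d) (Q : 'M[R]_n) :
    (forall w, A *m th w = Q *m b w) -> excess_risk PX A b th =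
    ((norm2 (Q *m f - F) ^+ 2 + tau ^+ 2 * frobenius_norm Q ^+ 2) / n%:R)%:E.
  move=> h; apply: (noise_expectation noise) => w.
  by rewrite h -/F /b mulmxDr addrAC.
rewrite (riskE _ _ (fun w => skE _)).
rewrite (riskE _ _ (fun w => pcr_solutionE dec _ k1 sk)).
rewrite !frobenius_proj_first // -EFinD lee_fin -mulrDl.
rewrite ler_pM2r ?invr_gt0 ?ltr0n // [leRHS]addrAC lerD2r.
have hP := proj_dist dec dec' nu0 k1 gaps hE f.
(* By the normal equations f - F is orthogonal to the column space of A, which contains P f - F.
   Hence |P f - F| <= |f - P f| <= |f|. *)
have aF : norm2 (proj_first k U *m f - F) <= norm2 f.
  apply: le_trans (norm2_compl_first k UU f).
  set x1 := pcr_solution A V k f.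
  have x1E : proj_first k U *m f = A *m x1 by rewrite (pcr_solutionE dec).
  have -> : f - proj_first k U *m f = (f - F) + (F - proj_first k U *m f).
    by rewrite addrA subrK.
  rewrite norm2_le dotv_pythagoras; last first.
    rewrite x1E -mulmxBr dotv_mulr -opprB mulmxN.
    by rewrite (optimal_paramE noise f n0 dec) oppr0 dotv0l.
  by rewrite -[F - _]opprB dotvNl dotvNr opprK lerDr dotvv_ge0.
set a := norm2 (proj_first k U *m f - F) in aF *.
have a0 : 0 <= a by exact: norm2_ge0.
have hb : norm2 (proj_first k U' *m f - F) <= a + nu * norm2 f.
  have -> : proj_first k U' *m f - F =
      (proj_first k U *m f - F) + (proj_first k U' *m f - proj_first k U *m f).
    by rewrite [RHS]addrC addrA subrK.
  by apply: le_trans (ler_norm2D _ _) _; rewrite lerD2l.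
(* The origin of 2 nu + nu^2: expand the square and use a <= |f| in the cross term. *)
apply: (@le_trans _ _ ((a + nu * norm2 f) ^+ 2)).
  by rewrite ler_sqr ?nnegrE ?norm2_ge0 // addr_ge0 ?mulr_ge0 ?norm2_ge0 // ltW.
have f0 := norm2_ge0 f.
by have := ler_wpM2r (mulr_ge0 (ltW nu0) f0) aF; nra.
Qed.

Lemma right_sketch_event (n d t : nat) (A : 'M[R]_(n, d))
      (dG : measure_display) (TG : measurableType dG) (PG : probability TG R)
      (G : TG -> 'M[R]_(t, d)) eps delta :
    random_matrix G -> gram_property PG G A^T eps delta ->
    exists2 E : set TG, measurable E /\ ((1 - delta)%:E <= PG E)%E &
      forall g, E g -> spectral_norm (A *m (G g)^T *m (A *m (G g)^T)^T - A *m A^T) <=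
        eps * spectral_norm A^T ^+ 2.
Proof.
move=> mG hG; set c := eps * _.
have mB := measurable_gram_event A^T c mG.
exists (~` [set w | c <= spectral_norm (A^T^T *m (G w)^T *m G w *m A^T - A^T^T *m A^T)]).
  split; first exact: measurableC.
  rewrite probability_setC // EFinB leeB //.
move=> g /= /negP; rewrite -ltNge trmx_mul trmxK => /ltW.
by rewrite trmxK !mulmxA.
Qed.

End RightSketch.

(** * Consequences of the gap hypothesis *)

Section SingularGap.
Variable R : realType.

Lemma spectral_norm_tr m n (M : 'M[R]_(m, n)) :
  spectral_norm M^T = spectral_norm M.
Proof.
have h p q (N : 'M[R]_(p, q)) : spectral_norm N^T <= spectral_norm N.
  apply: spectral_norm_le; first exact: spectral_norm_ge0.
  by apply: norm2_tr_le; [exact: spectral_norm_ge0|exact: spectral_normP].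
by apply/eqP; rewrite eq_le h /= -{1}[M]trmxK h.
Qed.

Lemma gap_facts n d k (A : 'M[R]_(n, d)) : (1 <= k)%N ->
  singular_value A k.+1 < singular_value A k ->
  [/\ 0 < spectral_norm A, 0 < gap k A & gap k A <= 1].
Proof.
move=> k1 g; have [U [s [V dec]]] := thin_svd_exists g.
have dec' : svd_of A U s V by [].
have [_ _ s0 sd _] := dec; rewrite (svd_spectral_norm dec').
move: g; rewrite /gap !(thin_svd_singular_value dec) // => g.
have sk1 : 0 <= nth_sv s k.+1 by exact: nth_sv_ge0.
have sk := le_lt_trans sk1 g.
have s1k : nth_sv s k <= nth_sv s 1 by exact: nth_sv_homo.
have s1 := lt_le_trans sk s1k.
split=> //.
  by rewrite divr_gt0 ?exprn_gt0 // subr_gt0 ltr_sqr ?nnegrE // ltW.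
rewrite ler_pdivrMr ?exprn_gt0 // mul1r lerBlDr.
have h : nth_sv s k ^+ 2 <= nth_sv s 1 ^+ 2.
  by rewrite ler_sqr ?nnegrE ?(ltW sk) ?(ltW s1).
by rewrite (le_trans h) // lerDl sqr_ge0.
Qed.

End SingularGap.

(** * CountSketch *)

Section CountSketchMoments.
Variables (R : realType) (s m n : nat).

(** The sum factors over coordinates x; its factor is 0 when x occurs an odd number [N x] of times
    among j, l, j', l', and 2 otherwise. All counts are even only if the two pairs agree up to
    order. *)
Lemma sum_signs (j l j' l' : 'I_m) : j != l -> j' != l' ->
  \sum_(E : {ffun 'I_m -> bool})
     ((-1) ^+ E j * (-1) ^+ E l * ((-1) ^+ E j' * (-1) ^+ E l')) =
  2 ^+ m * (((j', l') == (j, l)) + ((j', l') == (l, j)))%:R :> R.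
Proof.
move=> jl jl'.
pose N i := ((j == i) + (l == i) + ((j' == i) + (l' == i)))%N.
have single (E : {ffun 'I_m -> bool}) (i : 'I_m) :
    (-1) ^+ E i = \prod_x (-1) ^+ (E x * (i == x)) :> R.
  rewrite (bigD1 i) //= eqxx muln1 big1 ?mulr1 // => x xi.
  by rewrite eq_sym (negbTE xi) muln0.
transitivity (\sum_(E : {ffun 'I_m -> bool}) \prod_x (-1) ^+ (E x * N x) : R).
  apply: eq_bigr => E _; rewrite !single -!big_split /=; apply: eq_bigr => x _.
  by rewrite -!exprD -!mulnDr.
rewrite -(bigA_distr_bigA (fun x (b : bool) => (-1) ^+ (b * N x) : R)).
have sb k : \sum_(b : bool) (-1) ^+ (b * k) = (if odd k then 0 else 2) :> R.
  rewrite big_bool /= mul1n mul0n expr0 -signr_odd.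
  by case: (odd k); rewrite ?expr1 ?expr0 ?addNr.
under eq_bigr do rewrite sb.
have [[e1 e2]|ne1] := eqVneq (j', l') (j, l).
  rewrite e1 e2 xpair_eqE (negbTE jl) /= addn0 mulr1.
  rewrite (eq_bigr (fun=> 2)) ?prodr_const ?card_ord // => x _.
  by rewrite /N e1 e2 oddD addbb.
have [[e1 e2]|ne2] := eqVneq (j', l') (l, j).
  rewrite mulr1 (eq_bigr (fun=> 2)) ?prodr_const ?card_ord // => x _.
  by rewrite /N e1 e2 [((l == x) + _)%N]addnC oddD addbb.
rewrite mulr0.
suff [x ox] : exists x, odd (N x) by rewrite (bigD1 x) //= ox mul0r.
move: ne1 ne2; rewrite !xpair_eqE !negb_and => ne1 ne2.
have [jj|jj] := eqVneq j' j.
  exists l; rewrite /N (negbTE jl) eqxx jj (negbTE jl).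
  by move: ne1; rewrite jj eqxx /= => /negbTE ->.
have [jl2|jl2] := eqVneq l' j.
  exists l; rewrite /N (negbTE jl) eqxx jl2 (negbTE jl).
  by move: ne2; rewrite jl2 eqxx orbF => /negbTE ->.
exists j; rewrite /N eqxx eq_sym (negbTE jl).
by rewrite (negbTE jj) (negbTE jl2).
Qed.

(** Two distinct columns share a bucket in a fraction 1/s of the configurations; multiplying by s
    avoids excluding s = 0. *)
Lemma sum_buckets (j l : 'I_m) : j != l ->
  s%:R * \sum_(H : {ffun 'I_m -> 'I_s}) (H j == H l)%:R = s%:R ^+ m :> R.
Proof.
move=> jl.
(* [g v] writes the condition H j = H l = v as a product over coordinates, so that the sum over H
   factors. *)
pose g v (i : 'I_m) (x : 'I_s) : R := if (i == j) || (i == l) then (x == v)%:R else 1.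
have e (H : {ffun 'I_m -> 'I_s}) : (H j == H l)%:R = \sum_v \prod_i g v i (H i).
  rewrite (bigD1 (H j)) //= [X in _ + X]big1 ?addr0 => [|v vj]; last first.
    by rewrite (bigD1 j) //= /g eqxx /= eq_sym (negbTE vj) mul0r.
  rewrite (bigD1 j) //= (bigD1 l) /=; last by rewrite eq_sym.
  rewrite /g !eqxx /= orbT mul1r [H l == _]eq_sym big1 ?mulr1 // => i /andP[ij il].
  by rewrite (negbTE ij) (negbTE il).
under eq_bigr do rewrite e.
rewrite exchange_big /=.
have gE v : s%:R * (s%:R * \sum_(H : {ffun 'I_m -> 'I_s}) \prod_i g v i (H i)) = s%:R ^+ m.
  rewrite -(bigA_distr_bigA (g v)) (bigD1 j) //= (bigD1 l) /=; last by rewrite eq_sym.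
  have one i : (i == j) || (i == l) -> \sum_x g v i x = 1.
    move=> h; rewrite (bigD1 v) //= /g h eqxx big1 ?addr0 // => x /negbTE ->.
    by [].
  rewrite !one ?eqxx ?orbT // !mul1r.
  rewrite (eq_bigr (fun=> s%:R)) => [|i /andP[ij il]]; last first.
    by rewrite /g (negbTE ij) (negbTE il) sumr_const card_ord.
  rewrite prodr_const mulrA -expr2 -exprD; congr (_ ^+ _).
  rewrite (_ : #|_| = #|~: [set j; l]%SET|); last first.
    by apply: eq_card => x; rewrite !inE negb_or.
  by have := cardsC [set j; l]%SET; rewrite cards2 jl card_ord.
case: (posnP s) => [s0|s0].
  have -> : s%:R = 0 :> R by rewrite s0.
  by rewrite mul0r expr0n gtn_eqF // (leq_ltn_trans (leq0n j)).
have s0' : s%:R != 0 :> R by rewrite pnatr_eq0 -lt0n.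
rewrite (eq_bigr (fun=> s%:R ^+ m / s%:R ^+ 2)) => [|v _].
  rewrite sumr_const card_ord -[(_ / _) *+ _]mulr_natl; field; exact: s0'.
by rewrite -(gE v); field.
Qed.

Definition countsketch_mx (H : {ffun 'I_m -> 'I_s}) (E : {ffun 'I_m -> bool}) :
    'M[R]_(s, m) :=
  \matrix_(i, j) ((H j == i)%:R * (-1) ^+ E j).

Definition gram_error t (G : 'M[R]_(t, m)) (X : 'M[R]_(m, n)) : 'M[R]_n :=
  X^T *m G^T *m G *m X - X^T *m X.

Variable X : 'M[R]_(m, n).

Let coef a b (p : 'I_m * 'I_m) := X p.1 a * X p.2 b.

(** The columns of a CountSketch matrix are unit vectors, so the diagonal of G^T G - 1 vanishes. *)
Lemma countsketch_gram_error H E a b :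
  gram_error (countsketch_mx H E) X a b =
  \sum_(p : 'I_m * 'I_m | p.1 != p.2) coef a b p *
     ((H p.1 == H p.2)%:R * ((-1) ^+ E p.1 * (-1) ^+ E p.2)).
Proof.
have gg j l : ((countsketch_mx H E)^T *m countsketch_mx H E) j l =
    (H j == H l)%:R * ((-1) ^+ E j * (-1) ^+ E l).
  rewrite mxE (bigD1 (H j)) //= big1 ?addr0 => [|i ij]; last first.
    by rewrite !mxE eq_sym (negbTE ij) !mul0r.
  by rewrite !mxE eqxx mul1r eq_sym; ring.
have gg1 j : ((countsketch_mx H E)^T *m countsketch_mx H E) j j = 1.
  by rewrite gg eqxx mul1r -expr2 sqrr_sign.
have -> : gram_error (countsketch_mx H E) X =
    X^T *m ((countsketch_mx H E)^T *m countsketch_mx H E - 1%:M) *m X.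
  by rewrite mulmxBr mulmxBl mulmx1 !mulmxA.
set K := _ - _.
have -> : (X^T *m K *m X) a b = \sum_j \sum_l coef a b (j, l) * K j l.
  rewrite -mulmxA mxE; apply: eq_bigr => j _; rewrite !mxE mulr_sumr.
  by apply: eq_bigr => l _; rewrite /coef /=; ring.
rewrite pair_bigA /= [RHS]big_mkcond /=; apply: eq_bigr => -[j l] _ /=.
have -> : K j l = ((countsketch_mx H E)^T *m countsketch_mx H E) j l - (j == l)%:R.
  by rewrite /K mxE; congr (_ + _); rewrite !mxE.
have [->|jl] /= := eqVneq j l; first by rewrite gg1 subrr mulr0.
by rewrite gg subr0.
Qed.

(** E |error|_F^2 <= 2 |X|_F^4 / s, multiplied by s and by the number s^m 2^m of configurations. For
    each entry (a, b) only the products of a pair with itself or with its swap survive the sum over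
    signs. *)
Lemma countsketch_second_moment : s%:R *
  \sum_(H : {ffun 'I_m -> 'I_s}) \sum_(E : {ffun 'I_m -> bool})
    frobenius_norm (gram_error (countsketch_mx H E) X) ^+ 2 <=
  s%:R ^+ m * 2 ^+ m * (2 * (frobenius_norm X ^+ 2) ^+ 2).
Proof.
pose sw (p : 'I_m * 'I_m) := (p.2, p.1).
pose sg (E : {ffun 'I_m -> bool}) (p : 'I_m * 'I_m) : R := (-1) ^+ E p.1 * (-1) ^+ E p.2.
pose ch (H : {ffun 'I_m -> 'I_s}) (p : 'I_m * 'I_m) : R := (H p.1 == H p.2)%:R.
have entry a b : s%:R * (\sum_(H : {ffun 'I_m -> 'I_s}) \sum_(E : {ffun 'I_m -> bool})
    gram_error (countsketch_mx H E) X a b ^+ 2) =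
    s%:R ^+ m * 2 ^+ m * \sum_(p : 'I_m * 'I_m | p.1 != p.2)
      (coef a b p ^+ 2 + coef a b p * coef a b (sw p)).
  transitivity (s%:R * \sum_(p : 'I_m * 'I_m | p.1 != p.2)
      \sum_(q : 'I_m * 'I_m | q.1 != q.2) (coef a b p * coef a b q) *
      ((\sum_H ch H p * ch H q) * (\sum_E sg E p * sg E q))).
    congr (_ * _); under eq_bigr => H _ do under eq_bigr => E _ do
      rewrite countsketch_gram_error expr2 mulr_suml.
    under eq_bigr => H _ do rewrite exchange_big /=.
    rewrite exchange_big /=; apply: eq_bigr => p _.
    under eq_bigr => H _ do under eq_bigr => E _ do rewrite mulr_sumr.
    under eq_bigr => H _ do rewrite exchange_big /=.
    rewrite exchange_big /=; apply: eq_bigr => q _.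
    rewrite mulr_suml mulr_sumr; apply: eq_bigr => H _.
    rewrite !mulr_sumr; apply: eq_bigr => E _; rewrite /ch /sg; ring.
  rewrite !mulr_sumr; apply: eq_bigr => p pp.
  have sp : s%:R * \sum_H ch H p = s%:R ^+ m by exact: sum_buckets.
  have hq (q : 'I_m * 'I_m) : q.1 != q.2 ->
      (coef a b p * coef a b q) * ((\sum_H ch H p * ch H q) * (\sum_E sg E p * sg E q))
      = (\sum_H ch H p) * 2 ^+ m * (coef a b p *
        (coef a b q * ((q == p)%:R + (q == sw p)%:R))).
    move=> qq.
    have -> : \sum_E sg E p * sg E q = 2 ^+ m * ((q == p)%:R + (q == sw p)%:R).
      by have := sum_signs pp qq; rewrite -!surjective_pairing natrD.
    have chE : (q == p) || (q == sw p) -> \sum_H ch H p * ch H q = \sum_H ch H p.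
      move=> /orP[]/eqP ->; apply: eq_bigr => H _; rewrite /ch /sw /=.
        by case: eqP; rewrite ?mulr1 ?mulr0.
      by rewrite [H p.2 == _]eq_sym; case: eqP; rewrite ?mulr1 ?mulr0.
    case: (boolP ((q == p) || (q == sw p))) => [h|]; first by rewrite chE //; ring.
    by rewrite negb_or => /andP[/negbTE -> /negbTE ->]; rewrite addr0 !mulr0.
  rewrite (eq_bigr _ hq) -mulr_sumr mulrA mulrA sp -mulr_sumr; congr (_ * _).
  rewrite expr2 -mulrDr; congr (_ * _).
  under eq_bigr do rewrite mulrDr.
  rewrite big_split /=; congr (_ + _).
    rewrite (bigD1 p) //= eqxx mulr1 big1 ?addr0 // => q /andP[_ /negbTE ->].
    by rewrite mulr0.
  rewrite (bigD1 (sw p)) /=; last by rewrite eq_sym.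
  by rewrite eqxx mulr1 big1 ?addr0 // => q /andP[_ /negbTE ->]; rewrite mulr0.
have entry_le a b : \sum_(p : 'I_m * 'I_m | p.1 != p.2)
    (coef a b p ^+ 2 + coef a b p * coef a b (sw p)) <=
    2 * \sum_(p : 'I_m * 'I_m) coef a b p ^+ 2.
  rewrite big_mkcond /=.
  (* The cross term is at most half the sum of the two squares; reindexing by the swap then gives
     3/2 + 1/2 = 2. *)
  apply: (@le_trans _ _ (\sum_(p : 'I_m * 'I_m)
      (3 / 2 * coef a b p ^+ 2 + 1 / 2 * coef a b (sw p) ^+ 2))).
    apply: ler_sum => p _; case: ifP => _.
      have := sqr_ge0 (coef a b p - coef a b (sw p)); rewrite sqrrB; lra.
    by have := sqr_ge0 (coef a b p); have := sqr_ge0 (coef a b (sw p)); lra.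
  rewrite big_split /= -!mulr_sumr.
  rewrite [X in _ + 1 / 2 * X](reindex_inj (h := sw)) /=; last first.
    by move=> [? ?] [? ?] [-> ->].
  rewrite (eq_bigr (fun p => coef a b p ^+ 2)) => [|[]//]; lra.
have total : \sum_a \sum_b \sum_(p : 'I_m * 'I_m) coef a b p ^+ 2 =
    (frobenius_norm X ^+ 2) ^+ 2.
  rewrite frobenius_sqr [in RHS]exchange_big /= expr2 mulr_suml; apply: eq_bigr => a _.
  rewrite mulr_sumr; apply: eq_bigr => b _.
  rewrite -(pair_bigA _ (fun j l => coef a b (j, l) ^+ 2)) /= mulr_suml.
  apply: eq_bigr => j _; rewrite mulr_sumr; apply: eq_bigr => l _.
  by rewrite /coef /= exprMn.
apply: (@le_trans _ _ (\sum_a \sum_b s%:R ^+ m * 2 ^+ m *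
    (2 * \sum_(p : 'I_m * 'I_m) coef a b p ^+ 2))).
  under eq_bigr => H _ do under eq_bigr => E _ do rewrite frobenius_sqr.
  under eq_bigr => H _ do rewrite exchange_big /=.
  rewrite exchange_big /= mulr_sumr; apply: ler_sum => a _.
  under eq_bigr => H _ do rewrite exchange_big /=.
  rewrite exchange_big /= mulr_sumr; apply: ler_sum => b _.
  by rewrite entry ler_wpM2l // mulr_ge0 ?exprn_ge0.
rewrite -total !mulr_sumr; apply: ler_sum => a _.
by rewrite !mulr_sumr.
Qed.

End CountSketchMoments.

Section CountSketchProbability.
Context {R : realType} {d : measure_display} {T : measurableType d}.
Variable P : probability T R.

Lemma measure_fin_bigcup_le (I : finType) (D : pred I) (F : I -> set T) :
  (forall i, measurable (F i)) ->
  (P (\bigcup_(i in [set i | D i]) F i) <= \sum_(i | D i) P (F i))%E.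
Proof.
move=> mF.
have -> : \bigcup_(i in [set i | D i]) F i = \big[setU/set0]_(i | D i) F i.
  rewrite -bigcup_seq_cond; congr (\bigcup_(t in _) _).
  by apply/seteqP; split=> i /=; rewrite mem_index_enum.
elim: (index_enum I) => [|i l IH]; first by rewrite !big_nil measure0.
rewrite !big_cons; case: ifP => // _.
rewrite (le_trans (measureU2 _ _ _)) ?leeD2l //.
by apply: bigsetU_measurable.
Qed.

(* Finite version of Markov's inequality: the hash functions and the signs are
   uniform over finitely many configurations, so no integral is needed. *)
Lemma countsketch_tail (s m n : nat) (G : T -> 'M[R]_(s, m)) (X : 'M[R]_(m, n)) (c : R) :
  (0 < s)%N -> countsketch P G -> 0 < c ->
  (P [set w | (c <= spectral_norm (gram_error (G w) X))%R] <=
    (2 * (frobenius_norm X ^+ 2) ^+ 2 / (s%:R * c ^+ 2))%:E)%E.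
Proof.
move=> s0 [mG [h [e [uh ue ind ae]]]] c0.
pose cfg : finType := ({ffun 'I_m -> 'I_s} * {ffun 'I_m -> bool})%type.
pose ev (x : cfg) : set T :=
  [set w | (forall j, h j w = x.1 j) /\ (forall j, e j w = x.2 j)].
have evE x : ev x = \bigcap_(a in [set` [set: 'I_m + 'I_m]%SET])
    match a with inl j => [set w | h j w = x.1 j] | inr j => [set w | e j w = x.2 j] end.
  apply/seteqP; split=> w /=.
    by move=> [h1 h2] [j|j] _ /=; [exact: h1|exact: h2].
  move=> h12; split=> j; [apply: (h12 (inl j))|apply: (h12 (inr j))];
  by rewrite /= finset.in_setT.
have mev x : measurable (ev x).
  rewrite evE; apply: fin_bigcap_measurable => [|[j|j] _].
  - exact: finite_finset.
  - by case: (uh j (x.1 j)).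
  - by case: (ue j (x.2 j)).
pose p : R := (s%:R ^- m) * 2 ^- m.
have Pev x : P (ev x) = p%:E.
  rewrite evE ind => [|[j|j]]; last first.
  - by exists [set x.2 j] => //; rewrite setTI.
  - by exists [set x.1 j] => //; rewrite setTI.
  rewrite (eq_bigl predT) => [|a]; last by rewrite finset.in_setT.
  rewrite big_sumType /=.
  under eq_bigr => j _ do rewrite (uh j _).2.
  under [X in (_ * X)%E]eq_bigr => j _ do rewrite (ue j _).2.
  rewrite !prodEFin !prodr_const card_ord -EFinM /p !exprVn //.
pose bad (x : cfg) := c <= spectral_norm (gram_error (countsketch_mx R x.1 x.2) X).
pose B' := \bigcup_(x in [set x : cfg | bad x]) ev x.
have mB' : measurable B' by apply: fin_bigcup_measurable => //; exact: finite_finset.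
have [N [mN PN0 subN]] := ae.
have mB : measurable [set w | c <= spectral_norm (gram_error (G w) X)].
  exact: measurable_gram_event.
(* Off the null set [N] the sketch is [countsketch_mx] of its own configuration. *)
have subB : [set w | c <= spectral_norm (gram_error (G w) X)] `<=` B' `|` N.
  move=> w /= hw; have [Nw|nNw] := pselect (N w); [by right|left].
  have GE : G w = \matrix_(i, j) ((h j w == i)%:R * (-1) ^+ (e j w)).
    by apply: contrapT => nE; apply: nNw; exact: subN.
  pose x : cfg := ([ffun j => h j w], [ffun j => e j w]).
  exists x; last by split=> j; rewrite ffunE.
  rewrite /= /bad (_ : countsketch_mx _ _ _ = G w) // GE.
  by apply/matrixP => i j; rewrite !mxE !ffunE.
have -> : (2 * (frobenius_norm X ^+ 2) ^+ 2 / (s%:R * c ^+ 2))%:E =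
    ((2 * (frobenius_norm X ^+ 2) ^+ 2 / (s%:R * c ^+ 2))%:E + P N)%E.
  by rewrite PN0 adde0.
apply: le_trans (_ : P (B' `|` N) <= _)%E.
  by apply: le_measure; rewrite ?inE //; exact: measurableU.
rewrite (le_trans (measureU2 _ mB' mN)) // leeD2r //.
apply: le_trans (measure_fin_bigcup_le _ mev) _.
under eq_bigr => x _ do rewrite Pev.
rewrite sumEFin lee_fin.
have p0 : 0 <= p by rewrite mulr_ge0 ?invr_ge0 ?exprn_ge0.
pose fr (x : cfg) := frobenius_norm (gram_error (countsketch_mx R x.1 x.2) X).
(* On a bad configuration 1 <= fr^2 / c^2. *)
apply: (@le_trans _ _ (p / c ^+ 2 * \sum_(x : cfg) fr x ^+ 2)).
  rewrite big_mkcond mulr_sumr; apply: ler_sum => x _; case: ifP => [bx|_].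
    rewrite -mulrA ler_peMr // mulrC ler_pdivlMr ?exprn_gt0 // mul1r.
    rewrite ler_sqr ?nnegrE ?(ltW c0) ?sqrtr_ge0 //.
    exact: le_trans bx (spectral_norm_le_frobenius _).
  by rewrite mulr_ge0 ?sqr_ge0 // divr_ge0 ?sqr_ge0.
rewrite -(pair_bigA _ (fun H E => fr (H, E) ^+ 2)) /=.
have := countsketch_second_moment s X.
set S := \sum_H _ => hS.
have s0' : 0 < s%:R :> R by rewrite ltr0n.
have c20 : 0 < c ^+ 2 by rewrite exprn_gt0.
have q0 : 0 < s%:R ^+ m * 2 ^+ m :> R by rewrite mulr_gt0 ?exprn_gt0.
rewrite ler_pdivlMr ?mulr_gt0 // /p.
rewrite (_ : _ * _ * (s%:R * c ^+ 2) = (s%:R * S) / (s%:R ^+ m * 2 ^+ m)).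
  by rewrite ler_pdivrMr // [leRHS]mulrC.
by field; rewrite !expf_neq0 ?(gt_eqF c0) ?(gt_eqF s0').
Qed.

Lemma countsketch_gram (n d' k t : nat) (A : 'M[R]_(n, d')) (nu delta : R)
      (G : T -> 'M[R]_(t, d')) :
    (1 <= k)%N -> singular_value A k.+1 < singular_value A k ->
    0 < nu < 1 / 2 -> 0 < delta ->
    countsketch P G ->
    5 * (stable_rank A ^+ 2 / (gap k A ^+ 2 * nu ^+ 2 * delta)) <= t%:R ->
    gram_property P G A^T (nu / (1 + nu) * gap k A) delta.
Proof.
move=> k1 g /andP[nu0 nu2] delta0 cs ht.
have [A0 g0 _] := gap_facts k1 g.
move: (gap k A) g0 ht => gp g0 ht; set eps := nu / (1 + nu) * gp.
have nu1 : 0 < 1 + nu by rewrite addr_gt0.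
have eps0 : 0 < eps by rewrite /eps mulr_gt0 // divr_gt0.
have den0 : 0 < gp ^+ 2 * nu ^+ 2 * delta by rewrite !(mulr_gt0, exprn_gt0).
have F0 : 0 < frobenius_norm A.
  by apply: lt_le_trans A0 _; exact: spectral_norm_le_frobenius.
have sr0 : 0 < stable_rank A by rewrite divr_gt0 ?exprn_gt0.
have t0 : 0 < t%:R :> R.
  by apply: lt_le_trans ht; rewrite mulr_gt0 // divr_gt0 ?exprn_gt0.
have t0' : (0 < t)%N by rewrite -(ltr0n R).
rewrite /gram_property.
have c0 : 0 < eps * spectral_norm A^T ^+ 2.
  by rewrite spectral_norm_tr mulr_gt0 ?exprn_gt0.
apply: le_trans (countsketch_tail A^T t0' cs c0) _; rewrite lee_fin.
rewrite frobenius_tr spectral_norm_tr.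
have FE : frobenius_norm A ^+ 2 = stable_rank A * spectral_norm A ^+ 2.
  by rewrite /stable_rank divfK // sqrf_eq0 gt_eqF.
rewrite FE; move: (stable_rank A) sr0 ht {FE} => r sr0 ht.
move: (spectral_norm A) A0 {c0} => N A0.
have D0 : 0 < t%:R * (eps * N ^+ 2) ^+ 2.
  apply: mulr_gt0 => //; apply: exprn_gt0; apply: mulr_gt0 => //; exact: exprn_gt0.
rewrite ler_pdivrMr //.
move: ht; rewrite mulrA ler_pdivrMr // => ht.
pose N4 := (N ^+ 2) ^+ 2; have N40 : 0 < N4 by rewrite !exprn_gt0.
rewrite (_ : 2 * _ = 2 * r ^+ 2 * N4); last by rewrite /N4; ring.
rewrite (_ : delta * _ = (delta * (t%:R * eps ^+ 2)) * N4); last by rewrite /N4; ring.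
rewrite ler_pM2r //.
have -> : delta * (t%:R * eps ^+ 2) =
    t%:R * (gp ^+ 2 * nu ^+ 2 * delta) / (1 + nu) ^+ 2.
  by rewrite /eps; field; rewrite gt_eqF.
rewrite ler_pdivlMr ?exprn_gt0 //; apply: le_trans ht.
(* The constant 5: 2 (1 + nu)^2 < 9/2 because nu < 1/2. *)
rewrite mulrAC; apply: ler_wpM2r; first exact: sqr_ge0.
by nra.
Qed.

End CountSketchProbability.

(** * Subgaussian maps *)

Section MeanBound.
Context {R : realType} {d : measure_display} {T : measurableType d}.
Variable P : probability T R.

(** An upper bound for the mean of a nonnegative function carries integrability with it and passes
    to smaller measurable functions. *)
Definition mean_le (f : T -> R) (v : R) : Prop :=
  [/\ measurable_fun setT f, forall w, 0 <= f w &
      (\int[P]_w (f w)%:E <= v%:E)%E].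

Lemma mean_le_dom (f g : T -> R) v : measurable_fun setT f -> (forall w, 0 <= f w) ->
  (forall w, f w <= g w) -> mean_le g v -> mean_le f v.
Proof.
move=> mf f0 fg [mg g0 h]; split=> //; apply: le_trans h.
by apply: ge0_le_integral => //;
  do ?[exact/measurable_EFinP|by move=> w _; rewrite lee_fin].
Qed.

Lemma mean_le_trans f v u : v <= u -> mean_le f v -> mean_le f u.
Proof. by move=> vu [mf f0 h]; split=> //; apply: le_trans h _; rewrite lee_fin. Qed.

Lemma mean_leZ c f v : 0 <= c -> mean_le f v -> mean_le (fun w => c * f w) (c * v).
Proof.
move=> c0 [mf f0 h]; split; first exact: measurable_funM.
  by move=> w; exact: mulr_ge0.
under eq_integral => w _ do rewrite EFinM.
rewrite ge0_integralZl //; [|exact/measurable_EFinP|by move=> w _; rewrite lee_fin].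
by rewrite EFinM lee_wpmul2l // lee_fin.
Qed.

Lemma mean_leD f g v u : mean_le f v -> mean_le g u ->
  mean_le (fun w => f w + g w) (v + u).
Proof.
move=> [mf f0 hf] [mg g0 hg]; split; first exact: measurable_funD.
  by move=> w; exact: addr_ge0.
under eq_integral => w _ do rewrite EFinD.
rewrite ge0_integralD //; [|by move=> w _; rewrite lee_fin|exact/measurable_EFinP
  |by move=> w _; rewrite lee_fin|exact/measurable_EFinP].
by rewrite EFinD leeD.
Qed.

Lemma mean_le_cst c : 0 <= c -> mean_le (fun=> c) c.
Proof.
by move=> c0; split=> //; rewrite (has_mean_cst P c).2.
Qed.

Lemma mean_le_sum (I : Type) (l : seq I) (Q : pred I) (f : I -> T -> R) v :
  (forall i, Q i -> mean_le (f i) (v i)) ->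
  mean_le (fun w => \sum_(i <- l | Q i) f i w) (\sum_(i <- l | Q i) v i).
Proof.
move=> h; elim: l => [|i l IH].
  rewrite big_nil (_ : (fun _ => _) = fun=> 0); first exact: mean_le_cst.
  by apply/funext => w; rewrite big_nil.
rewrite big_cons (_ : (fun _ => _) = fun w =>
    if Q i then f i w + \sum_(i <- l | Q i) f i w else \sum_(i <- l | Q i) f i w).
  by case: ifP => // Qi; apply: mean_leD => //; exact: h.
by apply/funext => w; rewrite big_cons.
Qed.

Lemma mean_le_has_mean f v : mean_le f v -> exists2 u, u <= v & has_mean P f u.
Proof.
move=> [mf f0 h].
have i0 : (0 <= \int[P]_w (f w)%:E)%E by apply: integral_ge0 => w _; rewrite lee_fin.
have fin : (\int[P]_w (f w)%:E)%E \is a fin_num.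
  by rewrite ge0_fin_numE // (le_lt_trans h) // ltry.
exists (fine (\int[P]_w (f w)%:E)); first by rewrite -lee_fin fineK.
by apply: has_mean_ge0 => //; rewrite fineK.
Qed.

Lemma has_mean_mean_le (f : T -> R) v : (forall w, 0 <= f w) -> has_mean P f v -> mean_le f v.
Proof. by move=> f0 h; split=> //; [exact: has_mean_measurable h|rewrite h.2]. Qed.

Lemma mean_le_markov f v : mean_le f v -> (P [set w | (1 <= f w)%R] <= v%:E)%E.
Proof.
move=> [mf f0 h]; set A := [set w | _].
have mA : measurable A.
  have mb := measurable_fun_ler (measurable_cst (1 : R)) mf.
  by have := mb measurableT [set true] Logic.I; rewrite setTI.
apply: le_trans h; rewrite -[X in P X]setIT -integral_indic //.
apply: ge0_le_integral => //;
  do ?[exact/measurable_EFinP|by move=> w _; rewrite lee_fin].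
move=> w _; rewrite lee_fin indicE.
have [Aw|_] := boolP (w \in A); last exact: f0.
by have := set_mem Aw.
Qed.

Lemma mean_le_tail (f : T -> R) v (A : set T) : measurable A -> mean_le f v ->
  (forall w, A w -> 1 <= f w) -> (P A <= v%:E)%E.
Proof.
move=> mA hf h; apply: le_trans (mean_le_markov hf).
have [mf _ _] := hf.
have mb := measurable_fun_ler (measurable_cst (1 : R)) mf.
have mB : measurable [set w | (1 <= f w)%R].
  by have := mb measurableT [set true] Logic.I; rewrite setTI.
by apply: le_measure; rewrite ?inE // => w; exact: h.
Qed.

Lemma measurable_fun_expR (f : T -> R) :
  measurable_fun setT f -> measurable_fun setT (fun w => expR (f w)).
Proof. by move=> mf; exact: (measurableT_comp (@measurable_expR R) mf). Qed.

Lemma measurable_fun_normr (f : T -> R) :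
  measurable_fun setT f -> measurable_fun setT (fun w => `|f w|).
Proof. by move=> mf; exact: (measurableT_comp (@normr_measurable R setT) mf). Qed.

Lemma measurable_funZ c (f : T -> R) :
  measurable_fun setT f -> measurable_fun setT (fun w => c * f w).
Proof. by move=> mf; exact: measurable_funM. Qed.

Definition tail_bound (X : T -> R) (K : R) : Prop :=
  forall u, 0 <= u ->
    (P [set w | (u <= `|X w|)%R] <= (2 * expR (- (u ^+ 2 / K ^+ 2)))%:E)%E.

(** Sum of the geometric series with first term 2 e^(1/(2K^2)) and ratio e^(-1/(2K^2)) that
    dominates the layers below. *)
Definition sqexp_bound (K : R) : R :=
  2 * expR ((2 * K ^+ 2)^-1) * (1 - expR (- (2 * K ^+ 2)^-1))^-1.

(* e^{x^2/(4K^2)} is dominated by the sum over k of e^{(k+1)^2/(4K^2)} on the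
   events |x| >= k. *)
Lemma tail_bound_sqexp (X : T -> R) K : measurable_fun setT X -> 0 < K ->
  tail_bound X K ->
  mean_le (fun w => expR (X w ^+ 2 / (4 * K ^+ 2))) (sqexp_bound K).
Proof.
move=> mX K0 hX; have K20 : 0 < K ^+ 2 by rewrite exprn_gt0.
have K40 : 0 < 4 * K ^+ 2 by rewrite mulr_gt0.
have mA (k : nat) : measurable [set w | k%:R <= `|X w|].
  have mb := measurable_fun_ler (measurable_cst (k%:R : R)) (measurable_fun_normr mX).
  by have := mb measurableT [set true] Logic.I; rewrite setTI.
pose a (k : nat) : R := expR (k.+1%:R ^+ 2 / (4 * K ^+ 2)).
pose g (k : nat) (w : T) : R := a k * \1_[set w | k%:R <= `|X w|] w.
have g0 k w : (0 <= (g k w)%:E)%E by rewrite lee_fin mulr_ge0 ?expR_ge0.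
have mg k : measurable_fun setT (fun w => (g k w)%:E).
  by apply/measurable_EFinP/measurable_funM => //; exact: measurable_indic.
split; first by apply: measurable_fun_expR; apply: measurable_funM => //; exact: measurable_funX.
  by move=> w; exact: expR_ge0.
apply: (@le_trans _ _ (\int[P]_w (\sum_(k <oo) (g k w)%:E))%E).
  have mS : measurable_fun setT (fun w => (\sum_(k <oo) (g k w)%:E)%E).
    exact: ge0_emeasurable_sum.
  have mE : measurable_fun setT (fun w => (expR (X w ^+ 2 / (4 * K ^+ 2)))%:E).
    apply/measurable_EFinP; apply: measurable_fun_expR.
    by apply: measurable_funM => //; exact: measurable_funX.
  apply: ge0_le_integral => //.
  - move=> w _; pose k := Num.truncn `|X w|.
    have /andP[k1 k2] : k%:R <= `|X w| < k.+1%:R by rewrite truncn_itv.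
    apply: (@le_trans _ _ (g k w)%:E); last first.
      rewrite (nneseriesD1 (n := k)) // leeDl // nneseries_ge0 //.
    rewrite lee_fin /g indicE mem_set //= mulr1 ler_expR ler_wpM2r ?invr_ge0 ?(ltW K40) //.
    by rewrite -real_normK ?num_real // ler_sqr ?nnegrE // ltW.
rewrite integral_nneseries //.
pose r := expR (- (2 * K ^+ 2)^-1).
have r0 : 0 < r by exact: expR_gt0.
have r1 : r < 1 by rewrite -expR0 ltr_expR oppr_lt0 invr_gt0 mulr_gt0.
pose b := 2 * expR ((2 * K ^+ 2)^-1).
have hk k : (\int[P]_w (g k w)%:E <= (geometric b r k)%:E)%E.
  under eq_integral => w _ do rewrite EFinM.
  rewrite ge0_integralZl ?lee_fin ?expR_ge0 //; last first.
  - by apply/measurable_EFinP; exact: measurable_indic.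
  rewrite integral_indic // setIT.
  apply: (@le_trans _ _ ((a k)%:E * (2 * expR (- (k%:R ^+ 2 / K ^+ 2)))%:E)%E).
    by rewrite lee_wpmul2l ?lee_fin ?expR_ge0 // hX.
  rewrite -EFinM lee_fin /geometric /= /b /r -expRM_natr mulrCA -!mulrA ler_pM2l //.
  rewrite -!expRD ler_expR.
  (* The numerator is (k - 1)^2 + 2 (k^2 - k), which is nonnegative for integral k. *)
  rewrite -subr_ge0 (_ : _ - _ = ((2 * k%:R ^+ 2 - k.+1%:R ^+ 2 + 2)
    + 2 * (k%:R ^+ 2 - k%:R)) / (4 * K ^+ 2)); last first.
    by field; rewrite gt_eqF.
  rewrite divr_ge0 ?(ltW K40) // -natr1.
  have : k%:R <= k%:R ^+ 2 :> R.
    by rewrite -natrX ler_nat; case: (k) => // k'; rewrite leq_pmulr.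
  by have := sqr_ge0 (k%:R - 1 : R); rewrite sqrrB; lra.
apply: lime_le.
  by apply: is_cvg_nneseries => k _ _; apply: integral_ge0 => w _; exact: g0.
apply: nearW => n.
apply: (@le_trans _ _ (\sum_(0 <= k < n) (geometric b r k)%:E)%E).
  by apply: lee_sum => k _.
rewrite sumEFin lee_fin /sqexp_bound -/r -/b.
apply: geometric_le_lim => //; first by rewrite mulr_ge0 ?expR_ge0.
by rewrite ger0_norm // ltW.
Qed.

End MeanBound.

(** * Moment generating functions *)

Section MomentGenerating.
Context {R : realType} {d : measure_display} {T : measurableType d}.
Variable P : probability T R.

(** The linear term is kept exact so that it disappears from the mean of a centred variable. For 0
    <= x < 1 the bound is (1 - x) e^x <= 1 multiplied by 1 + x. *)
Lemma expR_le_quadratic (x : R) : expR x <= 1 + x + x ^+ 2 * expR `|x|.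
Proof.
have e1 (y : R) : y < 1 -> (1 - y) * expR y <= 1.
  move=> y1; rewrite -ler_pdivlMr ?expR_gt0 // mul1r -expRN.
  by have := expR_ge1Dx (- y).
have [x0|x0] := leP 0 x.
  rewrite (ger0_norm x0); have ex := expR_gt0 x.
  have [x1|x1] := ltP x 1.
    have := ler_wpM2l (_ : 0 <= 1 + x) (e1 _ x1); rewrite addr_ge0 // => /(_ isT).
    by rewrite mulr1; lra.
  have x2 : 1 <= x ^+ 2 by rewrite expr_ge1.
  have := ler_wpM2r (ltW ex) x2; rewrite mul1r; lra.
rewrite (ltr0_norm x0) (expRN x).
have := e1 x; rewrite (lt_trans x0) // => /(_ isT) h.
have ex := expR_gt0 x.
have h2 : expR x <= 1 by rewrite -expR0 ler_expR ltW.
have h3 : 1 - x <= (expR x)^-1 by rewrite -[leRHS]mul1r ler_pdivlMr.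
apply: (@le_trans _ _ (1 + x + x ^+ 2 * (1 - x))); last first.
  by rewrite -expRN in h3 *; rewrite lerD2l ler_wpM2l ?sqr_ge0.
have h4 : 0 < 1 - x by rewrite subr_gt0 (lt_trans x0).
rewrite -(ler_pM2l h4); nra.
Qed.

(** The linear term has mean 0, and 1 + l^2 M <= e^(l^2 M). *)
Lemma mgf_small (X : T -> R) l0 M l :
  has_mean P X 0 ->
  mean_le P (fun w => X w ^+ 2 * expR (l0 * `|X w|)) M -> `|l| <= l0 ->
  mean_le P (fun w => expR (l * X w)) (expR (l ^+ 2 * M)).
Proof.
move=> hX hM ll; have mX := has_mean_measurable hX.
have [u uM hu] := mean_le_has_mean hM.
have hg := has_meanD (has_meanD (has_mean_cst P 1) (has_meanZ l hX))
  (has_meanZ (l ^+ 2) hu).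
have fg w : expR (l * X w) <=
    1 + l * X w + l ^+ 2 * (X w ^+ 2 * expR (l0 * `|X w|)).
  apply: le_trans (expR_le_quadratic _) _; rewrite lerD2l exprMn -mulrA.
  rewrite ler_wpM2l ?sqr_ge0 // ler_wpM2l ?sqr_ge0 // ler_expR normrM.
  by rewrite ler_wpM2r.
have mf : measurable_fun setT (fun w => expR (l * X w)).
  by apply: measurable_fun_expR; exact: measurable_funZ.
have [v hv] : exists v, has_mean P (fun w => expR (l * X w)) v.
  by apply: has_mean_dominated mf hg _ => w; rewrite ger0_norm ?expR_ge0.
have vle := has_mean_le hv hg fg.
apply: mean_le_trans (has_mean_mean_le _ hv); last by move=> w; exact: expR_ge0.
apply: le_trans vle _; rewrite mulr0 addr0.
apply: le_trans (expR_ge1Dx _); rewrite lerD2l ler_wpM2l ?sqr_ge0 //.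
Qed.

(** Used with X = Y for single entries and with X = Y^2 - q for squares of row sums. With y = Y^2 +
    1, the bound c y / 4 <= e^(c y / 4) gives y^2 <= (16 / c^2) e^(c y / 2), and the other half of
    e^(c y) pays for e^(c |X| / 2). *)
Lemma mgf_of_sqexp (X Y : T -> R) c M l : 0 < c ->
  has_mean P X 0 -> measurable_fun setT Y ->
  (forall w, `|X w| <= Y w ^+ 2 + 1) ->
  mean_le P (fun w => expR (c * Y w ^+ 2)) M -> `|l| <= c / 2 ->
  mean_le P (fun w => expR (l * X w)) (expR (l ^+ 2 * (16 / c ^+ 2 * expR c * M))).
Proof.
move=> c0 hX mY XY hM ll; have mX := has_mean_measurable hX.
apply: mgf_small hX _ ll.
have h := mean_leZ (_ : 0 <= 16 / c ^+ 2 * expR c) hM.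
apply: mean_le_dom (h _); last first.
- by rewrite mulr_ge0 ?expR_ge0 // divr_ge0 ?sqr_ge0.
- move=> w; set x := `|X w|; set s := Y w ^+ 2 + 1.
  have xs : x <= s by exact: XY.
  have x0 : 0 <= x by exact: normr_ge0.
  have s0 : 0 <= s by exact: le_trans xs.
  have -> : X w ^+ 2 = x ^+ 2 by rewrite real_normK ?num_real.
  have -> : 16 / c ^+ 2 * expR c * expR (c * Y w ^+ 2) = 16 / c ^+ 2 * expR (c * s).
    by rewrite -mulrA -expRD /s mulrDr mulr1 [c + _]addrC.
  have h1 : c * s / 4 <= expR (c * s / 4).
    by apply: le_trans (expR_ge1Dx _); rewrite lerDr.
  have h2 : s ^+ 2 <= 16 / c ^+ 2 * expR (c * s / 2).
    have -> : c * s / 2 = c * s / 4 + c * s / 4 by field.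
    rewrite expRD -expr2.
    have -> : s ^+ 2 = 16 / c ^+ 2 * (c * s / 4) ^+ 2 by field; rewrite gt_eqF.
    rewrite ler_wpM2l ?divr_ge0 ?sqr_ge0 // ler_sqr ?nnegrE ?expR_ge0 //.
    by rewrite divr_ge0 // mulr_ge0 // ltW.
  have h3 : expR (c / 2 * x) <= expR (c / 2 * s).
    by rewrite ler_expR ler_wpM2l // divr_ge0 // ltW.
  have h4 : x ^+ 2 <= s ^+ 2 by rewrite ler_sqr ?nnegrE.
  apply: (@le_trans _ _ (16 / c ^+ 2 * expR (c * s / 2) * expR (c / 2 * s))).
    by apply: ler_pM; rewrite ?sqr_ge0 ?expR_ge0 // (le_trans h4 h2).
  rewrite -mulrA -expRD (_ : _ + _ = c * s) //; by field.
- by move=> w; rewrite mulr_ge0 ?sqr_ge0 ?expR_ge0.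
- apply: measurable_funM; first exact: measurable_funX.
  by apply: measurable_fun_expR; apply: measurable_funZ; exact: measurable_fun_normr.
Qed.

Lemma mean_le_ge0 (f : T -> R) v : mean_le P f v -> 0 <= v.
Proof.
move=> [_ f0 h]; rewrite -lee_fin; apply: le_trans h.
by apply: integral_ge0 => w _; rewrite lee_fin.
Qed.

(* The first summand serves |l| <= c / 2; otherwise l z <= c z^2 + l^2 / (4 c) and
   M <= expR (M * (4 / c ^+ 2) * l ^+ 2). *)
Definition subgaussian_const (c M : R) : R :=
  16 / c ^+ 2 * expR c * M + (4 * c)^-1 + M * (4 / c ^+ 2).

Lemma mgf_subgaussian (Z : T -> R) c M l : 0 < c -> has_mean P Z 0 ->
  mean_le P (fun w => expR (c * Z w ^+ 2)) M ->
  mean_le P (fun w => expR (l * Z w)) (expR (subgaussian_const c M * l ^+ 2)).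
Proof.
move=> c0 hZ hM; have mZ := has_mean_measurable hZ.
have M0 := mean_le_ge0 hM.
have c2 : 0 < c ^+ 2 by rewrite exprn_gt0.
have t1 : 0 <= 16 / c ^+ 2 * expR c * M.
  by rewrite !mulr_ge0 ?expR_ge0 // invr_ge0 ltW.
have t2 : 0 <= (4 * c)^-1 by rewrite invr_ge0 mulr_ge0 // ltW.
have t3 : 0 <= M * (4 / c ^+ 2) by rewrite mulr_ge0 // divr_ge0 // ltW.
have [ll|ll] := leP `|l| (c / 2).
  apply: mean_le_trans (mgf_of_sqexp (Y := Z) c0 hZ mZ _ hM ll).
    by rewrite ler_expR mulrC ler_wpM2r ?sqr_ge0 // /subgaussian_const -addrA lerDl addr_ge0.
  move=> w; rewrite -[X in X + 1]real_normK ?num_real //.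
  have := sqr_ge0 (`|Z w| - 1); rewrite sqrrB; have := sqr_ge0 `|Z w|; lra.
have h := mean_leZ (expR_ge0 (l ^+ 2 / (4 * c))) hM.
apply: mean_le_trans (mean_le_dom _ _ _ h); last 3 first.
- by apply: measurable_fun_expR; exact: measurable_funZ.
- by move=> w; exact: expR_ge0.
- move=> w; rewrite -expRD ler_expR -subr_ge0.
  rewrite (_ : _ - _ = (l - 2 * c * Z w) ^+ 2 / (4 * c)); last first.
    by field; rewrite gt_eqF.
  by rewrite divr_ge0 ?sqr_ge0 // mulr_ge0 // ltW.
have l2 : 1 <= 4 / c ^+ 2 * l ^+ 2.
  rewrite mulrAC ler_pdivlMr // mul1r -[l ^+ 2]real_normK ?num_real //.
  have : (c / 2) ^+ 2 <= `|l| ^+ 2.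
    by rewrite ler_sqr ?nnegrE ?divr_ge0 ?(ltW c0) // ltW.
  by rewrite exprMn; lra.
have hMe : M <= expR (M * (4 / c ^+ 2) * l ^+ 2).
  apply: (@le_trans _ _ (expR M)).
    by apply: le_trans (expR_ge1Dx _); rewrite lerDr.
  by rewrite ler_expR -mulrA ler_peMr.
apply: (@le_trans _ _ (expR (l ^+ 2 / (4 * c)) * expR (M * (4 / c ^+ 2) * l ^+ 2))).
  by rewrite ler_wpM2l ?expR_ge0.
rewrite -expRD ler_expR /subgaussian_const !mulrDl [l ^+ 2 / _]mulrC.
by have := mulr_ge0 t1 (sqr_ge0 l); lra.
Qed.

Lemma mean_le_prod (J : finType) (Z : J -> T -> R) (g : J -> R -> R) v :
  (forall a, measurable_fun setT (Z a)) -> independent_RVs P Z ->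
  (forall a, measurable_fun setT (g a)) -> (forall a x, 0 <= g a x) ->
  (forall a, mean_le P (fun w => g a (Z a w)) (v a)) ->
  mean_le P (fun w => \prod_a g a (Z a w)) (\prod_a v a).
Proof.
move=> mZ ind mg g0 h; split.
- by apply: measurable_fun_prodr => a; exact: (measurableT_comp (mg a) (mZ a)).
- by move=> w; exact: prodr_ge0.
rewrite independent_RVs_integral_prod //.
have i0 a : (0 <= \int[P]_w (g a (Z a w))%:E)%E.
  by apply: integral_ge0 => w _; rewrite lee_fin.
elim: (index_enum J) => [|a l IH]; first by rewrite !big_nil.
rewrite !big_cons EFinM; apply: lee_pmul => //; last by case: (h a).
by apply: prode_ge0 => b _.
Qed.

Variables (J : finType) (Z : J -> T -> R) (B : R).
Hypothesis mZ : forall a, measurable_fun setT (Z a).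
Hypothesis indZ : independent_RVs P Z.

Lemma linear_mgf (u : J -> R) l :
  (forall a l, mean_le P (fun w => expR (l * Z a w)) (expR (B * l ^+ 2))) ->
  mean_le P (fun w => expR (l * \sum_a u a * Z a w))
    (expR (B * (\sum_a u a ^+ 2) * l ^+ 2)).
Proof.
move=> h.
have e (w : T) : expR (l * \sum_a u a * Z a w) = \prod_a expR ((l * u a) * Z a w).
  rewrite mulr_sumr expR_sum; apply: eq_bigr => a _; by rewrite mulrA.
rewrite (_ : (fun w => _) = fun w => \prod_a expR ((l * u a) * Z a w)); last first.
  by apply/funext.
rewrite (_ : expR (B * _ * _) = \prod_a expR (B * (l * u a) ^+ 2)); last first.
  rewrite -expR_sum; congr expR; rewrite mulr_sumr mulr_suml.
  by apply: eq_bigr => a _; ring.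
apply: (mean_le_prod (g := fun a x => expR ((l * u a) * x)) mZ indZ) => //.
by move=> a; apply: measurable_fun_expR; apply: measurable_funZ.
Qed.

Lemma linear_second_moment (u : J -> R) :
  (forall a, has_mean P (Z a) 0) -> (forall a, has_mean P (fun w => Z a w ^+ 2) 1) ->
  has_mean P (fun w => (\sum_a u a * Z a w) ^+ 2) (\sum_a u a ^+ 2).
Proof.
move=> h1 h2.
have hz a b : has_mean P (fun w => Z a w * Z b w) (a == b)%:R.
  have [->|ab] := eqVneq a b.
    by apply: eq_has_mean (h2 b) => w; rewrite expr2.
  rewrite (_ : _%:R = 0 * 0); last by rewrite mulr0.
  by apply: has_mean_indep (h1 a) (h1 b); exact: independent_RVs_pair indZ ab.
apply: (@eq_has_mean _ _ _ _ (fun w => \sum_a \sum_b (u a * u b) * (Z a w * Z b w))).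
  move=> w; rewrite expr2 mulr_suml; apply: eq_bigr => a _.
  by rewrite mulr_sumr; apply: eq_bigr => b _; ring.
rewrite (_ : \sum_a u a ^+ 2 = \sum_a \sum_b (u a * u b) * (a == b)%:R); last first.
  apply: eq_bigr => a _; rewrite (bigD1 a) //= eqxx mulr1 big1 ?addr0 // => b ba.
  by rewrite eq_sym (negbTE ba) mulr0.
by apply: has_mean_sum => a; apply: has_mean_sum => b; exact: has_meanZ.
Qed.

(** Chernoff's bound for both signs at once. It lets [tail_bound_sqexp] be applied a second time, to
    linear combinations of the entries. *)
Lemma mgf_tail_bound (Y : T -> R) : 0 < B -> measurable_fun setT Y ->
  (forall l, mean_le P (fun w => expR (l * Y w)) (expR (B * l ^+ 2))) ->
  tail_bound P Y (Num.sqrt (4 * B)).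
Proof.
move=> B0 mY h v v0; rewrite sqr_sqrtr ?mulr_ge0 ?(ltW B0) //.
(* The minimizer of B l^2 - l v. *)
pose l := v / (2 * B).
have l0 : 0 <= l by rewrite divr_ge0 // mulr_ge0 // ltW.
have hf := mean_leZ (expR_ge0 (- (l * v))) (mean_leD (h l) (h (- l))).
have mA : measurable [set w | v <= `|Y w|].
  have mb := measurable_fun_ler (measurable_cst (v : R)) (measurable_fun_normr mY).
  by have := mb measurableT [set true] Logic.I; rewrite setTI.
have -> : 2 * expR (- (v ^+ 2 / (4 * B))) =
    expR (- (l * v)) * (expR (B * l ^+ 2) + expR (B * (- l) ^+ 2)).
  rewrite sqrrN (_ : expR (B * l ^+ 2) + _ = 2 * expR (B * l ^+ 2)); last by ring.
  rewrite mulrCA -expRD; congr (_ * expR _).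
  by rewrite /l; field; rewrite gt_eqF.
apply: mean_le_tail mA hf _ => w /= hw.
rewrite expRN mulrC ler_pdivlMr ?expR_gt0 // mul1r.
have [Y0|Y0] := leP 0 (Y w).
  rewrite ger0_norm // in hw; apply: (@le_trans _ _ (expR (l * Y w))).
    by rewrite ler_expR ler_wpM2l.
  by rewrite lerDl expR_ge0.
rewrite ltr0_norm // in hw; apply: (@le_trans _ _ (expR (- l * Y w))).
  by rewrite ler_expR mulNr -mulrN ler_wpM2l.
by rewrite lerDr expR_ge0.
Qed.

End MomentGenerating.

(** * Transfer from the law to the entries *)

Section LawTransfer.
Context {R : realType} {d d' : measure_display} {T : measurableType d}
  {T' : measurableType d'}.
Variables (P : probability T R) (D : probability T' R).
Variable Z : T -> T'.
Hypothesis mZ : measurable_fun setT Z.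
Hypothesis lawZ : forall B, measurable B -> P (Z @^-1` B) = D B.

Lemma has_mean_law (g : T' -> R) v :
  has_mean D g v -> has_mean P (fun w => g (Z w)) v.
Proof.
move=> hg; have mg := has_mean_measurable hg; have [ig eg] := hg.
pose Z' : {mfun T >-> T'} := mfun_Sub (mem_set mZ).
have mgE : measurable_fun setT (EFin \o g) by exact/measurable_EFinP.
have iP : P.-integrable setT (EFin \o (fun w => g (Z w))).
  apply/integrableP; split.
    by apply/measurable_EFinP; exact: (measurableT_comp mg mZ).
  have := (integrableP _ _ _ ig).2; rewrite (@eq_measure_integral _ _ _ _ (distribution P Z')).
    by rewrite ge0_integral_distribution //; exact: measurableT_comp.
  by move=> A mA _; apply/esym; exact: lawZ.
split=> //; rewrite -eg.
rewrite (@eq_measure_integral _ _ _ _ (distribution P Z')).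
  by rewrite integral_distribution.
by move=> A mA _; apply/esym; exact: lawZ.
Qed.

End LawTransfer.

Section LawTransferR.
Context {R : realType} {d : measure_display} {T : measurableType d}.
Variables (P : probability T R) (D : probability (measurableTypeR R) R).
Variable Z : T -> R.
Hypothesis mZ : measurable_fun setT Z.
Hypothesis lawZ : forall B : set (measurableTypeR R), measurable B ->
  P (Z @^-1` B) = D B.

Lemma has_mean_lawR (g : measurableTypeR R -> R) v :
  has_mean D g v -> has_mean P (fun w => g (Z w)) v.
Proof.
apply: (has_mean_law (Z := Z : T -> measurableTypeR R)) => //.
Qed.

Lemma tail_bound_law K : 0 <= K ->
  (forall u : R, 0 <= u ->
    (D [set x | (u <= `|x : R|)%R] <= (2 * expR (- (u ^+ 2 / K ^+ 2)))%:E)%E) ->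
  tail_bound P Z K.
Proof.
move=> K0 h u u0; apply: le_trans (h u u0); rewrite -lawZ //.
have mb := measurable_fun_ler (measurable_cst (u : R))
  (measurable_fun_normr (@measurable_id _ (measurableTypeR R) setT)).
by have := mb measurableT [set true] Logic.I; rewrite setTI.
Qed.

End LawTransferR.

(** * Concentration of the norm of a sketched vector *)

Section Rows.
Context {R : realType}.

(** The tail of an entry gives its exponential square moment ([c1]), then its mgf ([B]). A row sum
    Y_i has an mgf with the same [B] since |u| <= 1, hence a tail ([K2]), and the same passage
    ([c2]) leads to the mgf of Y_i^2 - |u|^2. The rows are independent, and t |G u|^2 is the sum of
    the Y_i^2. All constants come from the tail parameter K alone. *)
Lemma sketch_mgf (D : probability (measurableTypeR R) R) : subgaussian_law D ->
  exists M th0 : R, [/\ 0 < M, 0 < th0 &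
  forall (t m : nat) (d : measure_display) (T : measurableType d)
    (P : probability T R) (G : T -> 'M[R]_(t, m)),
  sketch_with_law P D G -> (0 < t)%N ->
  forall (u : 'cV[R]_m) th, norm2 u <= 1 -> `|th| <= th0 ->
  mean_le P (fun w => expR (th * t%:R * (norm2 (G w *m u) ^+ 2 - norm2 u ^+ 2)))
    (expR (M * th ^+ 2 * t%:R))].
Proof.
move=> [E0 V1 [K K0 tailD]].
have K20 : 0 < K ^+ 2 by rewrite exprn_gt0.
pose c1 := (4 * K ^+ 2)^-1.
have c10 : 0 < c1 by rewrite invr_gt0 mulr_gt0.
have sqexp_ge0 (k : R) : 0 < k -> 0 <= sqexp_bound k.
  move=> k0; rewrite /sqexp_bound !mulr_ge0 ?expR_ge0 //.
  by rewrite invr_ge0 subr_ge0 -expR0 ler_expR oppr_le0 invr_ge0 mulr_ge0 ?sqr_ge0.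
pose B := subgaussian_const c1 (sqexp_bound K).
have B0 : 0 < B.
  rewrite /B /subgaussian_const -addrA ltr_wpDl //.
    by rewrite mulr_ge0 ?sqexp_ge0 // mulr_ge0 ?expR_ge0 // divr_ge0 ?sqr_ge0.
  rewrite ltr_wpDr ?invr_gt0 ?mulr_gt0 //.
  by rewrite mulr_ge0 ?sqexp_ge0 // divr_ge0 ?sqr_ge0.
pose K2 := Num.sqrt (4 * B).
have K20' : 0 < K2 by rewrite sqrtr_gt0 mulr_gt0.
pose c2 := (4 * K2 ^+ 2)^-1.
have c20 : 0 < c2 by rewrite invr_gt0 mulr_gt0 // exprn_gt0.
pose M3 := 16 / c2 ^+ 2 * expR c2 * sqexp_bound K2.
have M30 : 0 <= M3.
  by rewrite mulr_ge0 ?sqexp_ge0 // mulr_ge0 ?expR_ge0 // divr_ge0 ?sqr_ge0.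
(* [M3] is only known to be nonnegative, so 1 is added; [c2 / 2] is the range of [mgf_of_sqexp]. *)
exists (M3 + 1), (c2 / 2); split.
- by rewrite ltr_wpDl.
- by rewrite divr_gt0.
move=> t m d T P G [Z [mZ lawZ indZ GZ]] t0 u th u1 hth.
have t0' : 0 < t%:R :> R by rewrite ltr0n.
have [hx hx2] : has_mean D (fun x : measurableTypeR R => x : R) 0 /\
    has_mean D (fun x : measurableTypeR R => (x : R) ^+ 2) (1 ^+ 2).
  by apply: has_mean_sqr => //; rewrite V1 expr1n.
have hZ a : has_mean P (Z a) 0 by exact: (has_mean_lawR (mZ a) (lawZ a) hx).
have hZ2 a : has_mean P (fun w => Z a w ^+ 2) 1.
  by have := has_mean_lawR (mZ a) (lawZ a) hx2; rewrite expr1n.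
have sqZ a : mean_le P (fun w => expR (c1 * Z a w ^+ 2)) (sqexp_bound K).
  have := tail_bound_sqexp (mZ a) K0 (tail_bound_law (lawZ a) (ltW K0) tailD).
  by rewrite (_ : (fun w => _) = fun w => expR (c1 * Z a w ^+ 2)) //;
    apply/funext => w; rewrite mulrC.
have mgfZ a l : mean_le P (fun w => expR (l * Z a w)) (expR (B * l ^+ 2)).
  exact: mgf_subgaussian.
set q := norm2 u ^+ 2.
have qE : \sum_j u j 0 ^+ 2 = q.
  by rewrite /q norm2_sqr dotvE; apply: eq_bigr => j _; rewrite expr2.
have q1 : q <= 1 by rewrite expr_le1 ?norm2_ge0.
have q0 : 0 <= q by exact: sqr_ge0.
pose Y i w := \sum_j u j 0 * Z (i, j) w.
have mY i : measurable_fun setT (Y i).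
  by apply: measurable_fun_sumr => j; exact: measurable_funZ.
(* A row sum seen as a combination of all entries, in the form that [linear_mgf] takes. *)
pose ui i (a : 'I_t * 'I_m) : R := if a.1 == i then u a.2 0 else 0.
have YE i w : Y i w = \sum_a ui i a * Z a w.
  rewrite [RHS](eq_bigr (fun a : 'I_t * 'I_m => ui i (a.1, a.2) * Z (a.1, a.2) w));
    last by case.
  rewrite -(pair_bigA _ (fun i' j => ui i (i', j) * Z (i', j) w)) /=.
  rewrite (bigD1 i) //= [X in _ + X]big1 ?addr0 => [|i' ii]; last first.
    by rewrite big1 // => j _; rewrite /ui /= (negbTE ii) mul0r.
  by apply: eq_bigr => j _; rewrite /ui /= eqxx.
have uiE i : \sum_a ui i a ^+ 2 = q.
  rewrite (eq_bigr (fun a : 'I_t * 'I_m => ui i (a.1, a.2) ^+ 2)); last by case.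
  rewrite -(pair_bigA _ (fun i' j => ui i (i', j) ^+ 2)) /=.
  rewrite (bigD1 i) //= [X in _ + X]big1 ?addr0 => [|i' ii]; last first.
    by rewrite big1 // => j _; rewrite /ui /= (negbTE ii) expr0n.
  by rewrite -qE; apply: eq_bigr => j _; rewrite /ui /= eqxx.
have mgfY i l : mean_le P (fun w => expR (l * Y i w)) (expR (B * l ^+ 2)).
  have := linear_mgf mZ indZ (ui i) l mgfZ; rewrite uiE => h.
  rewrite (_ : (fun w => _) = fun w => expR (l * \sum_a ui i a * Z a w)); last first.
    by apply/funext => w; rewrite YE.
  apply: mean_le_trans h; rewrite ler_expR ler_wpM2r ?sqr_ge0 //.
  by rewrite ler_piMr // ltW.
have sqY i : mean_le P (fun w => expR (c2 * Y i w ^+ 2)) (sqexp_bound K2).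
  have := tail_bound_sqexp (mY i) K20' (mgf_tail_bound B0 (mY i) (mgfY i)).
  by rewrite (_ : (fun w => _) = fun w => expR (c2 * Y i w ^+ 2)) //;
    apply/funext => w; rewrite mulrC.
have hY i : has_mean P (fun w => Y i w ^+ 2 - q) 0.
  rewrite (_ : 0 = q + (-1) * q); last by rewrite mulN1r subrr.
  apply: (@eq_has_mean _ _ _ _ (fun w => (\sum_a ui i a * Z a w) ^+ 2 + (-1) * q)).
    by move=> w; rewrite -YE mulN1r.
  apply: has_meanD; last exact: has_mean_cst.
  by rewrite -{1}(uiE i); apply: linear_second_moment.
have mgfV i : mean_le P (fun w => expR (th * (Y i w ^+ 2 - q))) (expR (th ^+ 2 * M3)).
  apply: (mgf_of_sqexp (Y := Y i)) => // w.
  have := sqr_ge0 (Y i w); rewrite ler_norml; lra.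
have indY : independent_RVs P Y by exact: (independent_RVs_rowsum (u := fun j => u j 0)).
have := mean_le_prod (g := fun i y => expR (th * (y ^+ 2 - q))) mY indY _ _ mgfV.
have mg : forall i : 'I_t, measurable_fun setT (fun y : R => expR (th * (y ^+ 2 - q))).
  move=> i; apply: measurable_fun_expR; apply: measurable_funZ.
  by apply: measurable_funB => //; exact: measurable_funX.
move=> /(_ mg (fun _ _ => expR_ge0 _)).
rewrite -expR_sum sumr_const card_ord.
rewrite (_ : (fun w => \prod_a _) = fun w =>
    expR (th * t%:R * (norm2 (G w *m u) ^+ 2 - q))).
  apply: mean_le_trans; rewrite ler_expR -[leLHS]mulr_natr mulrC [th ^+ 2 * _]mulrC.
  by rewrite mulrC ler_pM2r // ler_wpM2r ?sqr_ge0 // lerDl.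
apply/funext => w; rewrite -expR_sum; congr expR; rewrite -mulr_sumr -mulrA; congr (_ * _).
rewrite sumrB sumr_const card_ord -mulr_natl mulrBr; congr (_ - _); last by rewrite mulr1 mulr_natl.
rewrite norm2_sqr dotvE mulr_sumr; apply: eq_bigr => i _.
have -> : (G w *m u) i 0 = (Num.sqrt t%:R)^-1 * Y i w.
  rewrite mxE GZ /Y mulr_sumr; apply: eq_bigr => j _; rewrite mxE; ring.
by rewrite mulr1 -expr2 exprMn exprVn sqr_sqrtr ?ler0n // mulVKf // gt_eqF.
Qed.

(** The n-th power of y <= e^y at y = x / n. *)
Lemma exprn_le_expR (n : nat) (x : R) : (0 < n)%N -> 0 <= x ->
  x ^+ n <= n%:R ^+ n * expR x.
Proof.
move=> n0 x0; have n0' : 0 < n%:R :> R by rewrite ltr0n.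
have h : x / n%:R <= expR (x / n%:R).
  by apply: le_trans (expR_ge1Dx _); rewrite lerDr.
have -> : x ^+ n = n%:R ^+ n * (x / n%:R) ^+ n.
  by rewrite -exprMn mulrC divfK // gt_eqF.
rewrite ler_wpM2l ?exprn_ge0 //.
have -> : expR x = expR (x / n%:R) ^+ n.
  by rewrite -expRM_natr -mulrA mulVf ?mulr1 // gt_eqF.
by rewrite lerXn2r ?nnegrE ?expR_ge0 // divr_ge0.
Qed.

(** From h^(2p) <= (2p / a)^(2p) (e^(a h) + e^(-a h)). *)
Lemma even_moment (d : measure_display) (T : measurableType d) (P : probability T R)
    (h : T -> R) (p : nat) a V : (0 < p)%N -> 0 < a -> measurable_fun setT h ->
  mean_le P (fun w => expR (a * h w)) V ->
  mean_le P (fun w => expR (- a * h w)) V ->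
  mean_le P (fun w => h w ^+ (2 * p)) (((2 * p)%:R / a) ^+ (2 * p) * (2 * V)).
Proof.
move=> p0 a0 mh h1 h2.
have c0 : 0 <= ((2 * p)%:R / a) ^+ (2 * p) by rewrite exprn_ge0 // divr_ge0 // ltW.
have := mean_leZ c0 (mean_leD h1 h2).
rewrite (_ : V + V = 2 * V); last by ring.
apply: mean_le_dom; first exact: measurable_funX.
  by move=> w; rewrite exprM exprn_ge0 // sqr_ge0.
move=> w; have n0 : (0 < 2 * p)%N by rewrite muln_gt0.
have ah : 0 <= a * `|h w| by rewrite mulr_ge0 // ltW.
have := exprn_le_expR n0 ah; rewrite exprMn => hh.
have -> : h w ^+ (2 * p) = `|h w| ^+ (2 * p).
  by rewrite !exprM real_normK ?num_real.
rewrite exprMn exprVn mulrAC ler_pdivlMr ?exprn_gt0 // mulrC.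
apply: le_trans hh _; rewrite ler_wpM2l ?exprn_ge0 //.
have [h0|h0] := leP 0 (h w); first by rewrite ger0_norm // lerDl expR_ge0.
by rewrite ltr0_norm // mulrN -mulNr lerDr expR_ge0.
Qed.

End Rows.

(** * Lattice nets for quadratic forms *)

Section Net.
Variable R : realType.
Variable N : nat.

Definition supported (J : {set 'I_N}) (x : 'cV[R]_N) : Prop :=
  forall i, i \notin J -> x i 0 = 0.

Lemma supportedD J x y : supported J x -> supported J y -> supported J (x + y).
Proof. by move=> hx hy i iJ; rewrite mxE hx // hy // addr0. Qed.

Lemma supportedZ J a x : supported J x -> supported J (a *: x).
Proof. by move=> hx i iJ; rewrite mxE hx // mulr0. Qed.

Lemma supportedB J x y : supported J x -> supported J y -> supported J (x - y).
Proof. by move=> hx hy; rewrite -scaleN1r; apply/supportedD/supportedZ. Qed.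

Lemma supported_sub (J J' : {set 'I_N}) x :
  {subset J <= J'} -> supported J x -> supported J' x.
Proof. by move=> sub hx i iJ; apply: hx; apply: contra iJ; exact: sub. Qed.

Section Quadratic.
Variable H : 'M[R]_N.
Hypothesis Hsym : H^T = H.

Let bil u v := dotv u (H *m v).

Lemma symmetric_bilinearC u v : bil u v = bil v u.
Proof. by rewrite /bil dotv_mulr Hsym dotvC. Qed.

(** The vectors |v| u + |u| v and |v| u - |u| v have squared norms with sum 4 |u|^2 |v|^2, and their
    forms differ by 4 |u| |v| [bil u v]. *)
Lemma polarization (J : {set 'I_N}) c : 0 <= c ->
  (forall x, supported J x -> `|bil x x| <= c * norm2 x ^+ 2) ->
  forall u v, supported J u -> supported J v ->
    `|bil u v| <= c * (norm2 u * norm2 v).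
Proof.
move=> c0 h u v hu hv.
have [->|u0] := eqVneq u 0.
  by rewrite /bil dotv0l normr0 !mulr_ge0 ?norm2_ge0.
have [->|v0] := eqVneq v 0.
  by rewrite /bil mulmx0 dotv0r normr0 !mulr_ge0 ?norm2_ge0.
have a0 := norm2_gt0 u0; have b0 := norm2_gt0 v0.
set a := norm2 u in a0 *; set b := norm2 v in b0 *.
have h1 := h _ (supportedD (supportedZ b hu) (supportedZ a hv)).
have h2 := h _ (supportedB (supportedZ b hu) (supportedZ a hv)).
have e : bil (b *: u + a *: v) (b *: u + a *: v) -
    bil (b *: u - a *: v) (b *: u - a *: v) = 4 * (a * b) * bil u v.
  have vu := symmetric_bilinearC v u; rewrite /bil in vu *.
  rewrite !mulmxDr !mulmxN -!scalemxAr !(dotvDl, dotvDr, dotvNl, dotvNr, dotvZl, dotvZr) vu.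
  ring.
have nn : norm2 (b *: u + a *: v) ^+ 2 + norm2 (b *: u - a *: v) ^+ 2 =
    4 * (a * b) * (a * b).
  rewrite !norm2_sqr !(dotvDl, dotvDr, dotvNl, dotvNr, dotvZl, dotvZr).
  rewrite (dotvC v u) -(norm2_sqr u) -(norm2_sqr v) -/a -/b; ring.
have ab0 : 0 < 4 * (a * b) by rewrite !mulr_gt0.
rewrite -(ler_pM2l ab0) -[X in X * `|_|](gtr0_norm ab0) -normrM -e.
apply: le_trans (ler_normB _ _) _; apply: le_trans (lerD h1 h2) _.
by rewrite -mulrDr nn mulrCA.
Qed.

End Quadratic.

Section Grid.
Variable p : nat.
Hypothesis p0 : (0 < p)%N.

(* With this step, rounding towards 0 moves a vector with p entries by at most 1/4. *)
Definition grid_step : R := (4 * Num.sqrt p%:R)^-1.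

(** Sign and magnitude of each coordinate in units of the step. Magnitudes up to 4 p suffice: |x_i|
    <= 1 gives at most 4 sqrt p units. *)
Definition grid_index : finType :=
  {ffun 'I_N -> (bool * 'I_(4 * p).+1)%type}.

Definition grid_point (f : grid_index) : 'cV[R]_N :=
  \col_i (grid_step * ((-1) ^+ (f i).1 * (f i).2%:R)).

(** The sum condition says that the point has norm at most 1. Outside J one representative of 0 is
    prescribed, so that only the coordinates in J are counted. *)
Definition grid (J : {set 'I_N}) : pred grid_index := fun f =>
  [forall i, (i \notin J) ==> (f i == (false, ord0))] &&
  (\sum_i (f i).2 ^ 2 <= 16 * p)%N.

Lemma grid_step_gt0 : 0 < grid_step.
Proof. by rewrite invr_gt0 mulr_gt0 // sqrtr_gt0 ltr0n. Qed.

Lemma grid_step_sqr : grid_step ^+ 2 = (16 * p%:R)^-1.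
Proof.
rewrite /grid_step exprVn exprMn sqr_sqrtr ?ler0n //.
by congr (_ * _)^-1; ring.
Qed.

Lemma grid_point_supported J f : grid J f -> supported J (grid_point f).
Proof.
move=> /andP[/forallP h _] i iJ; rewrite mxE.
by have := h i; rewrite iJ /= => /eqP ->; rewrite /= mulr0 mulr0.
Qed.

Lemma norm2_grid_point J f : grid J f -> norm2 (grid_point f) <= 1.
Proof.
move=> /andP[_ h]; rewrite -ler_sqr ?nnegrE ?norm2_ge0 // expr1n norm2_sqr dotvE.
rewrite (eq_bigr (fun i => grid_step ^+ 2 * ((f i).2 ^ 2)%:R)) => [|i _]; last first.
  rewrite mxE -expr2 exprMn; congr (_ * _).
  by rewrite exprMn sqrr_sign mul1r natrX.
rewrite -mulr_sumr -natr_sum grid_step_sqr mulrC ler_pdivrMr ?mul1r; last first.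
  by rewrite mulr_gt0 // ltr0n.
by rewrite -natrM ler_nat.
Qed.

(** Rounding towards 0 increases no |x_i|, so the point stays in the unit ball, and the zeros
    outside J receive the prescribed index. *)
Lemma grid_approx (J : {set 'I_N}) x : (#|J| <= p)%N -> supported J x -> norm2 x <= 1 ->
  exists2 f, grid J f & norm2 (x - grid_point f) <= 1 / 4.
Proof.
move=> Jp hx x1; have h0 := grid_step_gt0; have h2 := grid_step_sqr.
set h := grid_step in h0 h2.
have xx : \sum_i x i 0 ^+ 2 <= 1.
  have -> : \sum_i x i 0 ^+ 2 = norm2 x ^+ 2.
    by rewrite norm2_sqr dotvE; apply: eq_bigr => i _; rewrite expr2.
  by rewrite expr_le1 ?norm2_ge0.
have xi1 i : x i 0 ^+ 2 <= 1.
  apply: le_trans xx; rewrite (bigD1 i) //= lerDl sumr_ge0 // => j _; exact: sqr_ge0.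
have p1 : 1 <= p%:R :> R by rewrite ler1n.
pose k i := Num.truncn (`|x i 0| / h).
have kh i : (k i)%:R * h <= `|x i 0| < (k i).+1%:R * h.
  rewrite -ler_pdivlMr // -ltr_pdivrMr //; apply: truncn_itv.
  by rewrite divr_ge0 // ltW.
have kL i : (k i < (4 * p).+1)%N.
  rewrite ltnS -(ler_nat R) -(ler_pM2r h0).
  have /andP[k1 _] := kh i; apply: le_trans k1 _.
  rewrite -ler_sqr ?nnegrE ?mulr_ge0 ?(ltW h0) // real_normK ?num_real //.
  apply: le_trans (xi1 i) _; rewrite exprMn h2 natrM exprMn.
  rewrite ler_pdivlMr ?mulr_gt0 ?(lt_le_trans _ p1) // mul1r; nra.
pose f : grid_index := [ffun i => (x i 0 < 0, Ordinal (kL i))].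
have fx i : `|x i 0 - grid_point f i 0| = `|x i 0| - (k i)%:R * h.
  have /andP[k1 _] := kh i.
  rewrite mxE ffunE /= -/h; have [xi|xi] := ltP (x i 0) 0.
    rewrite expr1 (ltr0_norm xi) in k1 *; rewrite ler0_norm; last by lra.
    by ring.
  rewrite expr0 (ger0_norm xi) in k1 *; rewrite ger0_norm; last by lra.
  by ring.
exists f.
  apply/andP; split.
    apply/forallP => i; apply/implyP => iJ; rewrite ffunE /= hx // ltxx.
    apply/eqP; congr (_, _); apply: val_inj => /=.
    by rewrite /k hx // normr0 mul0r truncn0.
  rewrite -(ler_nat R) natr_sum.
  apply: (@le_trans _ _ (\sum_i x i 0 ^+ 2 / h ^+ 2)).
    apply: ler_sum => i _; rewrite ffunE /= natrX ler_pdivlMr ?exprn_gt0 //.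
    rewrite -exprMn -[leRHS]real_normK ?num_real // ler_sqr ?nnegrE ?mulr_ge0 ?(ltW h0) //.
    by have /andP[] := kh i.
  by rewrite -mulr_suml h2 invrK natrM ler_piMl.
have hJ : norm2 (x - grid_point f) ^+ 2 <= (1 / 4) ^+ 2.
  rewrite norm2_sqr dotvE.
  apply: (@le_trans _ _ (\sum_(i in J) h ^+ 2)).
    rewrite [leRHS]big_mkcond /=; apply: ler_sum => i _; rewrite [X in X * X]mxE [X in _ + X]mxE.
    rewrite -expr2 -real_normK ?num_real // fx; case: ifPn => iJ.
      have /andP[k1 k2] := kh i; rewrite ler_sqr ?nnegrE ?(ltW h0) ?subr_ge0 //.
      by move: k2; rewrite -natr1 mulrDl mul1r; lra.
    by rewrite /k hx // normr0 mul0r truncn0 mul0r subrr expr0n.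
  rewrite sumr_const h2 -[leLHS]mulr_natr mulrC ler_pdivrMr ?mulr_gt0 ?(lt_le_trans _ p1) //.
  have : #|J|%:R <= p%:R :> R by rewrite ler_nat.
  by rewrite expr2; lra.
by rewrite ler_sqr ?nnegrE ?norm2_ge0 in hJ.
Qed.

Lemma sum_half_pow_le n : \sum_(i < n) (2 ^- i : R) <= 2.
Proof.
suff -> : \sum_(i < n) (2 ^- i : R) = 2 - 2 * 2 ^- n.
  by rewrite lerBlDr lerDl mulr_ge0 // invr_ge0 exprn_ge0.
elim: n => [|n IH]; first by rewrite big_ord0 expr0 invr1 mulr1 subrr.
rewrite big_ord_recr /= IH exprS; field.
by rewrite expf_neq0.
Qed.

(* Each point of the grid has weight at least 2^(-16p) under the product of the
   weights 2^(-j), whose total mass is at most 4 per coordinate. *)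
Lemma card_grid (J : {set 'I_N}) : (#|J| <= p)%N -> #|grid J|%:R <= 2 ^+ (18 * p) :> R.
Proof.
move=> Jp.
pose g (i : 'I_N) (v : bool * 'I_(4 * p).+1) : R :=
  if i \in J then 2 ^- v.2 else (v == (false, ord0))%:R.
have g0 i v : 0 <= g i v by rewrite /g; case: ifP => // _; rewrite invr_ge0 exprn_ge0.
apply: (@le_trans _ _ (2 ^+ (16 * p) * \sum_(f : grid_index) \prod_i g i (f i))).
  rewrite -sum1_card natr_sum mulr_sumr big_mkcond /=; apply: ler_sum => f _.
  rewrite (_ : (f \in grid J) = grid J f) //.
  have [/andP[/forallP hf1 hf2]|_] := boolP (grid J f); last first.
    by rewrite mulr_ge0 ?exprn_ge0 ?prodr_ge0.
  have gE i : g i (f i) = 2 ^- (f i).2.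
    rewrite /g; case: ifPn => // iJ; have := hf1 i; rewrite iJ /= => /eqP ->.
    by rewrite eqxx expr0 invr1.
  (* Since j <= j^2, the exponent is at most the sum of squares, hence at most 16 p. *)
  rewrite (eq_bigr _ (fun i _ => gE i)) prodfV -expr_sum.
  rewrite ler_pdivlMr ?exprn_gt0 // mul1r ler_eXn2l ?ltr1n //.
  apply: leq_trans hf2; apply: leq_sum => i _.
  by case: (f i).2 => -[|j] _ //=; rewrite -mulnn leq_pmulr.
rewrite -(bigA_distr_bigA g).
have bnd i : \sum_v g i v <= if i \in J then 4 else 1.
  rewrite /g; case: ifP => iJ.
    rewrite -(pair_bigA _ (fun (b : bool) (j : 'I_(4 * p).+1) => 2 ^- j)) /=.
    by rewrite big_bool /=; have := sum_half_pow_le (4 * p).+1; lra.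
  by rewrite (bigD1 (false, ord0)) //= big1 ?addr0 // => v /negbTE ->.
apply: (@le_trans _ _ (2 ^+ (16 * p) * \prod_(i : 'I_N) (if i \in J then 4 else 1))).
  rewrite ler_wpM2l ?exprn_ge0 //; apply: ler_prod => i _.
  by rewrite bnd andbT sumr_ge0.
rewrite -big_mkcond prodr_const (_ : 4 = 2 ^+ 2 :> R); last by ring.
by rewrite -exprM -exprD ler_eXn2l ?ltr1n // (_ : 18 = 16 + 2)%N // mulnDl leq_add2l leq_mul2l.
Qed.

(** Let c be the supremum over the unit vectors and shorter ones supported on J. With x rounded to
    z, the forms at x and z differ by <x - z, H (x + z)>, which is at most c (1/4) 2. So c <= beta +
    c / 2. *)
Lemma grid_quadratic (H : 'M[R]_N) (J : {set 'I_N}) beta : H^T = H -> (#|J| <= p)%N -> 0 <= beta ->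
  (forall f, grid J f -> `|dotv (grid_point f) (H *m grid_point f)| <= beta) ->
  forall x, supported J x -> `|dotv x (H *m x)| <= 2 * beta * norm2 x ^+ 2.
Proof.
move=> Hsym Jp beta0 hb.
pose S : set R := [set `|dotv x (H *m x)| | x in [set x | supported J x /\ norm2 x <= 1]].
have supS : has_sup S.
  split; first by exists `|dotv 0 (H *m 0)|; exists 0 => //=; split;
    [by move=> i _; rewrite mxE|rewrite norm2_0].
  exists (spectral_norm H) => _ [x [_ x1] <-].
  apply: le_trans (dotv_CS _ _) _.
  apply: (@le_trans _ _ (1 * (spectral_norm H * 1))); last by rewrite mul1r mulr1.
  apply: ler_pM; rewrite ?norm2_ge0 //; apply: le_trans (spectral_normP _ _) _.
  by rewrite ler_wpM2l ?spectral_norm_ge0.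
pose c := sup S.
have cS x : supported J x -> norm2 x <= 1 -> `|dotv x (H *m x)| <= c.
  by move=> hx x1; apply: (ub_le_sup supS.2); exists x.
have c0 : 0 <= c.
  apply: le_trans (cS 0 _ _); rewrite ?norm2_0 //; last by move=> i _; rewrite mxE.
have cq x : supported J x -> `|dotv x (H *m x)| <= c * norm2 x ^+ 2.
  move=> hx; have [->|x0] := eqVneq x 0.
    by rewrite dotv0l normr0 mulr_ge0 ?sqr_ge0.
  have nx := norm2_gt0 x0.
  rewrite -ler_pdivrMr ?exprn_gt0 //.
  have := cS ((norm2 x)^-1 *: x) (supportedZ _ hx).
  rewrite norm2Z ger0_norm ?invr_ge0 ?norm2_ge0 // mulVf ?gt_eqF // => /(_ (lexx _)).
  rewrite -scalemxAr dotvZl dotvZr !normrM ger0_norm ?invr_ge0 ?norm2_ge0 //.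
  by rewrite expr2 invfM mulrA mulrC.
have cle : c <= beta + c / 2.
  apply: ge_sup; first exact: supS.1.
  move=> _ [x [hx x1] <-].
  have [f fJ xf] := grid_approx Jp hx x1; set z := grid_point f in xf.
  have hz : supported J z := grid_point_supported fJ.
  have z1 : norm2 z <= 1 := norm2_grid_point fJ.
  have e : dotv x (H *m x) = dotv z (H *m z) + dotv (x - z) (H *m (x + z)).
    have zx := symmetric_bilinearC Hsym z x.
    rewrite mulmxDr !(dotvDl, dotvDr, dotvNl) zx; ring.
  rewrite e; apply: le_trans (ler_normD _ _) _; apply: lerD; first exact: hb.
  apply: le_trans (polarization Hsym c0 cq (supportedB hx hz) (supportedD hx hz)) _.
  rewrite ler_wpM2l //.
  have xz : norm2 (x + z) <= 2.
    by apply: le_trans (ler_norm2D _ _) _; have := lerD x1 z1; lra.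
  by have := ler_pM (norm2_ge0 _) (norm2_ge0 _) xf xz; lra.
move=> x hx; apply: le_trans (cq x hx) _; rewrite ler_wpM2r ?sqr_ge0 //; lra.
Qed.

End Grid.
End Net.

(** * Blocks of singular values *)

Section Blocks.
Variable R : realType.

Lemma bernoulli_ineq (m : nat) (y : R) : 0 <= y -> 1 + m%:R * (y - 1) <= y ^+ m.
Proof.
move=> y0; elim: m => [|m IH]; first by rewrite mul0r addr0 expr0.
rewrite exprS; apply: le_trans (ler_wpM2l y0 IH).
rewrite -subr_ge0 -natr1 (_ : _ - _ = m%:R * (y - 1) ^+ 2); last by ring.
by rewrite mulr_ge0 ?sqr_ge0.
Qed.

(** Replaces a maximum by a sum whose mean is accessible. For an empty range b = 0, and m > 0 makes
    its power vanish. *)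
Lemma max_power_le_sum (I : finType) (Q : pred I) (g : I -> R) m : (0 < m)%N ->
  exists b, [/\ 0 <= b, forall i, Q i -> `|g i| <= b &
    b ^+ (2 * m) <= \sum_(i | Q i) g i ^+ (2 * m)].
Proof.
move=> m0; have g0 i : 0 <= g i ^+ (2 * m) by rewrite exprM exprn_ge0 ?sqr_ge0.
have [/existsP[i0 Qi0]|nQ] := boolP [exists i, Q i]; last first.
  exists 0; split=> //.
    by move=> i Qi; move: nQ; rewrite negb_exists => /forallP/(_ i); rewrite Qi.
  rewrite expr0n gtn_eqF ?muln_gt0 //; exact: sumr_ge0.
pose i1 := [arg max_(i > i0 | Q i) `|g i|]%O.
have [Q1 h1] : Q i1 /\ forall i, Q i -> `|g i| <= `|g i1|.
  by rewrite /i1; case: arg_maxP.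
exists `|g i1|; split=> //.
rewrite exprM real_normK ?num_real // -exprM (bigD1 i1) //= lerDl.
by apply: sumr_ge0.
Qed.

Variables (N q : nat).
Hypothesis q0 : (0 < q)%N.

Definition block (a : nat) : {set 'I_N} := [set i : 'I_N | (i %/ q == a)%N]%SET.

Lemma card_block a : (#|block a| <= q)%N.
Proof.
pose r (i : 'I_N) : 'I_q := Ordinal (ltn_pmod i q0).
rewrite -(card_in_imset (f := r)).
  by apply: leq_trans (max_card _) _; rewrite card_ord.
move=> i j; rewrite !finset.inE => /eqP ia /eqP ja /(congr1 val) /= rij.
by apply: val_inj; rewrite /= (divn_eq i q) (divn_eq j q) ia ja rij.
Qed.

Definition mask (a : nat) (x : 'cV[R]_N) : 'cV[R]_N :=
  \col_i (if (i %/ q == a)%N then x i 0 else 0).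

Lemma maskE a x i : mask a x i 0 = if (i %/ q == a)%N then x i 0 else 0.
Proof. by rewrite mxE. Qed.

Lemma mask_supported a x : supported (block a) (mask a x).
Proof. by move=> i; rewrite finset.inE mxE => /negbTE ->. Qed.

Lemma block_ltN (i : 'I_N) : (i %/ q < N)%N.
Proof. by rewrite (leq_ltn_trans (leq_div _ _)). Qed.

Lemma sum_mask x : x = \sum_(a < N) mask a x.
Proof.
apply/matrixP => i j; rewrite ord1 summxE.
rewrite (bigD1 (Ordinal (block_ltN i))) //= mxE eqxx big1 ?addr0 // => a ai.
rewrite mxE; case: eqP => // e; move: ai.
by rewrite -val_eqE /= e eqxx.
Qed.

Lemma sum_norm2_mask x : \sum_(a < N) norm2 (mask a x) ^+ 2 = norm2 x ^+ 2.
Proof.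
rewrite norm2_sqr dotvE; under eq_bigr do rewrite norm2_sqr dotvE.
rewrite exchange_big /=; apply: eq_bigr => i _.
rewrite (bigD1 (Ordinal (block_ltN i))) //= mxE eqxx big1 ?addr0 // => a ai.
rewrite mxE; case: eqP => // [e|_]; last by rewrite mul0r.
by move: ai; rewrite -val_eqE /= e eqxx.
Qed.

Variable s : 'rV[R]_N.
Hypothesis s0 : forall i, 0 <= s 0 i.
Hypothesis sd : forall i j : 'I_N, (i <= j)%N -> s 0 j <= s 0 i.

(** The largest singular value of the block. Sums run over all a < N; blocks that would start past N
    are empty and get the value 0. *)
Definition block_sv (a : nat) : R := nth_sv s (a * q).+1.

Lemma block_sv_ge0 a : 0 <= block_sv a.
Proof. exact: nth_sv_ge0. Qed.

Lemma norm2_mask_diag a x :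
  norm2 (mask a (diag_mx s *m x)) <= block_sv a * norm2 (mask a x).
Proof.
rewrite norm2_leM ?block_sv_ge0 // !dotvE mulr_sumr; apply: ler_sum => i _.
rewrite !maskE; case: eqP => [ia|_]; last by rewrite mul0r mulr0.
rewrite mul_diag_mxE -!expr2 exprMn ler_wpM2r ?sqr_ge0 //.
rewrite ler_sqr ?nnegrE ?block_sv_ge0 // -nth_sv_ord /block_sv nth_sv_homo //.
by rewrite ltnS -ia leq_divM.
Qed.

(** The head of block a + 1 is at most every value in block a, so q times its square is at most the
    sum of squares over block a. The head of block 0 is left over. *)
Lemma sum_block_sv :
  \sum_(a < N) block_sv a ^+ 2 <= nth_sv s 1 ^+ 2 + (\sum_i s 0 i ^+ 2) / q%:R.
Proof.
pose f k := nth_sv s k.+1 ^+ 2.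
have f0 k : 0 <= f k by exact: sqr_ge0.
have fd k l : (k <= l)%N -> f l <= f k.
  by move=> kl; rewrite ler_sqr ?nnegrE ?nth_sv_ge0 // nth_sv_homo.
have fs K : \sum_(k < K) f k <= \sum_i s 0 i ^+ 2.
  have -> : \sum_i s 0 i ^+ 2 = \sum_(k < N) f k.
    by apply: eq_bigr => i _; rewrite /f nth_sv_ord.
  have [KN|NK] := leqP K N.
    rewrite (big_ord_widen_cond N predT f KN) big_mkcond /=.
    by apply: ler_sum => i _; case: ifP.
  rewrite [leRHS](big_ord_widen_cond K predT f (ltnW NK)) [leRHS]big_mkcond /=.
  apply: ler_sum => i _; case: ltnP => // Ni.
  by rewrite /f nth_sv_out // expr0n.
have blk n : q%:R * \sum_(a < n) f (a.+1 * q)%N <= \sum_(k < n * q) f k.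
  elim: n => [|n IH]; first by rewrite !big_ord0 mulr0.
  rewrite big_ord_recr /= mulrDr mulSnr big_split_ord /=; apply: lerD => //.
  rewrite mulr_natl -[X in _ *+ X]card_ord -sumr_const; apply: ler_sum => i _.
  by apply: fd; rewrite leq_add2l ltnW.
have q0' : 0 < q%:R :> R by rewrite ltr0n.
(* [N] occurs in the type of [s], so the case distinction is made on a copy. *)
have [n Nn] : exists n, N = n by exists N.
case: n Nn => [|n] Nn.
  rewrite big1 ?addr_ge0 ?sqr_ge0 // => [|i _].
    by rewrite divr_ge0 ?sumr_ge0 // => i _; exact: sqr_ge0.
  by have := ltn_ord i; rewrite {2}Nn.
have -> : \sum_(a < N) block_sv a ^+ 2 = \sum_(a < n.+1) f (a * q)%N.
  by rewrite -(big_mkord predT (fun a => f (a * q)%N))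
    -(big_mkord predT (fun a => block_sv a ^+ 2)) Nn.
rewrite big_ord_recl /= mul0n lerD2l ler_pdivlMr // mulrC.
by apply: le_trans (blk n) (fs _).
Qed.

Variable H : 'M[R]_N.
Hypothesis Hsym : H^T = H.

(** Its norm is the Frobenius norm of the matrix with entries [block_sv a * block_sv b * Y a b],
    taken row by row. *)
Definition block_weight (Y : 'I_N -> 'I_N -> R) : 'cV[R]_N :=
  \col_a norm2 (\col_b (block_sv a * block_sv b * Y a b)).

(** [polarization] on the union of two blocks bounds each pair; Cauchy-Schwarz over b and then over
    a adds the pairs up to a Frobenius norm. *)
Lemma block_bilinear (Y : 'I_N -> 'I_N -> R) x y :
  (forall a b, 0 <= Y a b) ->
  (forall (a b : 'I_N) z, supported (block a :|: block b) z ->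
     `|dotv z (H *m z)| <= Y a b * norm2 z ^+ 2) ->
  dotv (diag_mx s *m x) (H *m (diag_mx s *m y)) <=
    norm2 (block_weight Y) * norm2 x * norm2 y.
Proof.
move=> Y0 hY; set x' := diag_mx s *m x; set y' := diag_mx s *m y.
have nmask z : norm2 (\col_(a < N) norm2 (mask a z)) = norm2 z.
  apply/eqP; rewrite -(eqrXn2 (n := 2)) ?norm2_ge0 // -(sum_norm2_mask z) norm2_sqr dotvE.
  by apply/eqP; apply: eq_bigr => a _; rewrite !mxE expr2.
have -> : dotv x' (H *m y') = \sum_(a < N) \sum_(b < N) dotv (mask a x') (H *m mask b y').
  rewrite {1}(sum_mask x') dotv_suml; apply: eq_bigr => a _.
  by rewrite {1}(sum_mask y') mulmx_sumr dotv_sumr.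
apply: (@le_trans _ _ (\sum_(a < N) norm2 (mask a x) *
    (norm2 (\col_b (block_sv a * block_sv b * Y a b)) * norm2 y))).
  apply: ler_sum => a _.
  apply: (@le_trans _ _ (norm2 (mask a x) *
      dotv (\col_b (block_sv a * block_sv b * Y a b)) (\col_(b < N) norm2 (mask b y)))).
    rewrite dotvE mulr_sumr; apply: ler_sum => b _; rewrite !mxE.
    apply: le_trans (ler_norm _) _.
    have sub1 : supported (block a :|: block b) (mask a x').
      by apply: (supported_sub _ (@mask_supported a x')) => i; rewrite finset.in_setU => ->.
    have sub2 : supported (block a :|: block b) (mask b y').
      by apply: (supported_sub _ (@mask_supported b y')) => i; rewrite finset.in_setU orbC => ->.
    apply: le_trans (polarization Hsym (Y0 a b) (hY a b) sub1 sub2) _.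
    have m1 := norm2_mask_diag a x; have m2 := norm2_mask_diag b y.
    have := ler_pM (norm2_ge0 _) (norm2_ge0 _) m1 m2.
    move=> /(ler_wpM2l (Y0 a b)) /le_trans; apply.
    by rewrite le_eqVlt; apply/orP; left; apply/eqP; ring.
  rewrite ler_wpM2l ?norm2_ge0 //; apply: le_trans (ler_norm _) _.
  by apply: le_trans (dotv_CS _ _) _; rewrite nmask.
have -> : \sum_(a < N) norm2 (mask a x) *
      (norm2 (\col_b (block_sv a * block_sv b * Y a b)) * norm2 y)
    = dotv (block_weight Y) (\col_(a < N) norm2 (mask a x)) * norm2 y.
  rewrite dotvE mulr_suml; apply: eq_bigr => a _; rewrite !mxE; ring.
rewrite ler_wpM2r ?norm2_ge0 //; apply: le_trans (ler_norm _) _.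
by apply: le_trans (dotv_CS _ _) _; rewrite nmask.
Qed.

(** With t the sum of the squared [block_sv], the squared norm of [block_weight Y] is t^2 times the
    mean of Y^2 under these weights. *)
Definition block_prob (a b : 'I_N) : R :=
  block_sv a ^+ 2 * block_sv b ^+ 2 / (\sum_(c < N) block_sv c ^+ 2) ^+ 2.

Lemma block_prob_ge0 a b : 0 <= block_prob a b.
Proof. by rewrite divr_ge0 ?sqr_ge0 // mulr_ge0 ?sqr_ge0. Qed.

Lemma sum_block_prob : 0 < \sum_(c < N) block_sv c ^+ 2 ->
  \sum_a \sum_b block_prob a b = 1.
Proof.
set t := \sum_(c < N) _ => t0.
rewrite (eq_bigr (fun a : 'I_N => block_sv a ^+ 2 * (t / t ^+ 2))) => [|a _].
  by rewrite -mulr_suml -/t; field; rewrite gt_eqF.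
by rewrite -mulr_suml -mulr_sumr -/t -mulrA.
Qed.

(* Jensen's inequality for the weights block_prob, via Bernoulli's inequality. *)
Lemma block_power (Y : 'I_N -> 'I_N -> R) m (c L : R) :
  0 < c -> \sum_(a < N) block_sv a ^+ 2 <= L -> c <= norm2 (block_weight Y) ->
  1 <= \sum_a \sum_b block_prob a b * (Y a b ^+ 2 * (L ^+ 2 / c ^+ 2)) ^+ m.
Proof.
set t := \sum_(a < N) _ => c0 tL cW.
have t_ge0 : 0 <= t by apply: sumr_ge0 => a _; exact: sqr_ge0.
have W2 : norm2 (block_weight Y) ^+ 2 =
    \sum_(a < N) \sum_(b < N) (block_sv a * block_sv b * Y a b) ^+ 2.
  rewrite norm2_sqr dotvE; apply: eq_bigr => a _; rewrite !mxE -expr2 norm2_sqr dotvE.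
  by apply: eq_bigr => b _; rewrite !mxE expr2.
have cW2 : c ^+ 2 <= norm2 (block_weight Y) ^+ 2.
  by rewrite ler_sqr ?nnegrE ?norm2_ge0 // ltW.
have t0 : 0 < t.
  rewrite lt_def t_ge0 andbT; apply/eqP => t0.
  have z (a : 'I_N) : block_sv a = 0.
    move/eqP: t0; rewrite psumr_eq0 => [|i _]; last exact: sqr_ge0.
    by move=> /allP/(_ a (mem_index_enum _)); rewrite sqrf_eq0 => /eqP.
  move: cW2; rewrite W2 big1 ?leNgt ?exprn_gt0 // => a _.
  by rewrite big1 // => b _; rewrite (z a) !mul0r expr0n.
have p1 := sum_block_prob t0.
pose y a b := Y a b ^+ 2 * (L ^+ 2 / c ^+ 2).
have y0 a b : 0 <= y a b by rewrite mulr_ge0 ?sqr_ge0 // divr_ge0 ?sqr_ge0.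
(* The mean of [y] is at least 1 because c is at most the norm of [block_weight Y] and t <= L. *)
have py : 1 <= \sum_a \sum_b block_prob a b * y a b.
  have -> : \sum_a \sum_b block_prob a b * y a b =
      norm2 (block_weight Y) ^+ 2 * (L ^+ 2 / (t ^+ 2 * c ^+ 2)).
    rewrite W2 mulr_suml; apply: eq_bigr => a _; rewrite mulr_suml.
    apply: eq_bigr => b _; rewrite /block_prob /y -/t; field.
    by rewrite (gt_eqF c0) (gt_eqF t0).
  have L2 : t ^+ 2 <= L ^+ 2 by rewrite ler_sqr ?nnegrE // (le_trans t_ge0).
  rewrite mulrA ler_pdivlMr ?mulr_gt0 ?exprn_gt0 // mul1r mulrC.
  by apply: ler_pM => //; rewrite sqr_ge0.
apply: (@le_trans _ _ (\sum_a \sum_b block_prob a b * (1 + m%:R * (y a b - 1)))); last first.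
  apply: ler_sum => a _; apply: ler_sum => b _.
  by rewrite ler_wpM2l ?block_prob_ge0 // bernoulli_ineq.
rewrite (_ : \sum_a _ = \sum_a \sum_b block_prob a b +
    m%:R * (\sum_a \sum_b block_prob a b * y a b - \sum_a \sum_b block_prob a b)).
  by rewrite p1 lerDl mulr_ge0 // subr_ge0.
rewrite -sumrB mulr_sumr -big_split /=; apply: eq_bigr => a _.
rewrite -sumrB mulr_sumr -big_split /=; apply: eq_bigr => b _; ring.
Qed.

(** [grid_quadratic] loses a factor 2, whence the 4 in front of L^2; two blocks together have at
    most 2 q indices, whence the net parameter. The hypothesis on [w] says that c is at most the
    norm of the form H between diag(s) x and diag(s) y. *)
Lemma block_grid_power m (c L : R) : (0 < m)%N -> 0 < c ->
  \sum_(a < N) block_sv a ^+ 2 <= L ->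
  (forall w, 0 <= w ->
    (forall x y, dotv (diag_mx s *m x) (H *m (diag_mx s *m y)) <= w * norm2 x * norm2 y) ->
    c <= w) ->
  1 <= \sum_a \sum_b block_prob a b * ((4 * L ^+ 2 / c ^+ 2) ^+ m *
    \sum_(f | grid (p := 2 * q) (block a :|: block b) f)
      dotv (grid_point R f) (H *m grid_point R f) ^+ (2 * m)).
Proof.
move=> m0 c0 hL hc.
have p0 : (0 < 2 * q)%N by rewrite muln_gt0.
pose h f := dotv (@grid_point R N (2 * q) f) (H *m grid_point R f).
pose mx (a b : 'I_N) := max_power_le_sum (grid (p := 2 * q) (block a :|: block b)) h m0.
pose be a b := projT1 (cid (mx a b)).
have beP a b : [/\ 0 <= be a b,
    forall f, grid (p := 2 * q) (block a :|: block b) f -> `|h f| <= be a b &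
    be a b ^+ (2 * m) <= \sum_(f | grid (p := 2 * q) (block a :|: block b) f) h f ^+ (2 * m)].
  by rewrite /be; case: cid.
pose Y a b := 2 * be a b.
have Y0 a b : 0 <= Y a b by rewrite mulr_ge0 //; case: (beP a b).
have cY : c <= norm2 (block_weight Y).
  apply: hc => [|x y]; first exact: norm2_ge0.
  apply: block_bilinear => // a b z hz; have [b0 b1 _] := beP a b.
  apply: (grid_quadratic p0 Hsym _ b0 b1 hz).
  apply: leq_trans (leq_card_setU _ _) _.
  by rewrite mul2n -addnn leq_add ?card_block.
apply: le_trans (block_power m c0 hL cY) _.
apply: ler_sum => a _; apply: ler_sum => b _; rewrite ler_wpM2l ?block_prob_ge0 //.
have [_ _ b2] := beP a b.
rewrite (_ : Y a b ^+ 2 * _ = (4 * L ^+ 2 / c ^+ 2) * be a b ^+ 2); last first.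
  by rewrite /Y; field; rewrite gt_eqF.
rewrite exprMn -[(be a b ^+ 2) ^+ m]exprM ler_wpM2l // exprn_ge0 //.
by rewrite divr_ge0 ?sqr_ge0 // mulr_ge0 ?sqr_ge0.
Qed.

End Blocks.

(** * The Gram property of subgaussian maps *)

Section SubgaussianSketch.
Variable R : realType.

(** [th] is set so that 2 m / (th t) = eps / 16; then (16 / eps^2)^m (eps / 16)^(2m) = 16^-m. The
    net with its factor 2 costs at most 2^m by 36 q + 1 <= m, and the mgf at most e^(m/2) <= 2^m.
    There remains 4^-m <= 2^-m <= e^(-m/2) <= delta. In the condition on t, 2048 M ensures M th^2 t
    <= m / 2, and 32 / th0 ensures th <= th0. *)
Lemma block_tail_numeric (eps delta M th0 t : R) (q m : nat) :
  0 < eps <= 1 -> 0 < delta -> 0 < M -> 0 < th0 -> 0 < t -> (36 * q + 1 <= m)%N ->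
  2 * ln (1 / delta) <= m%:R ->
  (2048 * M + 32 / th0) * (m%:R / eps ^+ 2) <= t ->
  let th := 32 * m%:R / (eps * t) in
  [/\ 0 < th, th <= th0 &
  (16 / eps ^+ 2) ^+ m * (2 ^+ (18 * (2 * q)) *
     (((2 * m)%:R / (th * t)) ^+ (2 * m) * (2 * expR (M * th ^+ 2 * t)))) <= delta].
Proof.
move=> /andP[e0 e1] d0 M0 th00 t0 qm lm ht th.
have m0 : (0 < m)%N by rewrite (leq_trans _ qm) // addn1.
have m0' : 0 < m%:R :> R by rewrite ltr0n.
have e20 : 0 < eps ^+ 2 by rewrite exprn_gt0.
have thp : 0 < th by rewrite divr_gt0 ?mulr_gt0.
set E2 := m%:R / eps ^+ 2 in ht.
have E20 : 0 < E2 by rewrite divr_gt0.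
have h1 : 0 < M * E2 by rewrite mulr_gt0.
have h2 : 0 < th0^-1 * E2 by rewrite mulr_gt0 ?invr_gt0.
have ht1 : 2048 * M * E2 <= t by move: ht; rewrite mulrDl -!mulrA; lra.
have ht2 : 32 / th0 * E2 <= t by move: ht; rewrite mulrDl -!mulrA; lra.
split=> //.
  rewrite /th ler_pdivrMr ?mulr_gt0 //.
  move: ht2; rewrite mulrAC ler_pdivrMr // => ht2.
  have : 32 * m%:R / eps <= t * th0.
    apply: le_trans ht2; rewrite /E2 mulrA ler_wpM2l ?mulr_ge0 // lef_pV2 ?posrE //.
    by rewrite expr2 ler_piMr // ltW.
  by rewrite ler_pdivrMr // => /le_trans; apply; rewrite le_eqVlt; apply/orP; left; apply/eqP; ring.
have half : expR (2^-1) <= 2 :> R.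
  have : expR (- 2^-1) >= 1 - 2^-1 :> R by exact: expR_ge1Dx.
  rewrite expRN -[leRHS]mul1r ler_pdivlMr ?expR_gt0 //; lra.
have exph : expR (m%:R / 2) <= 2 ^+ m :> R.
  rewrite mulrC expRM_natr lerXn2r ?nnegrE ?expR_ge0 //.
have hM : expR (M * th ^+ 2 * t) <= 2 ^+ m.
  apply: le_trans exph; rewrite ler_expR.
  have -> : M * th ^+ 2 * t = (2048 * M * E2) * m%:R / (2 * t).
    by rewrite /th /E2; field; rewrite (gt_eqF e0) (gt_eqF t0).
  rewrite ler_pdivrMr ?mulr_gt0 // (_ : m%:R / 2 * (2 * t) = t * m%:R); last by field.
  by rewrite ler_wpM2r // ltW.
have -> : (2 * m)%:R / (th * t) = eps / 16.
  rewrite /th natrM; field.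
  by rewrite (gt_eqF e0) (gt_eqF t0) (gt_eqF m0').
have -> : (16 / eps ^+ 2) ^+ m * (2 ^+ (18 * (2 * q)) *
     ((eps / 16) ^+ (2 * m) * (2 * expR (M * th ^+ 2 * t)))) =
     16 ^- m * (2 ^+ (36 * q + 1) * expR (M * th ^+ 2 * t)).
  have -> : (16 / eps ^+ 2) ^+ m * (2 ^+ (18 * (2 * q)) *
     ((eps / 16) ^+ (2 * m) * (2 * expR (M * th ^+ 2 * t)))) =
    ((16 / eps ^+ 2) ^+ m * (eps / 16) ^+ (2 * m)) *
      (2 ^+ (18 * (2 * q)) * 2 * expR (M * th ^+ 2 * t)).
    by ring.
  congr (_ * _); last by rewrite (_ : (18 * (2 * q) = 36 * q)%N) ?addn1 ?exprSr // mulnA.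
  rewrite exprM -exprMn -[RHS]exprVn; congr (_ ^+ _); field.
  by rewrite gt_eqF.
apply: (@le_trans _ _ (16 ^- m * (2 ^+ m * 2 ^+ m))).
  rewrite ler_wpM2l ?invr_ge0 ?exprn_ge0 //; apply: ler_pM; rewrite ?exprn_ge0 ?expR_ge0 //.
  by rewrite ler_eXn2l ?ltr1n.
apply: (@le_trans _ _ (2 ^- m)).
  rewrite -exprMn -!exprVn -exprMn lerXn2r ?nnegrE ?mulr_ge0 ?invr_ge0 //.
  by rewrite -subr_ge0 (_ : _ - _ = 4^-1) ?invr_ge0 //; field.
rewrite -[leRHS]invrK lef_pV2 ?posrE ?invr_gt0 ?exprn_gt0 //.
apply: le_trans exph; rewrite -(lnK (x := delta^-1)) ?posrE ?invr_gt0 // ler_expR.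
rewrite ler_pdivlMr // mulrC; by rewrite div1r in lm.
Qed.

(** In the coordinates of the singular vectors the error becomes a form weighted by diag(s) on both
    sides, to which the block estimates apply. *)
Lemma gram_error_svd (n d t : nat) (A : 'M[R]_(n, d)) r (U : 'M[R]_(n, r)) s V
    (G : 'M[R]_(t, d)) u v : svd_of A U s V ->
  dotv u (gram_error G A^T *m v) =
  dotv (diag_mx s *m (U^T *m u))
    (V^T *m (G^T *m G - 1%:M) *m V *m (diag_mx s *m (U^T *m v))).
Proof.
move=> [_ _ _ _ AE].
have -> : gram_error G A^T = A *m (G^T *m G - 1%:M) *m A^T.
  by rewrite /gram_error trmxK mulmxBr mulmxBl mulmx1 !mulmxA.
move: (G^T *m G - 1%:M) => K.
rewrite dotv_mull tr_diag_mx dotv_mull trmxK AE; congr dotv.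
by rewrite !trmx_mul trmxK tr_diag_mx !mulmxA.
Qed.

Lemma subgaussian_gram (D : probability (measurableTypeR R) R) : subgaussian_law D ->
  exists2 C : R, 0 < C &
  forall (n d k t : nat) (A : 'M[R]_(n, d)) (nu delta : R)
    (dG : measure_display) (TG : measurableType dG) (PG : probability TG R)
    (G : TG -> 'M[R]_(t, d)),
  (1 <= k)%N -> singular_value A k.+1 < singular_value A k ->
  0 < nu < 1 / 2 -> 0 < delta < 1 / 2 ->
  sketch_with_law PG D G ->
  C * ((stable_rank A + ln (1 / delta)) / (gap k A ^+ 2 * nu ^+ 2)) <= t%:R ->
  gram_property PG G A^T (nu / (1 + nu) * gap k A) delta.
Proof.
move=> subD; have [M [th0 [M0 th00 mgf]]] := sketch_mgf subD.
pose C0 := 2048 * M + 32 / th0.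
have C00 : 0 < C0.
  have : 0 < th0^-1 by rewrite invr_gt0.
  by rewrite /C0; lra.
(* 74 comes from m <= 74 (sr(A) + ln(1/delta)), where sr(A) >= 1 absorbs the additive constants, and
   9/4 from (1 + nu)^2 <= 9/4. *)
exists (C0 * (74 * (9 / 4))); first by move: C00; clearbody C0; lra.
move=> n d k t A nu delta dG TG PG G k1 g /andP[nu0 nu2] /andP[d0 d2] sk ht.
have [A0 g0 g1] := gap_facts k1 g.
have [U [s [V dec]]] := thin_svd_exists g.
have dec' : svd_of A U s V by [].
have [UU VV s0 sd AE] := dec'.
set s1 := nth_sv s 1.
have As1 : spectral_norm A = s1 by exact: svd_spectral_norm dec'.
have s10 : 0 < s1 by rewrite -As1.
have F2 : \sum_i s 0 i ^+ 2 = stable_rank A * s1 ^+ 2.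
  by rewrite -(svd_frobenius dec') /stable_rank As1 divfK // sqrf_eq0 gt_eqF.
have sr1 : 1 <= stable_rank A.
  rewrite /stable_rank ler_pdivlMr ?exprn_gt0 // mul1r ler_sqr ?nnegrE ?(ltW A0) ?sqrtr_ge0 //.
  exact: spectral_norm_le_frobenius.
move: (gap k A) g0 g1 ht => gp g0 g1 ht.
have nu1 : 0 < 1 + nu by rewrite addr_gt0.
rewrite /gram_property; set eps := nu / (1 + nu) * gp.
have e0 : 0 < eps by rewrite /eps mulr_gt0 // divr_gt0.
have e1 : eps <= 1.
  rewrite -[leRHS]mul1r; apply: ler_pM => //; rewrite ?(ltW g0) ?divr_ge0 ?(ltW nu0) ?(ltW nu1) //.
  by rewrite ler_pdivrMr // mul1r lerDr.
have e2 : 4 / 9 * (gp ^+ 2 * nu ^+ 2) <= eps ^+ 2.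
  have -> : eps ^+ 2 = (1 + nu) ^- 2 * (gp ^+ 2 * nu ^+ 2).
    by rewrite /eps; field; rewrite gt_eqF.
  have X0 : 0 <= gp ^+ 2 * nu ^+ 2 by apply: mulr_ge0; exact: sqr_ge0.
  rewrite (ler_wpM2r X0) //.
  have -> : 4 / 9 = (9 / 4)^-1 :> R by field.
  rewrite lef_pV2 ?posrE ?exprn_gt0 //; nra.
have ln0 : 0 <= ln (1 / delta).
  by rewrite ln_ge0 // ler_pdivlMr // mul1r; lra.
(* q exceeds sr(A), so |A|_F^2 / q <= s1^2 and the squared block heads sum to at most 2 s1^2. *)
pose q := (Num.truncn (stable_rank A)).+1.
have q0 : (0 < q)%N by [].
have /andP[sq1 sq2] := truncn_itv (le_trans ler01 sr1).
(* 36 q + 1 pays for the net and the two signs of the mgf; the last unit rounds 2 ln(1/delta) up. *)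
pose m := (36 * q + 2 + Num.truncn (2 * ln (1 / delta)))%N.
have ln20 : 0 <= 2 * ln (1 / delta) by rewrite mulr_ge0.
have /andP[lt1 lt2] := truncn_itv ln20.
have m0 : (0 < m)%N by rewrite /m addnAC addn2.
have qm : (36 * q + 1 <= m)%N by rewrite /m -addnA leq_add2l.
have lm : 2 * ln (1 / delta) <= m%:R.
  apply: le_trans (ltW lt2) _; rewrite ler_nat /m -addn1 addnC leq_add2r.
  by rewrite addn2.
have mle : m%:R <= 74 * (stable_rank A + ln (1 / delta)).
  rewrite /m !natrD natrM /q -natr1; lra.
have gn0 : 0 < gp ^+ 2 * nu ^+ 2 by rewrite mulr_gt0 ?exprn_gt0.
have ht' : C0 * (m%:R / eps ^+ 2) <= t%:R.
  apply: le_trans ht; rewrite -mulrA ler_wpM2l ?(ltW C00) //.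
  rewrite ler_pdivrMr ?exprn_gt0 //.
  apply: le_trans mle _.
  rewrite [leRHS](_ : _ = 74 * (stable_rank A + ln (1 / delta)) *
    ((4 / 9 * (gp ^+ 2 * nu ^+ 2))^-1 * eps ^+ 2)); last first.
    by field; rewrite ?(gt_eqF g0) ?(gt_eqF nu0) ?(gt_eqF nu1).
  rewrite ler_peMr ?mulr_ge0 ?addr_ge0 ?(le_trans ler01 sr1) //.
  by rewrite mulrC ler_pdivlMr ?mulr_gt0 // mul1r.
have t0 : 0 < t%:R :> R.
  by apply: lt_le_trans ht'; rewrite mulr_gt0 // divr_gt0 ?exprn_gt0 // ltr0n.
have t0' : (0 < t)%N by rewrite -(ltr0n R).
have e01 : 0 < eps <= 1 by rewrite e0 e1.
have [thp thle final] := block_tail_numeric e01 d0 M0 th00 t0 qm lm ht'.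
set th := 32 * m%:R / (eps * t%:R) in thp thle final.
have mG : random_matrix G.
  have [Z [mZ _ _ GZ]] := sk; move=> i j.
  rewrite (_ : (fun w => G w i j) = fun w => (Num.sqrt t%:R)^-1 * Z (i, j) w).
    exact: measurable_funZ.
  by apply/funext => w; rewrite GZ mxE.
pose H w := V^T *m ((G w)^T *m G w - 1%:M) *m V.
have Hsym w : (H w)^T = H w.
  by rewrite /H !trmx_mul trmxK linearB /= trmx1 trmx_mul trmxK mulmxA.
have qf w z : dotv z (H w *m z) = norm2 (G w *m (V *m z)) ^+ 2 - norm2 (V *m z) ^+ 2.
  rewrite /H -!mulmxA dotv_mulr trmxK mulmxBl mul1mx dotvBr !norm2_sqr; congr (_ - _).
  by rewrite -mulmxA [in LHS]dotv_mulr trmxK.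
set c := eps * spectral_norm A^T ^+ 2.
have cE : c = eps * s1 ^+ 2 by rewrite /c spectral_norm_tr As1.
have c0 : 0 < c by rewrite cE mulr_gt0 ?exprn_gt0.
pose L := 2 * s1 ^+ 2.
have hL : \sum_(a < minn n d) block_sv q s a ^+ 2 <= L.
  apply: le_trans (sum_block_sv q0 s0 sd) _.
  rewrite F2 -/s1 /L mulr2n mulrDl mul1r lerD2l ler_pdivrMr ?ltr0n // mulrC.
  by rewrite ler_wpM2l ?sqr_ge0 // ltW.
have Lc : 4 * L ^+ 2 / c ^+ 2 = 16 / eps ^+ 2.
  by rewrite cE /L; field; rewrite (gt_eqF e0) (gt_eqF s10).
(* The variable for Markov's inequality: at least 1 on the bad event, with mean at most delta. *)
pose F w := \sum_a \sum_b block_prob q s a b * ((4 * L ^+ 2 / c ^+ 2) ^+ m *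
    \sum_(f | grid (p := 2 * q) (block (minn n d) q a :|: block (minn n d) q b) f)
      dotv (grid_point R f) (H w *m grid_point R f) ^+ (2 * m)).
pose mom := ((2 * m)%:R / (th * t%:R)) ^+ (2 * m) * (2 * expR (M * th ^+ 2 * t%:R)).
have mom0 : 0 <= mom.
  have tt0 := mulr_ge0 (ltW thp) (ltW t0).
  apply: mulr_ge0; first by apply: exprn_ge0; apply: divr_ge0.
  by apply: mulr_ge0 => //; exact: expR_ge0.
have meanq a b f : grid (p := 2 * q) (block (minn n d) q a :|: block (minn n d) q b) f ->
    mean_le PG (fun w => dotv (grid_point R f) (H w *m grid_point R f) ^+ (2 * m)) mom.
  move=> hf; have p0 : (0 < 2 * q)%N by rewrite muln_gt0.
  have u1 : norm2 (V *m grid_point R f) <= 1.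
    by rewrite isometry_norm2 //; exact: (norm2_grid_point R p0 hf).
  have mq : measurable_fun setT (fun w => dotv (grid_point R f) (H w *m grid_point R f)).
    under eq_fun do rewrite qf norm2_sqr.
    have mGv : random_matrix (fun w => G w *m (V *m grid_point R f)).
      by apply: random_matrix_mul => //; exact: random_matrix_cst.
    by apply: measurable_funB => //; exact: measurable_dotv.
  apply: even_moment m0 (mulr_gt0 thp t0) mq _ _.
    have := mgf _ _ _ _ _ _ sk t0' _ th u1; rewrite (gtr0_norm thp) => /(_ thle).
    by under [X in _ -> mean_le _ X _]eq_fun do rewrite qf.
  have := mgf _ _ _ _ _ _ sk t0' _ (- th) u1; rewrite normrN (gtr0_norm thp) => /(_ thle).
  rewrite sqrrN; under [X in _ -> mean_le _ X _]eq_fun do rewrite qf -mulNr.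
  by [].
have meanF : mean_le PG F (\sum_(a < minn n d) \sum_(b < minn n d) block_prob q s a b *
    ((4 * L ^+ 2 / c ^+ 2) ^+ m *
    \sum_(f | grid (p := 2 * q) (block (minn n d) q a :|: block (minn n d) q b) f) mom)).
  apply: mean_le_sum => a _; apply: mean_le_sum => b _.
  apply: mean_leZ; first exact: block_prob_ge0.
  apply: mean_leZ; first by rewrite Lc exprn_ge0 // divr_ge0 ?sqr_ge0.
  by apply: mean_le_sum => f; exact: meanq.
have bndF : \sum_(a < minn n d) \sum_(b < minn n d) block_prob q s a b *
    ((4 * L ^+ 2 / c ^+ 2) ^+ m *
    \sum_(f | grid (p := 2 * q) (block (minn n d) q a :|: block (minn n d) q b) f) mom) <= delta.
  apply: (@le_trans _ _ (\sum_(a < minn n d) \sum_(b < minn n d) block_prob q s a b * delta)).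
    apply: ler_sum => a _; apply: ler_sum => b _.
    rewrite ler_wpM2l ?block_prob_ge0 //; apply: le_trans final.
    rewrite Lc ler_wpM2l ?exprn_ge0 ?divr_ge0 ?sqr_ge0 //.
    rewrite sumr_const -[leLHS]mulr_natl -/mom; apply: ler_wpM2r => [|]; first exact: mom0.
    apply: card_grid.
    apply: leq_trans (leq_card_setU _ _) _.
    by rewrite mul2n -addnn leq_add ?card_block.
  (* If all heads vanish, division by 0 makes every weight 0; otherwise the weights sum to 1. *)
  have [t00|t00] := eqVneq (\sum_(a < minn n d) block_sv q s a ^+ 2) 0.
    rewrite big1 ?(ltW d0) // => a _; rewrite big1 // => b _.
    by rewrite /block_prob t00 expr0n /= invr0 mulr0 mul0r.
  under eq_bigr do rewrite -mulr_suml.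
  rewrite -mulr_suml sum_block_prob ?mul1r // lt_def t00 sumr_ge0 // => a _.
  exact: sqr_ge0.
apply: (mean_le_tail _ (mean_le_trans bndF meanF)).
  exact: measurable_gram_event.
move=> w /= hw.
(* By Bessel's inequality for U^T u and U^T v, any bound [W] of the weighted form bounds the
   spectral norm of the error. *)
apply: (block_grid_power q0 s0 sd (Hsym w) m0 c0 hL) => W W0 hW.
apply: le_trans hw _; apply: spectral_norm_le_bilinear => // u v.
rewrite (gram_error_svd (G w) u v dec').
apply: le_trans (hW _ _) _; rewrite -!mulrA ler_wpM2l //.
by apply: ler_pM; rewrite ?norm2_ge0 // bessel.
Qed.

End SubgaussianSketch.

Theorem theorem15 (R : realType) :
  (forall (n d k t : nat) (A : 'M[R]_(n, d))
      (U : 'M[R]_(n, minn n d)) (s : 'rV[R]_(minn n d)) (V : 'M[R]_(d, minn n d))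
      (f : 'cV[R]_n) (tau nu delta : R)
      (dX : measure_display) (TX : measurableType dX) (PX : probability TX R)
      (xi : TX -> 'cV[R]_n)
      (dG : measure_display) (TG : measurableType dG) (PG : probability TG R)
      (G : TG -> 'M[R]_(t, d)),
    let b := fun w => f + xi w in
    (1 <= k)%N -> (k <= \rank A)%N ->
    singular_value A k.+1 < singular_value A k ->
    thin_svd A U s V ->
    fixed_design_noise PX xi tau ->
    0 < nu < 1 / 2 -> 0 < delta < 1 / 2 ->
    random_matrix G ->
    gram_property PG G A^T (nu / (1 + nu) * gap k A) delta ->
    exists2 E : set TG, measurable E /\ ((1 - delta)%:E <= PG E)%E &
      forall g, E g ->
      let S := (G g)^T in
      forall (U' : 'M[R]_(n, minn n t)) (s' : 'rV[R]_(minn n t))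
             (V' : 'M[R]_(t, minn n t)),
        thin_svd (A *m S) U' s' V' ->
        (forall w, approx_pcp A U V k nu nu (b w)
                     (A *m sketched_pcr_solution A S V' k (b w))) /\
        (excess_risk PX A b (fun w => sketched_pcr_solution A S V' k (b w))
          <= excess_risk PX A b (fun w => pcr_solution A V k (b w))
             + ((2 * nu + nu ^+ 2) * norm2 f ^+ 2 / n%:R)%:E)%E)
  /\
  (exists2 C : R, 0 < C &
    forall (n d k t : nat) (A : 'M[R]_(n, d)) (nu delta : R)
      (dG : measure_display) (TG : measurableType dG) (PG : probability TG R)
      (G : TG -> 'M[R]_(t, d)),
    (1 <= k)%N -> (k <= \rank A)%N ->
    singular_value A k.+1 < singular_value A k ->
    0 < nu < 1 / 2 -> 0 < delta < 1 / 2 ->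
    countsketch PG G ->
    C * (stable_rank A ^+ 2 / (gap k A ^+ 2 * nu ^+ 2 * delta)) <= t%:R ->
    gram_property PG G A^T (nu / (1 + nu) * gap k A) delta)
  /\
  (forall D : probability (measurableTypeR R) R, subgaussian_law D ->
    exists2 C : R, 0 < C &
    forall (n d k t : nat) (A : 'M[R]_(n, d)) (nu delta : R)
      (dG : measure_display) (TG : measurableType dG) (PG : probability TG R)
      (G : TG -> 'M[R]_(t, d)),
    (1 <= k)%N -> (k <= \rank A)%N ->
    singular_value A k.+1 < singular_value A k ->
    0 < nu < 1 / 2 -> 0 < delta < 1 / 2 ->
    sketch_with_law PG D G ->
    C * ((stable_rank A + ln (1 / delta)) / (gap k A ^+ 2 * nu ^+ 2)) <= t%:R ->
    gram_property PG G A^T (nu / (1 + nu) * gap k A) delta).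
Proof.
split; [|split].
- move=> n d k t A U s V f tau nu delta dX TX PX xi dG TG PG G b k1 _ g dec noise
    /andP[nu0 _] _ mG gram.
  have [E [mE PE] hE] := right_sketch_event mG gram.
  exists E => // w Ew S U' s' V' dec'.
  exact: (right_sketch f k1 g dec noise nu0 (hE w Ew) dec').
- exists 5 => // n d k t A nu delta dG TG PG G k1 _ g nu01 /andP[d0 _] cs ht.
  exact: (countsketch_gram k1 g nu01 d0 cs ht).
- move=> D subD; have [C C0 hC] := subgaussian_gram subD.
  exists C => // n d k t A nu delta dG TG PG G k1 _ g nu01 d01 sk ht.
  exact: (hC _ _ _ _ _ _ _ _ _ _ _ k1 g nu01 d01 sk ht).
Qed.
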